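(* For every $\alpha\in[0,1)$ there exists a function $\psi\in L^2(\mathbb{R})\setminus\{0\}$ with compact support (in the time domain, i.e. $\psi$ itself has compact support) that is admissible with respect to the parameter $\alpha$.
   Context: For $x,\omega\in\mathbb{R}$ and $a>0$ define the following unitary operators on $L^2(\mathbb{R})$: translation $T_xf(t)=f(t-x)$, modulation $M_\omega f(t)=e^{2\pi i\omega t}f(t)$, dilation $D_af(t)=\frac{1}{\sqrt a}f(\frac{t}{a})$. For $\alpha\in[0,1)$ set $\beta(\omega)=(1+|\omega|)^{-\alpha}$, $\omega\in\mathbb{R}$. For $\psi\in L^2(\mathbb{R})\setminus\{0\}$ and $(x,\omega)\in\mathbb{R}^2$ put $\psi_{x,\omega}=T_xM_\omega D_{\beta(\omega)}\psi$. (This is $\pi(\sigma(x,\omega))\psi$, where $\pi(x,\omega,a,\tau)=e^{2\pi i\tau}T_xM_\omega D_a$ is the Stone-Von Neumann representation of the affine Weyl-Heisenberg group $G_{aWH}=\mathbb{R}^2\times\mathbb{R}_+\times\mathbb{R}$, and $\sigma(x,\omega)=(x,\omega,\beta(\omega),0)$ is a section of the quotient $G_{aWH}/H\simeq\mathbb{R}^2$, $H=\{(0,0,a,\tau)\}$, equipped with the invariant measure $dx\,d\omega$.) Define the operator $A_{\sigma,\psi}$ weakly by $$A_{\sigma,\psi}f=\int_{\mathbb{R}}\int_{\mathbb{R}}\langle f,\psi_{x,\omega}\rangle\,\psi_{x,\omega}\,dx\,d\omega,$$ i.e. $\langle A_{\sigma,\psi}f,g\rangle=\int_{\mathbb{R}}\int_{\mathbb{R}}\langle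 f,\psi_{x,\omega}\rangle\langle\psi_{x,\omega},g\rangle\,dx\,d\omega$. The function $\psi$ is called admissible (with respect to $\alpha$) if $A_{\sigma,\psi}$ is a bounded and boundedly invertible operator on $L^2(\mathbb{R})$. *)

(* Defs.v *)
From HB Require Import structures.
From mathcomp Require Import all_boot all_order all_algebra.
From mathcomp Require Import all_classical all_reals all_analysis.
From mathcomp Require Import complex.
Import Order.TTheory GRing.Theory Num.Theory.
Import numFieldNormedType.Exports.

Set Implicit Arguments.
Unset Strict Implicit.
Unset Printing Implicit Defensive.

Local Open Scope classical_set_scope.
Local Open Scope ring_scope.
Local Open Scope complex_scope.

(* The library's integral and Lp spaces are for real-valued
   functions, so complex-valued functions are integrated componentwise. *)
Section ComplexIntegral.
Context d (T : measurableType d) (R : realType).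
Variable mu : {measure set T -> \bar R}.

Definition cmeasurable (f : T -> R[i]) : Prop :=
  measurable_fun [set: T] (fun t => complex.Re (f t)) /\
  measurable_fun [set: T] (fun t => complex.Im (f t)).

Definition cintegrable (f : T -> R[i]) : Prop :=
  mu.-integrable [set: T] (fun t => (complex.Re (f t))%:E) /\
  mu.-integrable [set: T] (fun t => (complex.Im (f t))%:E).

(* Meaningful only when [cintegrable f]: [Rintegral] is 0 on infinite values. *)
Definition cintegral (f : T -> R[i]) : R[i] :=
  Rintegral mu [set: T] (fun t => complex.Re (f t)) +i*
  Rintegral mu [set: T] (fun t => complex.Im (f t)).

End ComplexIntegral.

Section L2.
Variable R : realType.

Local Notation mu := (@lebesgue_measure R).

(* Elements of L^2(R) are handled through representatives: [L2 f] says that f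
   represents an element of L^2(R), and two representatives are identified when
   they are equal almost everywhere. *)
Definition L2 (f : R -> R[i]) : Prop :=
  cmeasurable (f : measurableTypeR R -> R[i]) /\
  finite_norm mu 2%:E (@Normc.normc R \o f).

Definition L2norm (f : R -> R[i]) : \bar R :=
  'N[mu]_(2%:E)[EFin \o (@Normc.normc R \o f)]%E.

(* Linear in the first argument, antilinear in the second. *)
Definition inner (f g : R -> R[i]) : R[i] :=
  cintegral mu (fun t => f t * (g t)^*).

(* Bounded linear operators on L^2(R). Compatibility with almost everywhere
   equality follows from the linearity and boundedness clauses. *)
Definition bounded_op (A : (R -> R[i]) -> (R -> R[i])) : Prop :=
  [/\ forall f, L2 f -> L2 (A f),
      forall (c : R[i]) f g, L2 f -> L2 g ->
        {ae mu, forall t, A (fun s => c * f s + g s) t = c * A f t + A g t}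
    & exists C : R, forall f, L2 f -> (L2norm (A f) <= C%:E * L2norm f)%E].

Definition boundedly_invertible (A : (R -> R[i]) -> (R -> R[i])) : Prop :=
  exists B, [/\ bounded_op B,
    forall f, L2 f -> {ae mu, forall t, B (A f) t = f t}
  & forall f, L2 f -> {ae mu, forall t, A (B f) t = f t}].

Definition cis (theta : R) : R[i] := cos theta +i* sin theta.

Definition translation (x : R) (f : R -> R[i]) : R -> R[i] :=
  fun t => f (t - x).

Definition modulation (w : R) (f : R -> R[i]) : R -> R[i] :=
  fun t => cis (2 * pi * w * t) * f t.

Definition dilation (a : R) (f : R -> R[i]) : R -> R[i] :=
  fun t => ((Num.sqrt a)^-1)%:C * f (t / a).

Definition beta (alpha w : R) : R := (1 + `|w|) `^ (- alpha).

Definition atom (alpha : R) (psi : R -> R[i]) (x w : R) : R -> R[i] :=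
  translation x (modulation w (dilation (beta alpha w) psi)).

(* A is the operator weakly defined by
     <A f, g> = \int\int <f, psi_{x,w}> <psi_{x,w}, g> dx dw.
   The double integral is required to converge absolutely, so that it may be
   taken with respect to the product measure dx dw on R^2. *)
Definition represents_frame_operator (alpha : R) (psi : R -> R[i])
    (A : (R -> R[i]) -> (R -> R[i])) : Prop :=
  forall f g, L2 f -> L2 g ->
    let F (p : R * R) := inner f (atom alpha psi p.1 p.2) *
                         inner (atom alpha psi p.1 p.2) g in
    cintegrable (mu \x mu)%E F /\ inner (A f) g = cintegral (mu \x mu)%E F.

Definition admissible (alpha : R) (psi : R -> R[i]) : Prop :=
  exists A, [/\ represents_frame_operator alpha psi A,
                bounded_op A & boundedly_invertible A].

Definition compactly_supported (f : R -> R[i]) : Prop :=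
  compact (closure [set t | f t != 0]).

End L2.

(* Main.v *)
Require Import Defs.
From HB Require Import structures.
From mathcomp Require Import all_boot all_order all_algebra.
From mathcomp Require Import all_classical all_reals all_analysis.
From mathcomp Require Import measurable_realfun complex ring lra.
Import Order.TTheory GRing.Theory Num.Theory.
Import numFieldNormedType.Exports.

(** The window is the indicator function of [[0, a]] with [a] large. For it the
frame operator is [A f = a f + k * f], where the real kernel [k] is integrable
with norm at most [24 a^p / p], [p = (1 - alpha) / 2]. Since [p <= 1/2], this
norm is smaller than [a] once [a] is large. Then [f + (k / a) * f] is inverted
by [f + r * f], where [r] is the sum of the Neumann series of [k / a] in the
convolution algebra ([neumann_kernel]), and both operators are bounded on
[L^2] by Young's inequality ([sqint_conv]).

The formula for [A] comes from integrating the product of the coefficients of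
[f] and [g] over [x] first. This gives the integral over [u] of
[corr f g u * cos (2 pi w u) * overlap w u], where [corr f g] is the
cross-correlation of [f] and [g], and [overlap w u], the autocorrelation of the
dilated window, is the positive part of [a - |u| (1 + |w|)^alpha]. Integrating
over [w] should therefore produce the cosine transform in [w] of [overlap w u]
as the kernel of [A]: a Dirac mass of weight [a] at the origin, because
[overlap w 0 = a] for all [w], plus [k]. The two parts are separated by
inserting the factor [expR (- e |w|)], which makes every integral absolutely
convergent ([weighted_form]). With [overlap 0 u] in place of [overlap w u] the
regularized kernel is the Poisson kernel times [overlap 0 u], an approximate
identity ([poisson_cvg]) that yields [a f], because cross-correlations are
continuous at the origin ([corr_cvg]). The difference is bounded, uniformly in
[e], by [12 |u|^(p - 1)] on [[- a, a]]; this follows from two integrations by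
parts in [w] ([damped_integral_bound], [smoothed_kernel_bound]), and its
pointwise limit is [k] ([limit_kernel]).

As [e] tends to 0, Fatou's lemma for [f = g] shows that the coefficients are
square integrable on the plane ([sqint_coef]); dominated convergence then
gives the identity for all [f] and [g] ([frame_kernel]). The computation is
done for real functions. Complex functions are split into real and imaginary
parts; the form which couples cosine with sine coefficients is odd in [w] and
integrates to 0 ([Rint_form_im]). *)

Set Implicit Arguments.
Unset Strict Implicit.
Unset Printing Implicit Defensive.

Local Open Scope classical_set_scope.
Local Open Scope ring_scope.

Local Notation integ m f := (m.-integrable setT (EFin \o f)).

(** * Integrals of real-valued functions *)

Section generic.
Context d (T : measurableType d) (R : realType) (m : {measure set T -> \bar R}).
Implicit Types f g : T -> R.

Lemma integ_meas f : integ m f -> measurable_fun setT f.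
Proof. by move=> /measurable_int /measurable_EFinP. Qed.

Lemma integ_dom f g : measurable_fun setT f -> integ m g ->
  (forall x, `|f x| <= g x) -> integ m f.
Proof.
move=> mf ig fg; apply: (le_integrable _ _ _ ig) => //=.
  exact/measurable_EFinP.
by move=> x _; rewrite lee_fin (le_trans (fg x))// ler_norm.
Qed.

Lemma integP f : measurable_fun setT f ->
  integ m f <-> (\int[m]_x (`|f x|)%:E < +oo)%E.
Proof.
move=> mf; split => [/integrableP[_]//|h].
by apply/integrableP; split => //; exact/measurable_EFinP.
Qed.

Lemma integ_norm f : integ m f -> integ m (fun x => `|f x|).
Proof. by move=> /integrable_norm. Qed.

Lemma integD f g : integ m f -> integ m g -> integ m (fun x => f x + g x).
Proof. by move=> h1 h2; exact: (integrableD measurableT h1 h2). Qed.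

Lemma integB f g : integ m f -> integ m g -> integ m (fun x => f x - g x).
Proof. by move=> h1 h2; exact: (integrableB measurableT h1 h2). Qed.

Lemma integZ c f : integ m f -> integ m (fun x => c * f x).
Proof. by move=> h1; exact: (integrableZl measurableT c h1). Qed.

Lemma integZr c f : integ m f -> integ m (fun x => f x * c).
Proof. by move=> h1; exact: (integrableZr measurableT c h1). Qed.

Lemma EFin_Rintegral f : integ m f ->
  ((\int[m]_x f x)%R)%:E = (\int[m]_x (f x)%:E)%E.
Proof. by move=> h; rewrite fineK// integrable_fin_num. Qed.

Lemma le_Rint f g : integ m f -> integ m g -> (forall x, f x <= g x) ->
  \int[m]_x f x <= \int[m]_x g x.
Proof. by move=> *; exact: le_Rintegral. Qed.

Lemma ae_eq_Rint f g : measurable_fun setT f -> measurable_fun setT g ->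
  {ae m, forall x, f x = g x} -> \int[m]_x f x = \int[m]_x g x.
Proof.
move=> mf mg fg; congr fine; apply: ae_eq_integral => //.
- exact/measurable_EFinP.
- exact/measurable_EFinP.
- by move: fg; apply: filterS => x /= ->.
Qed.

Lemma ae_eq_integ f g : measurable_fun setT g ->
  {ae m, forall x, f x = g x} -> integ m f -> integ m g.
Proof.
move=> mg fg if_; apply/(integP mg).
rewrite (ae_eq_integral (fun x => (`|f x|)%:E)) //.
- by apply/(integP (integ_meas if_)).
- by apply/measurable_EFinP/measurableT_comp.
- by apply/measurable_EFinP/measurableT_comp => //; exact: integ_meas if_.
- by move: fg; apply: filterS => x /= ->.
Qed.

Lemma dominated_cvgR (f_ : nat -> T -> R) f g :
  (forall n, measurable_fun setT (f_ n)) -> measurable_fun setT f ->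
  {ae m, forall x, f_ n x @[n --> \oo] --> f x} -> integ m g ->
  (forall n, {ae m, forall x, `|f_ n x| <= g x}) ->
  integ m f /\ (\int[m]_x f_ n x) @[n --> \oo] --> \int[m]_x f x.
Proof.
move=> mf_ mf cv ig dom.
have igf : forall n, integ m (f_ n).
  move=> n; apply/(integP (mf_ n)).
  apply: (@le_lt_trans _ _ (\int[m]_x (`|g x|)%:E)%E); last first.
    by apply/integP => //; exact: integ_meas.
  apply: ae_ge0_le_integral => //.
  - by apply/measurable_EFinP/measurableT_comp.
  - by apply/measurable_EFinP/measurableT_comp => //; exact: integ_meas.
  - move: (dom n); apply: filterS => x h _; rewrite lee_fin.
    by rewrite (le_trans h) ?ler_norm.
have [] := @dominated_convergence _ _ _ m _ measurableT
  (fun n => EFin \o f_ n) (EFin \o f) (EFin \o g) _ _ _ ig _.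
- by move=> n; exact/measurable_EFinP.
- exact/measurable_EFinP.
- by move: cv; apply: filterS => x h _; exact: cvg_EFin (nearW _ _) h.
- apply: ae_foralln => n; move: (dom n); apply: filterS => x h _.
  by rewrite lee_fin.
move=> if_ _ cvi; split => //.
by apply: fine_cvg; rewrite EFin_Rintegral.
Qed.

End generic.

Section fubini.
Context d1 d2 (T1 : measurableType d1) (T2 : measurableType d2) (R : realType).
Context (m1 : {sigma_finite_measure set T1 -> \bar R}).
Context (m2 : {sigma_finite_measure set T2 -> \bar R}).
Implicit Types F : T1 * T2 -> R.

Lemma measurable_Rint_snd F : measurable_fun setT F ->
  measurable_fun setT (fun x => \int[m2]_y F (x, y)).
Proof.
move=> mF; apply: measurableT_comp; first exact: fine_measurable.
under eq_fun do rewrite integralE.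
apply: emeasurable_funB.
- have mp : measurable_fun setT ((EFin \o F)^\+)%E.
    exact/measurable_funepos/measurable_EFinP.
  have := measurable_fun_fubini_tonelli_F (m2 := m2) _ mp (fun z => funepos_ge0 _ z).
  apply: eq_measurable_fun => x _; apply: eq_integral => y _.
  by rewrite !funeposE.
- have mn : measurable_fun setT ((EFin \o F)^\-)%E.
    exact/measurable_funeneg/measurable_EFinP.
  have := measurable_fun_fubini_tonelli_F (m2 := m2) _ mn (fun z => funeneg_ge0 _ z).
  apply: eq_measurable_fun => x _; apply: eq_integral => y _.
  by rewrite !funenegE.
Qed.

(** The inner integrals are real numbers, equal to 0 where the section is not
integrable; this happens on a null set only, so the iterated integral is
unaffected. *)
Lemma RFubini1 F : integ (m1 \x m2)%E F ->
  integ m1 (fun x => \int[m2]_y F (x, y)) /\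
  \int[m1]_x (\int[m2]_y F (x, y)) = \int[(m1 \x m2)%E]_z F z.
Proof.
move=> iF.
have mF : measurable_fun setT F by exact: integ_meas iF.
have ae1 : ae_eq m1 setT (EFin \o (fun x => \int[m2]_y F (x, y)))
  (fubini_F m2 (EFin \o F)).
  have := ae_integrable1 iF; apply: filterS => x h _ /=.
  by rewrite EFin_Rintegral.
have mm := measurable_Rint_snd mF.
split; last first.
  rewrite /Rintegral -integral12_prod_meas1//; congr fine.
  apply: ae_eq_integral => //; first exact/measurable_EFinP.
  exact: (measurable_fubini_F iF).
have [_ h] := integrableP _ _ _ (integrable_fubini_F iF).
apply/integP => //; rewrite (le_lt_trans _ h)//.
apply: ae_ge0_le_integral => //.
- by apply/measurable_EFinP/measurableT_comp.
- by apply: measurableT_comp => //; exact: (measurable_fubini_F iF).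
- by move: ae1; apply: filterS => x /(_ I) /= <- _.
Qed.

End fubini.

Section fubini2.
Context d1 d2 (T1 : measurableType d1) (T2 : measurableType d2) (R : realType).
Context (m1 : {sigma_finite_measure set T1 -> \bar R}).
Context (m2 : {sigma_finite_measure set T2 -> \bar R}).
Implicit Types F : T1 * T2 -> R.

Lemma measurable_Rint_fst F : measurable_fun setT F ->
  measurable_fun setT (fun y => \int[m1]_x F (x, y)).
Proof.
move=> mF; apply: (measurable_Rint_snd m1 (F := F \o unstable.swap)).
by apply: measurableT_comp => //; exact: measurable_swap.
Qed.

Lemma RFubini2 F : integ (m1 \x m2)%E F ->
  integ m2 (fun y => \int[m1]_x F (x, y)) /\
  \int[m2]_y (\int[m1]_x F (x, y)) = \int[(m1 \x m2)%E]_z F z.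
Proof.
move=> iF.
have mF : measurable_fun setT F by exact: integ_meas iF.
have ae1 : ae_eq m2 setT (EFin \o (fun y => \int[m1]_x F (x, y)))
  (fubini_G m1 (EFin \o F)).
  have := ae_integrable2 iF; apply: filterS => x h _ /=.
  by rewrite EFin_Rintegral.
have mm := measurable_Rint_fst mF.
split; last first.
  rewrite /Rintegral -integral21_prod_meas1//; congr fine.
  apply: ae_eq_integral => //; first exact/measurable_EFinP.
  exact: (measurable_fubini_G iF).
have h := (integrable21ltyP m1 m2 ((measurable_EFinP _ _).2 mF)).1 iF.
apply/integP => //; rewrite (le_lt_trans _ h)//.
apply: ae_ge0_le_integral => //.
- by apply/measurable_EFinP/measurableT_comp.
- by move=> y _; exact: integral_ge0.
- apply: (@measurable_fun_fubini_tonelli_G _ _ _ _ _ m1 (abse \o (EFin \o F))) => [|z] //.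
    by do 2 apply: measurableT_comp => //.
  exact: abse_ge0.
- move: ae1; apply: filterS => y /(_ I) /= h1 _.
  rewrite -abse_EFin h1; apply: le_abse_integral => //.
  by apply/measurable_EFinP; exact: (measurable_fun_pair1 y mF).
Qed.

Lemma RFubini F : integ (m1 \x m2)%E F ->
  \int[m1]_x (\int[m2]_y F (x, y)) = \int[m2]_y (\int[m1]_x F (x, y)).
Proof. by move=> iF; rewrite (RFubini1 iF).2 (RFubini2 iF).2. Qed.

End fubini2.

(** * Affine changes of variable *)

Section change_of_variables.
Variable R : realType.
Local Notation mu := (@lebesgue_measure R).
Implicit Types (f : R -> R) (g : R -> \bar R).

Let affine (r b : R) : measurableTypeR R -> measurableTypeR R :=
  fun x => r * x + b.

Let measurable_affine r b : measurable_fun setT (affine r b).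
Proof. by apply: measurable_funD => //; exact: mulrl_measurable. Qed.

Let lebesgue_measure_affine (r b : R) (r0 : 0 < r) (A : set (measurableTypeR R)) :
  measurable A ->
  mu A = (r%:E * pushforward mu (affine r b) A)%E.
Proof.
move=> mA; have mphi := measurable_affine r b.
pose nu := mscale (NngNum (ltW r0)) (pushforward mu (affine r b)).
rewrite (@lebesgue_measure_unique R (nu mphi))//= => _ [[u v]] _ <-.
rewrite /nu /mscale /pushforward/=.
rewrite /pushforward (_ : _ @^-1` _ = `](u - b) / r, (v - b) / r]%classic); last first.
  apply/seteqP; split => x /=; rewrite !in_itv/= ltr_pdivrMr// ler_pdivlMr// ltrBlDr lerBrDr mulrC//.
rewrite !lebesgue_measure_itv/= !lte_fin ltr_pM2r ?invr_gt0// ltrD2r.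
case: ifPn => _; last by rewrite mule0.
rewrite -!EFinD -EFinM; congr EFin; field; exact: lt0r_neq0.
Qed.

Lemma ge0_integral_affine (r b : R) g : 0 < r -> measurable_fun setT g ->
  (forall x, 0 <= g x)%E ->
  (\int[mu]_x g (r * x + b)%R = r^-1%:E * \int[mu]_x g x)%E.
Proof.
move=> r0 mg g0; have mphi := measurable_affine r b.
rewrite -[LHS](@ge0_integral_pushforward _ _ _ _ _ (affine r b) mphi mu setT)//.
have ri0 : 0 <= r^-1 by rewrite invr_ge0 ltW.
rewrite -(ge0_integral_mscale mu measurableT (NngNum ri0)) //.
apply: eq_measure_integral => A mA _.
change (pushforward mu (affine r b) A = r^-1%:E * mu A)%E.
rewrite (lebesgue_measure_affine b r0 mA).
by rewrite muleA -EFinM mulVf ?gt_eqF// mul1e.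
Qed.

Lemma integral_affine (r b : R) g : 0 < r -> measurable_fun setT g ->
  (\int[mu]_x g (r * x + b)%R = r^-1%:E * \int[mu]_x g x)%E.
Proof.
move=> r0 mg; rewrite integralE [in RHS]integralE.
have ri0 : 0 < r^-1 by rewrite invr_gt0.
have -> : (\int[mu]_x (fun x => g (r * x + b)%R)^\+ x = r^-1%:E * \int[mu]_x (g^\+ x))%E.
  rewrite -(ge0_integral_affine b r0) //; last exact: measurable_funepos.
  by apply: eq_integral => x _; rewrite !funeposE.
have -> : (\int[mu]_x (fun x => g (r * x + b)%R)^\- x = r^-1%:E * \int[mu]_x (g^\- x))%E.
  rewrite -(ge0_integral_affine b r0) //; last exact: measurable_funeneg.
  by apply: eq_integral => x _; rewrite !funenegE.
set P := (\int[mu]_x g^\+ x)%E; set N := (\int[mu]_x g^\- x)%E.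
case: P => [p| |]; case: N => [n| |] /=; rewrite -?EFinM ?gt0_muley ?gt0_muleNy ?lte_fin//=.
- by rewrite mulrBr.
Qed.

Lemma integral_opp g : measurable_fun setT g ->
  (\int[mu]_x g (- x)%R = \int[mu]_x g x)%E.
Proof.
have ge0 h : measurable_fun setT h -> (forall x, 0 <= h x)%E ->
    (\int[mu]_x h (- x)%R = \int[mu]_x h x)%E.
  move=> mh h0.
  rewrite -[LHS](@ge0_integral_pushforward _ _ _ _ _ (-%R : measurableTypeR R -> measurableTypeR R) _ mu setT)//.
  by apply: eq_measure_integral => A mA _; exact: (lebesgue_measureN mA).
move=> mg; rewrite integralE [in RHS]integralE; congr (_ - _)%E.
  rewrite -[RHS]ge0 //; last exact: measurable_funepos.
  by apply: eq_integral => x _; rewrite !funeposE.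
rewrite -[RHS]ge0 //; last exact: measurable_funeneg.
by apply: eq_integral => x _; rewrite !funenegE.
Qed.

Lemma integral_shift b g : measurable_fun setT g ->
  (\int[mu]_x g (x + b)%R = \int[mu]_x g x)%E.
Proof.
move=> mg; rewrite -[RHS]mul1e -invr1 -(integral_affine b)//.
by under [in RHS]eq_integral do rewrite mul1r.
Qed.

Lemma integral_refl b g : measurable_fun setT g ->
  (\int[mu]_x g (b - x)%R = \int[mu]_x g x)%E.
Proof.
move=> mg; rewrite -(integral_opp mg) -[RHS](integral_shift (- b)).
  by apply: eq_integral => x _; rewrite opprD opprK addrC.
by apply: measurableT_comp => //; exact: measurable_funN.
Qed.

Lemma Rint_shift b f : measurable_fun setT f ->
  \int[mu]_x f (x + b) = \int[mu]_x f x.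
Proof. by move=> /measurable_EFinP mf; congr fine; exact: (integral_shift b mf). Qed.

Lemma Rint_refl b f : measurable_fun setT f ->
  \int[mu]_x f (b - x) = \int[mu]_x f x.
Proof. by move=> /measurable_EFinP mf; congr fine; exact: (integral_refl b mf). Qed.

Lemma Rint_opp f : measurable_fun setT f ->
  \int[mu]_x f (- x) = \int[mu]_x f x.
Proof. by move=> /measurable_EFinP mf; congr fine; exact: (integral_opp mf). Qed.

Lemma integ_shift b f : integ mu f -> integ mu (fun x => f (x + b)).
Proof.
move=> if_; have mf : measurable_fun setT f := integ_meas if_.
apply/integP; first by apply: measurableT_comp => //; exact: measurable_funD.
rewrite (integral_shift b (g := fun x => (`|f x|)%:E)); first exact/integP.
by apply/measurable_EFinP/measurableT_comp.
Qed.

Lemma integ_refl b f : integ mu f -> integ mu (fun x => f (b - x)).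
Proof.
move=> if_; have mf : measurable_fun setT f := integ_meas if_.
apply/integP; first by apply: measurableT_comp => //; exact: measurable_funB.
rewrite (integral_refl b (g := fun x => (`|f x|)%:E)); first exact/integP.
by apply/measurable_EFinP/measurableT_comp.
Qed.

Lemma Rint_scale r f : 0 < r -> measurable_fun setT f ->
  \int[mu]_x f (r * x) = r^-1 * \int[mu]_x f x.
Proof.
move=> r0 /measurable_EFinP mf; rewrite /Rintegral.
have := integral_affine 0 r0 mf => /=.
under eq_integral do rewrite addr0.
move=> ->; case: (\int[mu]_x _)%E => [y| |]//=.
- by rewrite mulr0 gt0_muley ?lte_fin ?invr_gt0.
- by rewrite mulr0 gt0_muleNy ?lte_fin ?invr_gt0.
Qed.

Lemma integ_scale r f : 0 < r -> integ mu f -> integ mu (fun x => f (r * x)).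
Proof.
move=> r0 if_; have mf : measurable_fun setT f := integ_meas if_.
apply/integP; first by apply: measurableT_comp => //; exact: mulrl_measurable.
have mn : measurable_fun setT (fun x => (`|f x|)%:E).
  by apply/measurable_EFinP/measurableT_comp.
have := integral_affine 0 r0 mn => /=.
under eq_integral do rewrite addr0.
by move=> ->; rewrite lte_mul_pinfty ?lee_fin ?invr_ge0 ?(ltW r0)//; exact/integP.
Qed.

Lemma lae_imp (P Q : R -> Prop) : (forall x, P x -> Q x) ->
  {ae mu, forall x, P x} -> {ae mu, forall x, Q x}.
Proof. by move=> PQ; exact: (@filterS _ _ (ae_filter_ringOfSetsType mu)). Qed.

Lemma lae_imp2 (P P' Q : R -> Prop) : (forall x, P x -> P' x -> Q x) ->
  {ae mu, forall x, P x} -> {ae mu, forall x, P' x} -> {ae mu, forall x, Q x}.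
Proof. by move=> PQ; exact: (@filterS2 _ _ (ae_filter_ringOfSetsType mu)). Qed.

Lemma lae_neq (a : R) : {ae mu, forall x, x <> a}.
Proof.
exists [set a]; split => //; first exact: lebesgue_measure_set1.
by move=> s /= /contrapT ->.
Qed.

End change_of_variables.

(** * Square-integrable functions *)

Section square_integrable.
Context d (T : measurableType d) (R : realType) (m : {measure set T -> \bar R}).
Implicit Types f g : T -> R.

Definition sqint f := measurable_fun setT f /\ integ m (fun x => f x ^+ 2).

Lemma sqint_mul f g : sqint f -> sqint g -> integ m (fun x => f x * g x).
Proof.
move=> [mf if_] [mg ig]; apply: integ_dom (integD if_ ig) _.
  exact: measurable_funM.
move=> x; have h1 := sqr_ge0 (f x - g x); have h2 := sqr_ge0 (f x + g x).
by rewrite ler_norml; nra.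
Qed.

Lemma sqintD f g : sqint f -> sqint g -> sqint (fun x => f x + g x).
Proof.
move=> hf hg; have [[mf if_] [mg ig]] := (hf, hg); split.
  exact: measurable_funD.
under eq_fun do rewrite sqrrD.
apply: integD => //; apply: integD => //.
under eq_fun do rewrite -mulr_natl.
by apply: integZ; exact: sqint_mul.
Qed.

Lemma sqintZ c f : sqint f -> sqint (fun x => c * f x).
Proof.
move=> [mf if_]; split; first exact: measurable_funM.
by under eq_fun do rewrite exprMn; exact: integZ.
Qed.

Lemma sqintB f g : sqint f -> sqint g -> sqint (fun x => f x - g x).
Proof.
move=> hf hg; have := sqintD hf (sqintZ (-1) hg).
by under eq_fun do rewrite mulN1r.
Qed.

Lemma sqint_norm f : sqint f -> sqint (fun x => `|f x|).
Proof.
move=> [mf if_]; split; first exact: measurableT_comp.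
by under eq_fun do rewrite real_normK ?num_real//.
Qed.

Lemma sqint_dom f g : measurable_fun setT f -> sqint g ->
  (forall x, `|f x| <= `|g x|) -> sqint f.
Proof.
move=> mf [mg ig] fg; split => //; apply: integ_dom ig _.
  exact: measurable_funX.
by move=> x; rewrite normrX -(real_normK (num_real (g x))) lerXn2r ?nnegrE.
Qed.

Lemma sq_Rint_ge0 f : 0 <= \int[m]_x f x ^+ 2.
Proof. by apply: Rintegral_ge0 => x _; exact: sqr_ge0. Qed.

Lemma cauchy_schwarz f g : sqint f -> sqint g ->
  (\int[m]_x (f x * g x)) ^+ 2 <= (\int[m]_x f x ^+ 2) * (\int[m]_x g x ^+ 2).
Proof.
move=> hf hg; have [[mf if_] [mg ig]] := (hf, hg).
have ifg := sqint_mul hf hg.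
set x := \int[m]_x (_ * _); set a := \int[m]_x _ ^+ 2; set b := \int[m]_x g x ^+ 2.
have H e : 0 <= a * e ^+ 2 - 2 * e * x + b.
  suff -> : a * e ^+ 2 - 2 * e * x + b = \int[m]_x (e * f x - g x) ^+ 2 by exact: sq_Rint_ge0.
  transitivity (\int[m]_x (e ^+ 2 * f x ^+ 2 - 2 * e * (f x * g x) + g x ^+ 2)).
    rewrite RintegralD //; last by apply: integB; exact: integZ.
    rewrite RintegralB //; try exact: integZ.
    by rewrite !RintegralZl // mulrC.
  by apply: eq_Rintegral => y _; ring.
have a0 : 0 <= a by exact: sq_Rint_ge0.
have b0 : 0 <= b by exact: sq_Rint_ge0.
have [a00|a00] := eqVneq a 0.
  rewrite a00 mul0r.
  have [->|x0] := eqVneq x 0; first by rewrite expr0n.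
  have := H ((b + 1) / x); rewrite a00 mul0r add0r.
  rewrite (_ : 2 * _ * x = 2 * (b + 1)); last by field.
  by move=> ?; lra.
have {}a0 : 0 < a by rewrite lt_neqAle eq_sym a00.
have := H (x / a).
rewrite (_ : a * _ ^+ 2 - 2 * _ * x + b = (a * b - x ^+ 2) / a); last by field.
by rewrite ler_pdivlMr// mul0r subr_ge0.
Qed.

(** Cauchy-Schwarz for [|k|^(1/2)] and [|k|^(1/2) |f|]: the pointwise half of
Young's inequality. *)
Lemma young_pointwise (k f : T -> R) : measurable_fun setT f -> integ m k ->
  integ m (fun x => `|k x| * f x ^+ 2) ->
  integ m (fun x => k x * f x) /\
  (\int[m]_x (k x * f x)) ^+ 2 <= (\int[m]_x `|k x|) * \int[m]_x (`|k x| * f x ^+ 2).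
Proof.
move=> mf ik ikf; have mk := integ_meas ik.
have mk' : measurable_fun setT (fun x => `|k x|) by exact: measurableT_comp.
have ms : measurable_fun setT (fun x => Num.sqrt `|k x|).
  apply: measurableT_comp => //; apply: continuous_measurable_fun; exact: sqrt_continuous.
have h1 : sqint (fun x => Num.sqrt `|k x|).
  split => //.
  by under eq_fun do rewrite sqr_sqrtr//; exact: integ_norm.
have h2 : sqint (fun x => Num.sqrt `|k x| * `|f x|).
  split; first by apply: measurable_funM => //; exact: measurableT_comp.
  by under eq_fun do rewrite exprMn sqr_sqrtr// real_normK ?num_real//.
have E : (fun x => Num.sqrt `|k x| * (Num.sqrt `|k x| * `|f x|)) = (fun x => `|k x * f x|).
  by apply/funext => x; rewrite mulrA -expr2 sqr_sqrtr// normrM.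
have i3 := sqint_mul h1 h2; rewrite E in i3.
have mkf : measurable_fun setT (fun x => k x * f x) by exact: measurable_funM.
have i4 : integ m (fun x => k x * f x) by apply: integ_dom i3 _.
split => //; have := cauchy_schwarz h1 h2; rewrite E.
under [X in _ <= X * _ -> _]eq_Rintegral do rewrite sqr_sqrtr//.
under [X in _ <= _ * X -> _]eq_Rintegral do rewrite exprMn sqr_sqrtr// real_normK ?num_real//.
apply: le_trans.
rewrite -(real_normK (num_real (\int[m]_x (k x * f x)))) lerXn2r ?nnegrE//.
  by apply: Rintegral_ge0.
exact: le_normr_Rintegral.
Qed.

End square_integrable.

(** * Convolution *)

Section convolution.
Variable R : realType.
Local Notation mu := (@lebesgue_measure R).
Implicit Types (f g k r w : R -> R).

Definition conv k f (t : R) : R := \int[mu]_s (k (t - s) * f s).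

Lemma measurable_conv_kernel k w : measurable_fun setT k -> measurable_fun setT w ->
  measurable_fun setT (fun p : R * R => k (p.1 - p.2) * w p.2).
Proof.
move=> mk mw; apply: measurable_funM.
  apply: measurableT_comp => //; apply: measurable_funB.
    exact: measurable_fst.
  exact: measurable_snd.
by apply: measurableT_comp => //; exact: measurable_snd.
Qed.

Lemma measurable_conv k f : measurable_fun setT k -> measurable_fun setT f ->
  measurable_fun setT (conv k f).
Proof.
move=> mk mf.
exact: (measurable_Rint_snd mu (measurable_conv_kernel mk mf)).
Qed.

Lemma integ_conv_kernel k w : integ mu k -> integ mu w ->
  integ (mu \x mu)%E (fun p : R * R => k (p.1 - p.2) * w p.2).
Proof.
move=> ik iw; have mk := integ_meas ik; have mw := integ_meas iw.
have mm := measurable_conv_kernel mk mw.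
apply/(integrable21ltyP mu mu); first exact/measurable_EFinP.
under eq_integral => s _.
  under eq_integral do rewrite /= normrM mulrC EFinM.
  rewrite ge0_integralZl//; last first.
    apply/measurable_EFinP/measurableT_comp => //.
    by apply: measurableT_comp => //; exact: measurable_funB.
  rewrite (integral_shift (- s) (g := fun x => (`|k x|)%:E)); last first.
    exact/measurable_EFinP/measurableT_comp.
  rewrite muleC.
over.
rewrite /= ge0_integralZl//.
- rewrite lte_mul_pinfty//; first exact: integral_ge0.
  + have := (integP mu mk).1 ik; rewrite -ge0_fin_numE//; exact: integral_ge0.
  + exact/(integP mu mw).1.
- exact/measurable_EFinP/measurableT_comp.
- exact: integral_ge0.
Qed.

Lemma ae_integ_conv k w : integ mu k -> integ mu w ->
  {ae mu, forall t, integ mu (fun s => k (t - s) * w s)}.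
Proof. by move=> ik iw; have := ae_integrable1 (integ_conv_kernel ik iw). Qed.

Lemma integ_conv k w : integ mu k -> integ mu w -> integ mu (conv k w).
Proof. by move=> ik iw; have [] := RFubini1 (integ_conv_kernel ik iw). Qed.

Lemma Rint_conv k w : integ mu k -> integ mu w ->
  \int[mu]_t conv k w t = (\int[mu]_t k t) * (\int[mu]_t w t).
Proof.
move=> ik iw; have mk : measurable_fun setT k := integ_meas ik.
rewrite [LHS](RFubini (integ_conv_kernel ik iw)) /=.
under eq_Rintegral => s _.
  rewrite RintegralZr//; last exact: (integ_shift (- s) ik).
  rewrite (Rint_shift (- s) mk); over.
by rewrite RintegralZl.
Qed.

Lemma norm_conv_le k w : integ mu k -> integ mu w ->
  {ae mu, forall t, `|conv k w t| <= conv (fun x => `|k x|) (fun x => `|w x|) t}.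
Proof.
move=> ik iw; have := ae_integ_conv ik iw; apply: lae_imp => t h.
rewrite (le_trans (le_normr_Rintegral _ h))//.
by rewrite /conv; under eq_Rintegral do rewrite normrM.
Qed.

Lemma Rint_norm_conv k w : integ mu k -> integ mu w ->
  \int[mu]_t `|conv k w t| <= (\int[mu]_t `|k t|) * (\int[mu]_t `|w t|).
Proof.
move=> ik iw; have ik' := integ_norm ik; have iw' := integ_norm iw.
rewrite -(Rint_conv ik' iw').
rewrite -lee_fin !EFin_Rintegral; [|exact: integ_conv|exact/integ_norm/integ_conv].
apply: ae_ge0_le_integral => //.
- by apply/measurable_EFinP; exact/integ_meas/integ_norm/integ_conv.
- by move=> t _; rewrite lee_fin; apply: Rintegral_ge0 => s _; exact: mulr_ge0.
- by apply/measurable_EFinP; exact/integ_meas/integ_conv.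
- by have := norm_conv_le ik iw; apply: lae_imp => t h _; rewrite lee_fin.
Qed.

Lemma convC k w t : measurable_fun setT k -> measurable_fun setT w ->
  conv k w t = conv w k t.
Proof.
move=> mk mw; rewrite /conv -(Rint_refl t (f := fun s => k (t - s) * w s)).
  by apply: eq_Rintegral => s _; rewrite opprB addrC subrK mulrC.
by apply: measurable_funM => //; apply: measurableT_comp => //; exact: measurable_funB.
Qed.

Lemma ae_conv_sqint k f : integ mu k -> sqint mu f ->
  {ae mu, forall t, integ mu (fun s => k (t - s) * f s) /\
    conv k f t ^+ 2 <= (\int[mu]_x `|k x|) * conv (fun x => `|k x|) (fun s => f s ^+ 2) t}.
Proof.
move=> ik [mf i2]; have := ae_integ_conv (integ_norm ik) i2.
apply: lae_imp => t h.
have [h1 h2] := young_pointwise mf (integ_refl t ik) h; split => //.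
move: h2; rewrite (Rint_refl t (f := fun x => `|k x|))//.
by apply: measurableT_comp => //; exact: integ_meas ik.
Qed.

Lemma ae_integ_conv_sqint k f : integ mu k -> sqint mu f ->
  {ae mu, forall t, integ mu (fun s => k (t - s) * f s)}.
Proof. by move=> ik hf; have := ae_conv_sqint ik hf; apply: lae_imp => t []. Qed.

(** Young's inequality: integrate the pointwise bound of [ae_conv_sqint] and use
that the integral of a convolution is the product of the integrals. *)
Lemma sqint_conv k f : integ mu k -> sqint mu f ->
  sqint mu (conv k f) /\
  \int[mu]_t conv k f t ^+ 2 <= (\int[mu]_x `|k x|) ^+ 2 * \int[mu]_x f x ^+ 2.
Proof.
move=> ik hf; have [mf i2] := hf; have ik' := integ_norm ik.
have ic := integ_conv ik' i2.
have mc : measurable_fun setT (conv k f) by apply: measurable_conv => //; exact: integ_meas ik.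
have lecc : (\int[mu]_t (conv k f t ^+ 2)%:E <=
   \int[mu]_t ((\int[mu]_x `|k x|) * conv (fun x => `|k x|) (fun s => f s ^+ 2) t)%:E)%E.
  apply: ae_ge0_le_integral => //.
  - by move=> t _; rewrite lee_fin sqr_ge0.
  - by apply/measurable_EFinP; exact: measurable_funX.
  - move=> t _; rewrite lee_fin mulr_ge0//; first exact: Rintegral_ge0.
    by apply: Rintegral_ge0 => s _; rewrite mulr_ge0// sqr_ge0.
  - by apply/measurable_EFinP; exact: integ_meas (integZ _ ic).
  - by have := ae_conv_sqint ik hf; apply: lae_imp => t [_ h] _; rewrite lee_fin.
have sc : sqint mu (conv k f).
  split => //; apply/integP; first exact: measurable_funX.
  under eq_integral do rewrite ger0_norm ?sqr_ge0//.
  apply: (le_lt_trans lecc); rewrite -EFin_Rintegral ?ltry//.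
  exact: integZ.
split => //; rewrite expr2 -mulrA -(Rint_conv ik' i2).
rewrite -RintegralZl// -lee_fin !EFin_Rintegral//; [exact: integZ|exact: sc.2].
Qed.

Lemma eq_conv k k' f f' t : measurable_fun setT k -> measurable_fun setT k' ->
  measurable_fun setT f -> measurable_fun setT f' ->
  {ae mu, forall s, k s = k' s} -> {ae mu, forall s, f s = f' s} ->
  conv k f t = conv k' f' t.
Proof.
move=> mk mk' mf mf' kk ff.
have aux k0 f0 g0 : measurable_fun setT k0 -> measurable_fun setT f0 ->
    measurable_fun setT g0 -> {ae mu, forall s, f0 s = g0 s} -> conv k0 f0 t = conv k0 g0 t.
  move=> mk0 mf0 mg0 fg0; apply: ae_eq_Rint.
  - by apply: measurable_funM => //; apply: measurableT_comp => //; exact: measurable_funB.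
  - by apply: measurable_funM => //; apply: measurableT_comp => //; exact: measurable_funB.
  - by move: fg0; apply: lae_imp => s ->.
by rewrite (aux _ _ f')// convC// (aux _ _ k')// convC.
Qed.

Lemma ae_convD k f g : integ mu k -> sqint mu f -> sqint mu g ->
  {ae mu, forall t, conv k (fun s => f s + g s) t = conv k f t + conv k g t}.
Proof.
move=> ik hf hg; have := ae_integ_conv_sqint ik hf; have := ae_integ_conv_sqint ik hg.
apply: lae_imp2 => t h1 h2; rewrite /conv -RintegralD//.
by apply: eq_Rintegral => s _; rewrite mulrDr.
Qed.

Lemma ae_convZ k c f : integ mu k -> sqint mu f ->
  {ae mu, forall t, conv k (fun s => c * f s) t = c * conv k f t}.
Proof.
move=> ik hf; have := ae_integ_conv_sqint ik hf.
apply: lae_imp => t h1; rewrite /conv -RintegralZl//.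
by apply: eq_Rintegral => s _; rewrite mulrCA.
Qed.

Lemma ae_convDl k r f : integ mu k -> integ mu r -> sqint mu f ->
  {ae mu, forall t, conv (fun s => k s + r s) f t = conv k f t + conv r f t}.
Proof.
move=> ik ir hf; have := ae_integ_conv_sqint ik hf; have := ae_integ_conv_sqint ir hf.
apply: lae_imp2 => t h1 h2; rewrite /conv -RintegralD//.
by apply: eq_Rintegral => s _; rewrite mulrDl.
Qed.

Lemma convZl k c f t : integ mu (fun s => k (t - s) * f s) ->
  conv (fun s => c * k s) f t = c * conv k f t.
Proof.
move=> h; rewrite /conv -RintegralZl//.
by apply: eq_Rintegral => s _; rewrite mulrA.
Qed.

Lemma ae_convA r k f : integ mu r -> integ mu k -> sqint mu f ->
  {ae mu, forall t, conv r (conv k f) t = conv (conv r k) f t}.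
Proof.
move=> ir ik hf; have [mf _] := hf.
have mr := integ_meas ir; have mk := integ_meas ik.
have ir' := integ_norm ir; have ik' := integ_norm ik.
have hf' := sqint_norm hf.
have := ae_integ_conv_sqint ir' (sqint_conv ik' hf').1; apply: lae_imp => t h.
(* F (s, v) = r (t - s) k (s - v) f v is absolutely integrable *)
pose F (p : R * R) := r (t - p.1) * (k (p.1 - p.2) * f p.2).
have mF : measurable_fun setT F.
  apply: measurable_funM; last exact: measurable_conv_kernel.
  apply: measurableT_comp => //; apply: measurable_funB => //; exact: measurable_fst.
have iF : integ (mu \x mu)%E F.
  apply/(integrable12ltyP mu mu); first exact/measurable_EFinP.
  have [_ h2] := integrableP _ _ _ h.
  apply: le_lt_trans h2; apply: ae_ge0_le_integral => //.
  - by move=> s _; apply: integral_ge0.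
  - apply: (@measurable_fun_fubini_tonelli_F _ _ _ _ _ mu (abse \o (EFin \o F))) => [|z].
      by do 2 apply: measurableT_comp => //.
    exact: abse_ge0.
  - apply/measurable_EFinP/measurableT_comp => //; apply: measurable_funM.
      by do 2 apply: measurableT_comp => //; exact: measurable_funB.
    by apply: measurable_conv; exact: measurableT_comp.
  - have := ae_integ_conv_sqint ik' hf'; apply: lae_imp => s h3 _ /=.
    rewrite /F/=; under eq_integral do rewrite !normrM EFinM.
    rewrite ge0_integralZl//; last by apply/measurable_EFinP; exact: (integ_meas h3).
    rewrite -EFin_Rintegral// -EFinM lee_fin normrM normr_id.
    by rewrite ler_wpM2l// ler_norm.
have mkf : {ae mu, forall s, integ mu (fun v => k (s - v) * f v)}.
  exact: ae_integ_conv_sqint.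
transitivity (\int[mu]_s \int[mu]_v F (s, v)).
  apply: ae_eq_Rint.
  - apply: measurable_funM; last exact: measurable_conv.
    by apply: measurableT_comp => //; exact: measurable_funB.
  - exact: measurable_Rint_snd.
  - by move: mkf; apply: lae_imp => s hs; rewrite /F/= RintegralZl.
rewrite (RFubini iF).
apply: ae_eq_Rint.
- exact: measurable_Rint_fst.
- by apply: measurable_funM => //; apply: measurableT_comp; [exact: measurable_conv|exact: measurable_funB].
have := ae_integrable2 iF; apply: lae_imp => v hv.
(* Integrability of the section at v yields that of the inner convolution only
   after division by f v, so the zeros of f are treated apart. *)
have [fv0|fv0] := eqVneq (f v) 0.
  rewrite fv0 mulr0 /F/=; under eq_Rintegral do rewrite fv0 !mulr0.
  by rewrite Rintegral_cst// mul0r.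
rewrite /F/= /conv.
have mrk : measurable_fun setT (fun s : R => r (t - v - s) * k s).
  by apply: measurable_funM => //; apply: measurableT_comp => //; exact: measurable_funB.
rewrite -(Rint_shift (- v) mrk).
have hv' : integ mu (fun s : R => r (t - s) * k (s - v)).
  have -> : (fun s : R => r (t - s) * k (s - v)) = (fun s : R => (f v)^-1 * F (s, v)).
    by apply/funext => s; rewrite /F /=; field.
  exact: (integZ (f v)^-1 hv).
have E s : t - v - (s - v) = t - s by ring.
under [in RHS]eq_Rintegral do rewrite E.
rewrite -RintegralZr//.
by apply: eq_Rintegral => s _; rewrite mulrA.
Qed.

End convolution.

(** * Inversion in the convolution algebra *)

Section neumann.
Variable R : realType.
Local Notation mu := (@lebesgue_measure R).

(** The sum of the [|D n|] has a finite integral, hence is finite outside a null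
set; off that set the partial sums converge and the sum dominates them. *)
Lemma ae_summable (D : nat -> R -> R) (q : R) : 0 <= q < 1 ->
  (forall n, integ mu (D n)) -> (forall n, \int[mu]_t `|D n t| <= q ^+ n) ->
  exists h r : R -> R, [/\ integ mu h, measurable_fun setT r &
    {ae mu, forall t, (forall N, `|\sum_(0 <= n < N) D n t| <= h t) /\
       (\sum_(0 <= n < N) D n t) @[N --> \oo] --> r t}].
Proof.
move=> /andP[q0 q1] iD Dq.
have mD n : measurable_fun setT (D n) := integ_meas (iD n).
have mnD n : measurable_fun setT (fun t => (`|D n t|)%:E).
  by apply/measurable_EFinP/measurableT_comp.
pose H t := (\sum_(0 <= n <oo) (`|D n t|)%:E)%E.
have H0 t : (0 <= H t)%E by apply: nneseries_ge0.
have mH : measurable_fun setT H.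
  by apply: ge0_emeasurable_sum.
have iH : mu.-integrable setT H.
  apply/integrableP; split => //.
  under eq_integral do rewrite gee0_abs//.
  rewrite /H integral_nneseries//.
  apply: (@le_lt_trans _ _ (\sum_(0 <= n <oo) (q ^+ n)%:E)%E).
    apply: lee_nneseries => [n _ _|n _]; first exact: integral_ge0.
    by rewrite -(EFin_Rintegral (integ_norm (iD n))) lee_fin.
  have cg : cvgn (series (geometric 1 q)).
    by apply: is_cvg_geometric_series; rewrite ger0_norm.
  rewrite (_ : (fun N => _) = EFin \o series (geometric 1 q)); last first.
    apply/funext => N; rewrite /series/= -sumEFin.
    by apply: eq_bigr => i _; rewrite mul1r.
  by rewrite EFin_lim// ltry.
have fH := integrable_ae measurableT iH.
pose E := [set t | (H t < +oo)%E].
have mE : measurable (E : set (measurableTypeR R)).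
  by rewrite -[E]setTI; exact: emeasurable_fun_infty_o.
have Hub t N : E t -> \sum_(0 <= n < N) `|D n t| <= fine (H t).
  move=> Et; rewrite -lee_fin -sumEFin fineK ?ge0_fin_numE//.
  exact: nneseries_lim_ge.
have cvE t : E t -> cvgn (series (fun n => D n t)).
  move=> Et; apply: normed_cvg; apply: nondecreasing_is_cvgn.
    by move=> i j ij; apply: (@nondecreasing_series _ (fun n => `|D n t|) xpredT 0%N _ i j ij).
  exists (fine (H t)) => _ [N _ <-]; exact: Hub.
(* The indicator of E makes the partial sums converge everywhere, so that the
   limit is measurable. *)
pose r t := limn (fun N => \1_E t * \sum_(0 <= n < N) D n t).
have mr : measurable_fun setT r.
  apply: (@measurable_fun_cvg _ _ _ _ (fun N t => \1_E t * \sum_(0 <= n < N) D n t)).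
    move=> N; apply: measurable_funM; first exact: measurable_indic.
    by apply: measurable_sum => n.
  move=> t _; have [tE|tE] := boolP (t \in E).
    rewrite /r; apply: is_cvgMr; apply: cvE; exact: set_mem.
  rewrite /r; under eq_fun do rewrite indicE (negbTE tE) mul0r.
  exact: is_cvg_cst.
exists (fun t => fine (H t)), r; split => //.
  apply/integP; first by apply: measurableT_comp => //; exact: fine_measurable.
  have [_] := integrableP _ _ _ iH; apply: le_lt_trans.
  apply: ge0_le_integral => //.
  - apply/measurable_EFinP/measurableT_comp => //.
    by apply: measurableT_comp => //; exact: fine_measurable.
  - by apply: measurableT_comp.
  - by move=> t _; rewrite -abse_EFin; case: (H t) => [x| |]//=; rewrite normr0 leey.
move: fH; apply: lae_imp => t /(_ I) fHt.
have Et : E t by rewrite /E/= -ge0_fin_numE.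
split=> [N|].
  by rewrite (le_trans _ (Hub t N Et))// ler_norm_sum.
rewrite /r (_ : (fun N => _) = (fun N => \sum_(0 <= n < N) D n t)).
  exact: (cvE t Et).
by apply/funext => N; rewrite indicE mem_set// mul1r.
Qed.

(** [r] is the limit of [S 0 = 0], [S n.+1 = - k - k * S n], the partial sums of
the Neumann series. Consecutive terms differ by at most [q ^ n] in norm, with
[q] the norm of [k], so the sequence converges almost everywhere under an
integrable bound; the recursion passes to the limit. *)
Lemma neumann_kernel (k : R -> R) : integ mu k -> \int[mu]_t `|k t| < 1 ->
  exists2 r, integ mu r & {ae mu, forall t, r t + k t + conv k r t = 0}.
Proof.
move=> ik q1; set q := \int[mu]_t _ in q1.
have q0 : 0 <= q by exact: Rintegral_ge0.
have mk : measurable_fun setT k := integ_meas ik.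
pose S := fix S n := if n is m.+1 then (fun t => - k t - conv k (S m) t) else (fun=> 0 : R).
have iS n : integ mu (S n).
  elim: n => [|n ih] /=; first exact: integrable0.
  have := integB (integZ (-1) ik) (integ_conv ik ih).
  by congr (is_true (integrable.body _ _ _)); apply/funext => t /=; rewrite mulN1r.
pose D n t := S n.+1 t - S n t.
have iD n : integ mu (D n) by exact: integB.
have Dq n : \int[mu]_t `|D n t| <= q ^+ n.
  elim: n => [|n ih].
    rewrite expr0 (le_trans _ (ltW q1))// /q le_eqVlt; apply/orP; left; apply/eqP.
    apply: eq_Rintegral => t _; rewrite /D/= /conv subr0.
    under eq_Rintegral do rewrite mulr0.
    by rewrite Rintegral_cst// mul0r subr0 normrN.
  rewrite exprS; apply: le_trans (ler_wpM2l q0 ih).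
  rewrite (le_trans _ (Rint_norm_conv ik (iD n)))// le_eqVlt; apply/orP; left; apply/eqP.
  apply: ae_eq_Rint.
  - by apply: measurableT_comp => //; exact: integ_meas (iD _).
  - by apply: measurableT_comp => //; exact: integ_meas (integ_conv ik (iD n)).
  have := ae_integ_conv ik (iS n.+1); have := ae_integ_conv ik (iS n).
  apply: lae_imp2 => t h1 h2; rewrite -[RHS]normrN; congr `|_|.
  have -> : D n.+1 t = - (conv k (S n.+1) t - conv k (S n) t) by rewrite /D/=; ring.
  congr (- _); rewrite /conv -RintegralB//.
  by apply: eq_Rintegral => s _; rewrite -mulrBr.
have SE N t : S N t = \sum_(0 <= n < N) D n t.
  by rewrite telescope_sumr// subr0.
have [h [r [ih mr hr]]] : exists h r : R -> R, [/\ integ mu h, measurable_fun setT r &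
    {ae mu, forall t, (forall N, `|S N t| <= h t) /\ S N t @[N --> \oo] --> r t}].
  have [h [r [ih mr hr]]] := ae_summable (introT andP (conj q0 q1)) iD Dq.
  exists h, r; split => //; move: hr; apply: lae_imp => t [h1 h2]; split => [N|].
    by rewrite SE.
  by under eq_fun do rewrite SE.
have ir : integ mu r.
  have [] := @dominated_cvgR _ _ _ mu S r h (fun n => integ_meas (iS n)) mr _ ih _ => //.
  - by move: hr; apply: lae_imp => t [].
  - by move=> n; move: hr; apply: lae_imp => t [].
exists r => //.
have := ae_integ_conv (integ_norm ik) ih; move: (hr); apply: lae_imp2 => t [_ St] ht.
have cvc : conv k (S N) t @[N --> \oo] --> conv k r t.
  have mkt : measurable_fun setT (fun s : R => k (t - s)).
    by apply: measurableT_comp => //; exact: measurable_funB.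
  have [] := @dominated_cvgR _ _ _ mu (fun N (s : R) => k (t - s) * S N s)
     (fun s : R => k (t - s) * r s) (fun s : R => `|k (t - s)| * h s) _ _ _ ht _ => //.
  - by move=> n; apply: measurable_funM => //; exact: integ_meas (iS n).
  - exact: measurable_funM.
  - by move: hr; apply: lae_imp => s [_ hs]; apply: cvgMr.
  - by move=> n; move: hr; apply: lae_imp => s [hs _]; rewrite normrM ler_wpM2l.
have h1 : S N.+1 t @[N --> \oo] --> - k t - conv k r t.
  by apply: cvgB => //; exact: cvg_cst.
have h2 : S N.+1 t @[N --> \oo] --> r t by rewrite (cvg_shiftS (fun N => S N t)).
rewrite (cvg_unique _ h2 h1) //; ring.
Qed.

End neumann.

(** * Continuity of the cross-correlation at the origin *)

Section correlation.
Variable R : realType.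
Local Notation mu := (@lebesgue_measure R).
Implicit Types (f g : R -> R).

Definition corr f g (u : R) : R := \int[mu]_s (f s * g (s + u)).

Lemma measurable_shift f u : measurable_fun setT f -> measurable_fun setT (fun s : R => f (s + u)).
Proof. by move=> mf; apply: measurableT_comp => //; exact: measurable_funD. Qed.

Lemma measurable_corr_kernel f g : measurable_fun setT f -> measurable_fun setT g ->
  measurable_fun setT (fun p : R * R => f p.2 * g (p.2 + p.1)).
Proof.
move=> mf mg; apply: measurable_funM.
  by apply: measurableT_comp => //; exact: measurable_snd.
apply: measurableT_comp => //; apply: measurable_funD.
  exact: measurable_snd.
exact: measurable_fst.
Qed.

Lemma measurable_corr f g : measurable_fun setT f -> measurable_fun setT g ->
  measurable_fun setT (corr f g).
Proof. by move=> mf mg; exact: (measurable_Rint_snd mu (measurable_corr_kernel mf mg)). Qed.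

Lemma sqint_shift g u : sqint mu g -> sqint mu (fun s => g (s + u)).
Proof. by move=> [mg ig]; split; [exact: measurable_shift|exact: (integ_shift u ig)]. Qed.

Lemma integ_corr f g u : sqint mu f -> sqint mu g -> integ mu (fun s => f s * g (s + u)).
Proof. by move=> hf hg; apply: sqint_mul => //; exact: sqint_shift. Qed.

Lemma corr_sqr_le f g u : sqint mu f -> sqint mu g ->
  corr f g u ^+ 2 <= (\int[mu]_s f s ^+ 2) * \int[mu]_s g s ^+ 2.
Proof.
move=> hf hg; rewrite -(Rint_shift u (f := fun s => g s ^+ 2)).
  by apply: cauchy_schwarz => //; exact: sqint_shift.
by apply: measurable_funX; case: hg.
Qed.

Definition corr_bound f g : R :=
  Num.sqrt ((\int[mu]_s f s ^+ 2) * \int[mu]_s g s ^+ 2).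

Lemma corr_le f g u : sqint mu f -> sqint mu g -> `|corr f g u| <= corr_bound f g.
Proof.
move=> hf hg; rewrite -sqrtr_sqr ler_wsqrtr//; exact: corr_sqr_le.
Qed.

Lemma corrBl f f' g u : sqint mu f -> sqint mu f' -> sqint mu g ->
  corr (fun s => f s - f' s) g u = corr f g u - corr f' g u.
Proof.
move=> hf hf' hg; rewrite /corr -RintegralB//; [|exact: integ_corr..].
by apply: eq_Rintegral => s _; rewrite mulrBl.
Qed.

Let corr_cvg0 f := forall g (u : nat -> R), sqint mu g -> u n @[n --> \oo] --> 0 ->
  corr f g (u n) @[n --> \oo] --> \int[mu]_s (f s * g s).

(** By Cauchy-Schwarz [corr f g u] depends on [f] continuously in the square
norm, uniformly in [u]; so the property passes to limits. *)
Let corr_cvg0_closed f : sqint mu f ->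
  (forall e, 0 < e -> exists f', [/\ sqint mu f', corr_cvg0 f' & \int[mu]_s (f s - f' s) ^+ 2 <= e]) ->
  corr_cvg0 f.
Proof.
move=> hf apx g u hg u0; apply/cvgrPdist_le => e e0.
pose G := \int[mu]_s g s ^+ 2 + 1.
have G0 : 0 < G by rewrite ltr_wpDl// sq_Rint_ge0.
have [f' [hf' cf' ff']] := apx ((e / 3) ^+ 2 / G) (divr_gt0 (exprn_gt0 2 (divr_gt0 e0 (ltr0n _ 3))) G0).
have hd := sqintB hf hf'.
have small v : `|corr f g v - corr f' g v| <= e / 3.
  rewrite -corrBl// -(@ler_pXn2r _ 2%N)// ?nnegrE ?divr_ge0 ?(ltW e0)//.
  rewrite real_normK ?num_real// (le_trans (corr_sqr_le _ hd hg))//.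
  apply: (@le_trans _ _ ((e / 3) ^+ 2 / G * G)).
    by rewrite ler_pM ?sq_Rint_ge0// lerDl.
  by rewrite divfK// gt_eqF.
have c0 h : \int[mu]_s (h s * g s) = corr h g 0.
  by apply: eq_Rintegral => s _; rewrite addr0.
have := cf' g u hg u0; move=> /cvgrPdist_le/(_ (e / 3)) /(_ ltac:(by rewrite divr_gt0)).
apply: filterS => n; rewrite !c0.
have := small 0; have := small (u n).
rewrite !ler_norml => /andP[a1 a2] /andP[a3 a4] /andP[a5 a6]; apply/andP; split; lra.
Qed.

(** Moving the shift to the cut function, the integrand converges at every point
of continuity, that is off [N] and [- N]; dominated convergence applies. *)
Let corr_cvg0_cut (phi : R -> R) (N : R) : 0 < N -> continuous phi ->
  (forall s, `|phi s| <= N) -> 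
  let f := fun s => \1_(`[- N, N]%classic : set R) s * phi s in
  sqint mu f /\ corr_cvg0 f.
Proof.
move=> N0 cphi phiN f.
have mphi : measurable_fun setT phi by exact: continuous_measurable_fun.
have mf : measurable_fun setT f by apply: measurable_funM.
have ind_sq (M B : R) : sqint mu (fun s : R => B * \1_(`[- M, M]%classic : set R) s).
  apply: sqintZ; split => //.
  rewrite (_ : (fun s => _) = \1_(`[- M, M]%classic : set R)).
    exact: integrable_indic_itv.
  by apply/funext => s; rewrite indicE; case: (_ \in _); rewrite ?expr0n ?expr1n.
have hf : sqint mu f.
  apply: (sqint_dom (m := mu) mf (ind_sq N N)) => s; rewrite !normrM mulrC.
  by rewrite ler_wpM2r// (le_trans (phiN s))// ler_norm.
split => // g u hg u0; have [mg _] := hg.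
have E n : corr f g (u n) = \int[mu]_s (f (s - u n) * g s).
  rewrite /corr -(Rint_shift (- u n) (f := fun s => f s * g (s + u n))).
    by apply: eq_Rintegral => s _; rewrite subrK.
  by apply: measurable_funM => //; exact: measurable_shift.
have /cvgrPdist_lt /(_ 1 ltr01) [K _ HK] := u0.
pose U n := \int[mu]_s (f (s - u n) * g s).
(* Past K the shifts are smaller than 1, so all shifted functions live on
   the interval [- (N + 1), N + 1]. *)
rewrite (_ : (fun n => corr f g (u n)) = U); last exact/funext.
rewrite -(@cvg_shiftn K _ U).
have [] := @dominated_cvgR _ _ _ mu (fun n (s : R) => f (s - u (n + K)%N) * g s)
   (fun s : R => f s * g s)
   (fun s => (N * \1_(`[- (N + 1), N + 1]%classic : set R) s) * `|g s|) => //.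
- by move=> n; apply: measurable_funM => //; exact: measurable_shift.
- exact: measurable_funM.
- have := lae_neq (- N); have := lae_neq N; apply: lae_imp2 => s sN sN'; apply: cvgMl.
  have us : s - u (n + K)%N @[n --> \oo] --> s.
    rewrite -[X in _ --> X]subr0; apply: cvgB; first exact: cvg_cst.
    by rewrite (cvg_shiftn K).
  have cs : {for s, continuous f}.
    have [Ns|sN0] := ltP N `|s|.
      have near0 : \forall x \near s, 0 = f x.
        have sN0 : 0 < `|s| - N by rewrite subr_gt0.
        apply: filterS (nbhsx_ballx s _ sN0) => x; rewrite /ball/= => bx.
        have Nx : N < `|x|.
          have := lerB_dist s x; lra.
        rewrite /f indicE memNset ?mul0r//=.
        by rewrite in_itv/= -ler_norml; apply/negP; rewrite -ltNge.
      have fs : f s = 0 by exact: esym (nbhs_singleton near0).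
      have : f @ s --> (0 : R); last by rewrite -fs.
      apply: cvg_trans (near_eq_cvg near0) _.
      exact: cvg_cst.
    have {}sN0 : `|s| < N.
      rewrite lt_neqAle sN0 andbT; apply/eqP => h.
      by have [s0|s0] := lerP 0 s; move: h; [rewrite ger0_norm|rewrite ltr0_norm// => h; apply: sN'; rewrite -h opprK].
    have near1 : \forall x \near s, phi x = f x.
      have sN1 : 0 < N - `|s| by rewrite subr_gt0.
      apply: filterS (nbhsx_ballx s _ sN1) => x; rewrite /ball/= => bx.
      have Nx : `|x| < N.
        have := lerB_dist x s; rewrite distrC; lra.
      rewrite /f indicE mem_set ?mul1r//=.
      by rewrite in_itv/= -ler_norml ltW.
    have fs : phi s = f s by exact: (nbhs_singleton near1).
    have : f @ s --> phi s; last by rewrite fs.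
    apply: cvg_trans (near_eq_cvg near1) _.
    exact: cphi.
  exact: (cvg_comp _ _ us cs).
- apply: sqint_mul; first exact: ind_sq. exact: sqint_norm.
- move=> n; apply/aeW => s; rewrite normrM ler_wpM2r// /f normrM.
  rewrite mulrC; apply: ler_pM => //; rewrite !indicE.
  have [h|_] := boolP (_ \in `[- N, N]%classic); last by rewrite normr0; case: (_ \in _).
  rewrite normr1 mem_set//=; move/set_mem: h => /=.
  have := HK (n + K)%N (leq_addl _ _); rewrite /= sub0r normrN ltr_norml.
  by rewrite !in_itv/= => /andP[? ?] /andP[? ?]; apply/andP; split; lra.
Qed.

(** Such cut continuous functions are dense: cut [f] at a height and a distance,
approximate the result by a continuous function in mean, and clamp the
approximation to the height of the cut. For functions bounded by [M], a mean
error bounds the square error up to the factor [2 M]. *)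
Lemma corr_cvg f : sqint mu f -> corr_cvg0 f.
Proof.
have arith (a b c d : R) : a < d / 4 -> b <= c -> c <= d / 4 -> 2 * a + 2 * b <= d by lra.
move=> hf; apply: corr_cvg0_closed => // e e0; have [mf if2] := hf.
have e4 : 0 < e / 4 by lra.
pose B N : set (measurableTypeR R) := `[- N.+1%:R, N.+1%:R]%classic `&` f @^-1` `[- N.+1%:R, N.+1%:R]%classic.
have mB N : measurable (B N).
  by apply: measurableI => //; rewrite -[X in measurable X]setTI; exact: mf.
pose f1 N s := \1_(B N) s * f s.
have mf1 N : measurable_fun setT (f1 N).
  by apply: measurable_funM => //; exact: measurable_indic.
have f1le N s : `|f1 N s| <= `|f s|.
  by rewrite /f1 indicE; case: (_ \in _); rewrite ?mul1r ?mul0r ?normr0.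
have hf1 N : sqint mu (f1 N) by exact: (sqint_dom (m := mu) (mf1 N) hf (f1le N)).
have c1 : \int[mu]_s (f s - f1 N s) ^+ 2 @[N --> \oo] --> 0.
  rewrite (_ : 0 = \int[mu]_s 0); last by rewrite Rintegral_cst// mul0r.
  have [] := @dominated_cvgR _ _ _ mu (fun N s => (f s - f1 N s) ^+ 2)
     (fun=> 0) (fun s => f s ^+ 2) _ _ _ if2 _ => //.
  - by move=> n; apply: measurable_funX; exact: measurable_funB.
  - apply/aeW => s; apply: cvg_near_cst.
    exists (Num.truncn (Num.max `|s| `|f s|)) => // N /= hN; apply/eqP.
    have hm : Num.max `|s| `|f s| < N.+1%:R.
      by rewrite (lt_le_trans (Num.Theory.truncnS_gt _))// ler_nat.
    move: hm; rewrite gt_max => /andP[/ltW hs /ltW hfs].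
    rewrite /f1 indicE mem_set ?mul1r ?subrr ?expr0n//.
    by split => /=; rewrite in_itv/= -ler_norml.
  - move=> n; apply/aeW => s; rewrite /f1 indicE; case: (_ \in _).
      by rewrite mul1r subrr expr0n normr0 sqr_ge0.
    by rewrite mul0r subr0 ger0_norm// sqr_ge0.
have /cvgrPdist_lt /(_ _ e4) [N _ /(_ N (leqnn _))] := c1.
rewrite /= sub0r normrN ger0_norm ?sq_Rint_ge0// => fN.
pose M : R := N.+1%:R; have M0 : 0 < M by rewrite ltr0n.
pose E : set (measurableTypeR R) := `[- M, M]%classic.
have mE : measurable E by exact: measurable_itv.
have if1 : mu.-integrable E (EFin \o f1 N).
  apply: (le_integrable mE (g := EFin \o (fun=> M))) => //=.
  - by apply/measurable_EFinP; exact: (measurable_funS measurableT (@subsetT _ _)).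
  - move=> s _; rewrite lee_fin (@ger0_norm _ M (ltW M0)) /f1 indicE.
    have [h|_] := boolP (s \in B N); last by rewrite mul0r normr0; exact: ltW.
    by rewrite mul1r ler_norml; move/set_mem: h => [_ /=]; rewrite in_itv.
  - apply: continuous_compact_integrable; first exact: segment_compact.
    by apply: continuous_subspaceT; exact: cst_continuous.
have [|g_ [cg ig gf1]] := approximation_continuous_integrable mE _ if1.
  pose E0 : set R := `[- M, M]%classic.
  have : (mu E0 < +oo)%E by rewrite lebesgue_measure_itv/=; case: ifPn => _; exact: ltry.
  exact.
have e8 : 0 < e / (8 * M) by rewrite divr_gt0// mulr_gt0.
move/fine_cvgP : gf1 => [_ /cvgrPdist_lt /(_ _ e8) [n _ /(_ n (leqnn _))]].
set g := g_ n; rewrite /= sub0r normrN.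
pose w s := \1_E s * `|f1 N s - g s|.
have wE : (fun z : R => `|f1 N z - g z|%:E)%E \_ E = EFin \o w.
  apply/funext => s; rewrite patchE /w /= indicE.
  by case: (s \in E); rewrite ?mul1r ?mul0r.
have iw : integ mu w.
  have : mu.-integrable E (fun z => `|f1 N z - g z|%:E).
    by apply: (@integrable_norm _ _ _ mu E (fun s => f1 N s - g s)); exact: (integrableB mE if1 (ig n)).
  by move/(integrable_mkcond _ mE); rewrite wE.
rewrite integral_mkcond wE -/(Rintegral mu setT w) => /(le_lt_trans (ler_norm _)) wlt.
pose phi s := Num.max (- M) (Num.min M (g s)).
have cphi : continuous phi.
  move=> s; apply: (@continuous_max _ _ (fun=> - M) (fun s => Num.min M (g s))); first exact: cvg_cst.
  by apply: (@continuous_min _ _ (fun=> M) g); [exact: cvg_cst|exact: cg].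
have phiM s : `|phi s| <= M.
  rewrite ler_norml /phi le_max lexx /= ge_max ge_min lexx /= andbT; lra.
have [hf' cf'] := corr_cvg0_cut M0 cphi phiM.
set f' := (fun s => _) in hf' cf'.
exists f'; split => //.
have le1 s : (f1 N s - f' s) ^+ 2 <= (2 * M) * w s.
  rewrite /w /f' /f1 !indicE.
  have [sE|sE] := boolP (s \in E); last first.
    rewrite !mul0r subr0 mulr0 memNset ?mul0r ?expr0n// => -[h _].
    by move/negP: sE; apply; exact/mem_set.
  rewrite !mul1r.
  have : `|(s \in B N)%:R * f s| <= M.
    have [h|_] := boolP (s \in B N); last by rewrite mul0r normr0; exact: ltW.
    by rewrite mul1r ler_norml; move/set_mem: h => [_ /=]; rewrite in_itv.
  move: ((s \in B N)%:R * f s) => y yM; have := phiM s.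
  have : `|y - phi s| <= `|y - g s|.
    move: yM; rewrite ler_norml /phi => /andP[y1 y2].
    rewrite maxEle minEle; case: (leP M (g s)) => hg1; case: ifPn => hg2; do ?[move: hg2; rewrite -ltNge => hg2];
    rewrite !ler_norml; case: (ger0P (y - g s)) => h3; apply/andP; split; lra.
  rewrite -(real_normK (num_real (y - phi s))) => h1 h2.
  rewrite expr2; apply: ler_pM => //; rewrite (le_trans (ler_normB _ _))//; lra.
have i1 : integ mu (fun s => (f s - f1 N s) ^+ 2) by case: (sqintB hf (hf1 N)).
have i2 : integ mu (fun s => (f1 N s - f' s) ^+ 2) by case: (sqintB (hf1 N) hf').
have i3 : integ mu (fun s => (f s - f' s) ^+ 2) by case: (sqintB hf hf').
have h2 : \int[mu]_s (f1 N s - f' s) ^+ 2 <= (2 * M) * \int[mu]_s w s.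
  by rewrite -RintegralZl//; apply: le_Rint => //; exact: integZ.
apply: (@le_trans _ _ (2 * \int[mu]_s (f s - f1 N s) ^+ 2 + 2 * \int[mu]_s (f1 N s - f' s) ^+ 2)).
  rewrite -!RintegralZl// -RintegralD//; [|exact: integZ..].
  apply: le_Rint => //; first by apply: integD; exact: integZ.
  move=> s; have := sqr_ge0 ((f s - f1 N s) - (f1 N s - f' s)).
  by set u := f1 N s; set v := f' s; nra.
have h4 : (2 * M) * \int[mu]_s w s <= e / 4.
  rewrite (_ : e / 4 = (2 * M) * (e / (8 * M))); last by field; rewrite gt_eqF.
  by rewrite ler_wpM2l ?mulr_ge0 ?ltW.
exact: arith fN h2 h4.
Qed.

End correlation.

(** * Oscillatory integrals by parts *)

Section calculus.
Variable R : realType.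
Local Notation mu := (@lebesgue_measure R).

Lemma Rint_FTC (F f : R -> R) (c W : R) : c < W ->
  (forall w : R, c <= w -> is_derive w 1 F (f w)) ->
  (forall w : R, c <= w -> {for w, continuous f}) ->
  mu.-integrable `[c, W] (EFin \o f) /\ \int[mu]_(w in `[c, W]) f w = F W - F c.
Proof.
move=> cW dF cf.
have cf' : {within `[c, W], continuous f}.
  apply: continuous_in_subspaceT => w; rewrite inE/= in_itv/= => /andP[w0 _]; exact: cf.
have cF (w : R) : c <= w -> {for w, continuous F}.
  move=> w0; apply: differentiable_continuous; apply/derivable1_diffP.
  by have [] := dF w w0.
split; first by apply: continuous_compact_integrable => //; exact: segment_compact.
rewrite /Rintegral (continuous_FTC2 cW cf' (F := F)) //.
- split.
  + by move=> w; rewrite in_itv/= => /andP[w0 _]; have [] := dF w (ltW w0).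
  + by apply: cvg_at_right_filter; exact: cF.
  + by apply: cvg_at_left_filter; apply: cF; exact: ltW.
- move=> w; rewrite in_itv/= => /andP[w0 _]; rewrite derive1E.
  by apply: derive_val; exact: dF (ltW w0).
Qed.

(** If [f] differs from the derivative of [F] by at most the derivative of [G],
the integral of [f] differs from the increment of [F] by at most that of [G]. *)
Lemma Rint_FTC_bound (F G f dF g : R -> R) (W : R) : 0 < W ->
  (forall w : R, 0 <= w -> is_derive w 1 F (dF w)) ->
  (forall w : R, 0 <= w -> is_derive w 1 G (g w)) ->
  (forall w : R, 0 <= w -> {for w, continuous dF}) ->
  (forall w : R, 0 <= w -> {for w, continuous g}) ->
  (forall w : R, 0 <= w -> {for w, continuous f}) ->
  (forall w : R, 0 <= w -> `|f w - dF w| <= g w) ->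
  `|\int[mu]_(w in `[0, W]) f w - (F W - F 0)| <= G W - G 0.
Proof.
move=> W0 hF hG cdF cg cf fg.
have [idF <-] := Rint_FTC W0 hF cdF; have [ig <-] := Rint_FTC W0 hG cg.
have if_ : mu.-integrable `[0, W] (EFin \o f).
  apply: continuous_compact_integrable; first exact: segment_compact.
  apply: continuous_in_subspaceT => w; rewrite inE/= in_itv/= => /andP[w0 _]; exact: cf.
rewrite -RintegralB//.
have i1 : mu.-integrable `[0, W] (EFin \o (fun w => f w - dF w)).
  exact: (integrableB _ if_ idF).
rewrite (le_trans (le_normr_Rintegral _ i1))//; apply: le_Rintegral => //.
  exact: (@integrable_norm _ _ _ mu _ (fun w => f w - dF w)).
by move=> w /=; rewrite in_itv/= => /andP[w0 _]; exact: fg.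
Qed.

Lemma is_derive_pow1 (c w : R) : 0 <= w ->
  is_derive w 1 (fun x : R => (1 + x) `^ c) (c * (1 + w) `^ (c - 1)).
Proof.
move=> w0; have w1 : 1 + w \in `]0, +oo[ by rewrite in_itv/= andbT; lra.
have h1 : is_derive (1 + w) 1 (@powR R ^~ c) (c * (1 + w) `^ (c - 1)).
  apply: DeriveDef; first exact: derivable_powR.
  by rewrite -derive1E powR_derive1.
have h2 : is_derive w 1 (fun x : R => 1 + x) 1.
  by apply: is_derive_eq; rewrite add0r mulr1.
have := @is_derive1_comp R (@powR R ^~ c) (fun x => 1 + x) w _ _ h1 h2.
by rewrite mulr1.
Qed.

Lemma continuous_pow1 (c w : R) : 0 <= w -> {for w, continuous (fun x : R => (1 + x) `^ c)}.
Proof.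
move=> w0; apply: differentiable_continuous; apply/derivable1_diffP.
by have [] := is_derive_pow1 c w0.
Qed.

Section damped.
Variables (e th : R).
Hypotheses (e0 : 0 < e) (th0 : 0 < th).
Let D := e ^+ 2 + th ^+ 2.

Definition damped_cos (w : R) := expR (- (e * w)) * cos (th * w).
(** [damped_cos1] and [damped_cos2] are the successive antiderivatives of
[damped_cos] that vanish at infinity. *)
Definition damped_cos1 (w : R) := expR (- (e * w)) * (th * sin (th * w) - e * cos (th * w)) / D.
Definition damped_cos2 (w : R) :=
  expR (- (e * w)) * ((e ^+ 2 - th ^+ 2) * cos (th * w) - 2 * e * th * sin (th * w)) / D ^+ 2.

Let D0 : 0 < D. Proof. by rewrite addr_gt0// exprn_gt0. Qed.
Let Dn0 : D != 0. Proof. by rewrite gt_eqF. Qed.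

Let is_derive_expN (w : R) : is_derive w 1 (fun x : R => expR (- (e * x))) (- e * expR (- (e * w))).
Proof. by apply: is_derive_eq; rewrite /GRing.scale/=; ring. Qed.

Let is_derive_cosM (w : R) : is_derive w 1 (fun x : R => cos (th * x)) (- th * sin (th * w)).
Proof. by apply: is_derive_eq; rewrite /GRing.scale/=; ring. Qed.

Let is_derive_sinM (w : R) : is_derive w 1 (fun x : R => sin (th * x)) (th * cos (th * w)).
Proof. by apply: is_derive_eq; rewrite /GRing.scale/=; ring. Qed.

Lemma is_derive_damped_cos1 (w : R) : is_derive w 1 damped_cos1 (damped_cos w).
Proof.
have H1 := is_derive_expN w; have H2 := is_derive_cosM w; have H3 := is_derive_sinM w.
rewrite /damped_cos1 /damped_cos; apply: is_derive_eq.
by rewrite /GRing.scale/=; move: Dn0; rewrite /D => Dn; field.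
Qed.

Lemma is_derive_damped_cos2 (w : R) : is_derive w 1 damped_cos2 (damped_cos1 w).
Proof.
have H1 := is_derive_expN w; have H2 := is_derive_cosM w; have H3 := is_derive_sinM w.
rewrite /damped_cos1 /damped_cos2; apply: is_derive_eq.
by rewrite /GRing.scale/=; move: Dn0; rewrite /D => Dn; field.
Qed.

Lemma continuous_damped_cos : continuous damped_cos.
Proof.
move=> w; apply: differentiable_continuous; apply/derivable1_diffP.
have H1 := is_derive_expN w; have H2 := is_derive_cosM w.
by apply: derivableM; [have [] := H1|have [] := H2].
Qed.

Let expN_le1 (w : R) : 0 <= w -> 0 < expR (- (e * w)) <= 1.
Proof. by move=> w0; rewrite expR_gt0 -expR0 ler_expR oppr_le0 mulr_ge0// ltW. Qed.

Let cs_le (x y t : R) : (x * sin t + y * cos t) ^+ 2 <= x ^+ 2 + y ^+ 2.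
Proof.
have := cos2Dsin2 t; have := sqr_ge0 (x * cos t - y * sin t).
set c := cos t; set s := sin t => h1 h2.
have -> : x ^+ 2 + y ^+ 2 = (x ^+ 2 + y ^+ 2) * (c ^+ 2 + s ^+ 2) by rewrite h2 mulr1.
rewrite -subr_ge0; apply: (le_trans h1); rewrite le_eqVlt; apply/orP; left; apply/eqP; ring.
Qed.

Lemma damped_cos1_le (w : R) : 0 <= w -> `|damped_cos1 w| <= th^-1.
Proof.
move=> w0; have /andP[x0 x1] := expN_le1 w0.
rewrite -(@ler_pXn2r _ 2%N)// ?nnegrE ?invr_ge0 ?(ltW th0)//.
rewrite real_normK ?num_real// /damped_cos1.
rewrite !exprMn (exprVn D).
have := cs_le th (- e) (th * w); rewrite mulNr => h.
apply: (@le_trans _ _ (1 * D / D ^+ 2)).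
  apply: ler_pM => //.
  - by rewrite mulr_ge0 ?sqr_ge0// exprn_ge0// ltW.
  - by rewrite invr_ge0 exprn_ge0// ltW.
  - apply: ler_pM; rewrite ?sqr_ge0//.
      by rewrite exprn_ile1// ltW.
    by rewrite (le_trans h)// /D sqrrN addrC.
rewrite mul1r expr2 invfM mulrA mulfV// mul1r exprVn lef_pV2 ?posrE ?exprn_gt0//.
by rewrite /D lerDr sqr_ge0.
Qed.

Lemma damped_cos2_le (w : R) : 0 <= w -> `|damped_cos2 w| <= (th ^+ 2)^-1.
Proof.
move=> w0; have /andP[x0 x1] := expN_le1 w0.
apply: (@le_trans _ _ D^-1); last first.
  by rewrite lef_pV2 ?posrE ?exprn_gt0// /D lerDr sqr_ge0.
rewrite -(@ler_pXn2r _ 2%N)// ?nnegrE ?invr_ge0 ?(ltW D0)//.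
rewrite real_normK ?num_real// /damped_cos2 !exprMn.
have := cs_le (- (2 * e * th)) (e ^+ 2 - th ^+ 2) (th * w); rewrite addrC mulNr => h.
apply: (@le_trans _ _ (1 * D ^+ 2 / (D ^+ 2) ^+ 2)).
  rewrite (exprVn (D ^+ 2)); apply: ler_pM => //.
  - by rewrite mulr_ge0 ?sqr_ge0// exprn_ge0// ltW.
  - by rewrite invr_ge0 exprn_ge0// exprn_ge0// ltW.
  - apply: ler_pM; rewrite ?sqr_ge0//.
      by rewrite exprn_ile1// ltW.
    by rewrite (le_trans h)// le_eqVlt; apply/orP; left; apply/eqP; rewrite /D; ring.
by rewrite mul1r [X in _ / X]expr2 invfM mulrA mulfV ?expf_neq0// mul1r exprVn.
Qed.

(** Interpolation between the two bounds [2 / th ^ 2], best for large [w], and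
[w / th], from the mean value theorem, best for small [w]. *)
Lemma damped_cos2_diff_le (p w : R) : 0 < p <= 1 -> 0 <= w ->
  `|damped_cos2 w - damped_cos2 0| <= 2 * (th `^ p / th ^+ 2) * (1 + w) `^ p.
Proof.
move=> /andP[p0 p1] w0.
have -> : 2 * (th `^ p / th ^+ 2) * (1 + w) `^ p = 2 * (th * (1 + w)) `^ p / th ^+ 2.
  rewrite powRM ?(ltW th0)//; last lra.
  ring.
have th2 : 0 < th ^+ 2 by rewrite exprn_gt0.
have [h|h] := leP 1 (th * (1 + w)).
  apply: (@le_trans _ _ (2 / th ^+ 2)).
    apply: (le_trans (ler_normB _ _)); rewrite mulrDl !mul1r.
    by apply: lerD; exact: damped_cos2_le.
  rewrite ler_wpM2r ?invr_ge0 ?(ltW th2)// ler_pMr//.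
  by rewrite -[leLHS](powRr0 (th * (1 + w))) ler_powR// ltW.
have [->|wn0] := eqVneq w 0.
  by rewrite subrr normr0 !mulr_ge0 ?powR_ge0 ?invr_ge0 ?(ltW th2).
have w0' : 0 < w by rewrite lt_neqAle eq_sym wn0.
have [c cw ->] : exists2 c, c \in `[0, w] & damped_cos2 w - damped_cos2 0 = damped_cos1 c * (w - 0).
  apply: MVT_segment => // [x _|]; first exact: is_derive_damped_cos2.
  apply: derivable_within_continuous => x _; by have [] := is_derive_damped_cos2 x.
rewrite subr0 normrM (ger0_norm w0).
apply: (@le_trans _ _ (th^-1 * w)).
  by rewrite ler_wpM2r// damped_cos1_le// (itvP cw).
have -> : th^-1 * w = (th * w) / th ^+ 2 by field; rewrite gt_eqF.
rewrite ler_wpM2r ?invr_ge0 ?(ltW th2)//.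
apply: (@le_trans _ _ ((th * (1 + w)) `^ p)); last first.
  by rewrite ler_peMl ?powR_ge0//; lra.
apply: (@le_trans _ _ (th * (1 + w))); first by rewrite ler_wpM2l ?ltW//; lra.
apply: ger1_powR => //; rewrite ltW// andbT mulr_gt0//; lra.
Qed.

End damped.

Section by_parts.
Variables (al u e W : R).
Hypotheses (al0 : 0 < al) (al1 : al < 1) (u0 : 0 < u) (e0 : 0 < e) (W0 : 0 < W).
Let a := u * (1 + W) `^ al.
Let p := (1 - al) / 2.
Let th := 2 * pi * u.

(** Two integrations by parts. Here [a - u (1 + w)^al] vanishes at the right end
[W], so the first one leaves only the boundary term [e / (e^2 + th^2) (a - u)]
at 0. The second one uses [damped_cos2 - damped_cos2 0], which vanishes at 0;
it grows at most like [(1 + w)^p], and the second derivative of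
[u (1 + w)^al] decays like [(1 + w)^(al - 2)], so the remaining integrand is
[O((1 + w)^(- p - 1))], integrable uniformly in [e] and [W]. *)
Lemma damped_integral_bound :
  `|\int[mu]_(w in `[0, W]) (damped_cos e th w * (a - u * (1 + w) `^ al))
    - e / (e ^+ 2 + th ^+ 2) * (a - u)| <= 6 * (u `^ p / u).
Proof.
have pi0 : 0 < (pi : R) := pi_gt0 R.
move: (al0) (al1) (u0) (W0) => al0' al1' u0' W0'.
have th0 : 0 < th by rewrite /th !mulr_gt0.
have p0 : 0 < p by rewrite divr_gt0// subr_gt0.
have p1 : p <= 1 by rewrite ler_pdivrMr//; move: al0; lra.
pose E1 := damped_cos1 e th.
pose E2 w := damped_cos2 e th w - damped_cos2 e th 0.
pose l w := a - u * (1 + w) `^ al.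
pose l1 w := - u * (al * (1 + w) `^ (al - 1)).
pose l2 w := - u * (al * ((al - 1) * (1 + w) `^ (al - 1 - 1))).
pose F w := E1 w * l w - E2 w * l1 w.
pose dF w := damped_cos e th w * l w - E2 w * l2 w.
pose C := 2 * (th `^ p / th ^+ 2).
pose G w := - (C * u * al * (1 - al) / p) * (1 + w) `^ (- p).
pose g w := C * u * al * (1 - al) * (1 + w) `^ (- p - 1).
have dE1 (w : R) : is_derive w 1 E1 (damped_cos e th w) by exact: is_derive_damped_cos1.
have dE2 (w : R) : is_derive w 1 E2 (E1 w).
  have := is_derive_damped_cos2 e0 th0 w => h.
  by apply: is_derive_eq; rewrite oppr0 addr0.
have dl (w : R) : 0 <= w -> is_derive w 1 l (l1 w).
  move=> w0; have h := is_derive_pow1 al w0.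
  by apply: is_derive_eq; rewrite /GRing.scale/= /l1; ring.
have dl1 (w : R) : 0 <= w -> is_derive w 1 l1 (l2 w).
  move=> w0; have h := is_derive_pow1 (al - 1) w0.
  by apply: is_derive_eq; rewrite /GRing.scale/= /l2; ring.
have hF (w : R) : 0 <= w -> is_derive w 1 F (dF w).
  move=> w0; have h1 := dl w w0; have h2 := dl1 w w0; have h3 := dE1 w; have h4 := dE2 w.
  by apply: is_derive_eq; rewrite /GRing.scale/= /dF; ring.
have hG (w : R) : 0 <= w -> is_derive w 1 G (g w).
  move=> w0; have h := is_derive_pow1 (- p) w0.
  apply: is_derive_eq; rewrite /GRing.scale/= /g.
  by field; rewrite gt_eqF.
have cE2 (w : R) : {for w, continuous E2}.
  apply: differentiable_continuous; apply/derivable1_diffP; by have [] := dE2 w.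
have cdl (w : R) : 0 <= w -> {for w, continuous l}.
  move=> w0; apply: differentiable_continuous; apply/derivable1_diffP; by have [] := dl w w0.
have cf (w : R) : 0 <= w -> {for w, continuous (fun x => damped_cos e th x * l x)}.
  by move=> w0; apply: cvgM; [exact: continuous_damped_cos|exact: cdl].
have cdF (w : R) : 0 <= w -> {for w, continuous dF}.
  move=> w0; apply: cvgB; first exact: cf.
  apply: cvgM; first exact: cE2.
  apply: cvgMl_tmp; apply: cvgMl_tmp; apply: cvgMl_tmp; exact: continuous_pow1.
have cg (w : R) : 0 <= w -> {for w, continuous g}.
  by move=> w0; apply: cvgMl_tmp; exact: continuous_pow1.
have C0 : 0 <= C by rewrite /C mulr_ge0// divr_ge0 ?powR_ge0// exprn_ge0// ltW.
have bnd (w : R) : 0 <= w -> `|damped_cos e th w * l w - dF w| <= g w.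
  move=> w0; rewrite /dF opprB addrC subrK normrM.
  have E2w : `|E2 w| <= C * (1 + w) `^ p by apply: damped_cos2_diff_le => //; exact/andP.
  have -> : `|l2 w| = u * al * (1 - al) * (1 + w) `^ (al - 1 - 1).
    rewrite /l2 !normrM normrN (gtr0_norm u0) (gtr0_norm al0) (ger0_norm (powR_ge0 _ _)).
    rewrite ltr0_norm; last lra.
    ring.
  (* This is where the value of p matters: p + (al - 2) = - p - 1. *)
  have -> : g w = (C * (1 + w) `^ p) * (u * al * (1 - al) * (1 + w) `^ (al - 1 - 1)).
    rewrite /g (_ : - p - 1 = p + (al - 1 - 1)); last by rewrite /p; field.
    rewrite (@powRD _ _ p (al - 1 - 1)); first ring.
    by apply/implyP => _; rewrite gt_eqF//; lra.
  by rewrite ler_wpM2r// !mulr_ge0 ?powR_ge0 ?subr_ge0 ?(ltW u0) ?(ltW al0) ?(ltW al1).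
have := Rint_FTC_bound W0 hF hG cdF cg cf bnd.
have E20 : E2 0 = 0 by rewrite /E2 subrr.
have lW : l W = 0 by rewrite /l subrr.
have -> : F W - F 0 = e / (e ^+ 2 + th ^+ 2) * (a - u) - E2 W * l1 W.
  rewrite /F E20 lW mul0r subr0 mulr0 add0r /l /E1 /damped_cos1.
  rewrite addr0 powR1 !mulr0 oppr0 expR0 sin0 cos0 mulr0 mulr1 mulr1 mul1r sub0r.
  ring.
set I := Rintegral _ _ _; set Q := e / _ * _ => HI.
have W1 : 1 <= 1 + W by lra.
(* The boundary term of the second integration by parts. *)
have tail : `|E2 W * l1 W| <= C * u.
  rewrite normrM.
  have E2w : `|E2 W| <= C * (1 + W) `^ p by apply: damped_cos2_diff_le; rewrite ?p0 ?p1// ltW.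
  have -> : `|l1 W| = u * (al * (1 + W) `^ (al - 1)).
    by rewrite /l1 !normrM normrN (gtr0_norm u0) (gtr0_norm al0) (ger0_norm (powR_ge0 _ _)).
  apply: (@le_trans _ _ (C * (1 + W) `^ p * (u * (al * (1 + W) `^ (al - 1))))).
    by rewrite ler_wpM2r// !mulr_ge0 ?powR_ge0 ?(ltW u0) ?(ltW al0).
  have -> : C * (1 + W) `^ p * (u * (al * (1 + W) `^ (al - 1))) = C * u * (al * (1 + W) `^ (- p)).
    rewrite (_ : - p = p + (al - 1)); last by rewrite /p; field.
    rewrite (@powRD _ _ p (al - 1)); first ring.
    by apply/implyP => _; rewrite gt_eqF//; lra.
  rewrite ler_piMr//; first exact: mulr_ge0 C0 (ltW u0).
  rewrite mulr_ile1 ?powR_ge0 ?(ltW al0) ?(ltW al1)//.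
  by rewrite -[leRHS](powRr0 (1 + W)) ler_powR// oppr_le0 ltW.
have GW : G W - G 0 <= 2 * (C * u).
  rewrite /G addr0 powR1 mulr1 opprK mulNr addrC.
  have -> : C * u * al * (1 - al) / p = 2 * al * (C * u) by rewrite /p; field; lra.
  have Cu0 : 0 <= C * u := mulr_ge0 C0 (ltW u0).
  have : 0 <= 2 * al * (C * u) * (1 + W) `^ (- p).
    apply: mulr_ge0; last exact: powR_ge0.
    by apply: mulr_ge0 => //; apply: mulr_ge0 => //; exact: ltW.
  have : 0 <= (1 - al) * (C * u) by apply: mulr_ge0 => //; lra.
  move: (C * u) Cu0 => x x0; set y := 2 * al * x * _; lra.
(* Boundary term and remainder add up to 3 C u, whence the constant 6. *)
have Cu : C * u <= 2 * (u `^ p / u).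
  rewrite /C -mulrA ler_wpM2l//.
  pose k : R := 2 * pi.
  have k1 : 1 <= k by rewrite /k; have := pi_ge2 R; lra.
  have k0 : 0 < k by lra.
  rewrite /th -/k powRM ?(ltW u0) ?(ltW k0)//.
  have -> : k `^ p * u `^ p / (k * u) ^+ 2 * u = (k `^ p / k ^+ 2) * (u `^ p / u).
    by field; rewrite !gt_eqF.
  rewrite ler_piMl ?divr_ge0 ?powR_ge0 ?(ltW u0)//.
  rewrite ler_pdivrMr ?exprn_gt0// mul1r -powR_mulrn ?(ltW k0)// ler_powR//.
  lra.
move: tail HI; rewrite !ler_norml => /andP[t1 t2] /andP[H1 H2].
move: (E2 W * l1 W) (G W - G 0) (C * u) (u `^ p / u) t1 t2 H1 H2 GW Cu.
move: Q I => q i x y z v *; apply/andP; split; lra.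
Qed.
End by_parts.
End calculus.

(** * The cosine transform of a two-sided exponential *)

Section even_integral.
Variable R : realType.
Local Notation mu := (@lebesgue_measure R).

Lemma Rint_even (f : R -> R) : integ mu f -> (forall x, f (- x) = f x) ->
  \int[mu]_x f x = 2 * \int[mu]_(x in `[0, +oo[) f x.
Proof.
move=> if_ fe; have mf : measurable_fun setT f := integ_meas if_.
have -> : [set: R] = `]-oo, 0[%classic `|` `[0, +oo[%classic.
  by rewrite (itv_setU_setT true 0).
rewrite Rintegral_setU//; last 2 first.
- by rewrite (itv_setU_setT true 0).
- apply/disj_setPS => x [/=]; rewrite !in_itv/= => x0; rewrite andbT.
  by rewrite leNgt x0.
rewrite mulr_natl mulr2n; congr (_ + _).
rewrite -[RHS]Rintegral_itv_obnd_cbnd; last by apply: integrableS if_.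
rewrite [LHS]Rintegral_mkcond [RHS]Rintegral_mkcond.
rewrite -[LHS]Rint_opp; last first.
  by apply: (measurable_restrictT _ _).1 => //; exact: measurable_funTS.
apply: eq_Rintegral => x _; rewrite !patchE.
have -> : (- x \in `]-oo, 0[%classic) = (x \in `]0, +oo[%classic).
  by rewrite !mem_setE !in_itv/= andbT oppr_lt0.
by case: ifP; rewrite ?fe.
Qed.

(** Both halves are exponential densities up to a factor. *)
Lemma integ_expN (e : R) : 0 < e -> integ mu (fun w => expR (- (e * `|w|))).
Proof.
move=> e0.
have i1 := integrable_exponential_pdf e0.
have i2 : integ mu (fun x => exponential_pdf e (0 - x)) by exact: (integ_refl 0 i1).
apply: integ_dom (integZ e^-1 (integD i1 i2)) _.
  apply: measurableT_comp => //; apply: measurable_funN.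
  by apply: measurable_funM => //; exact: measurableT_comp.
move=> w; rewrite ger0_norm ?expR_ge0// sub0r.
have pdf0 x : 0 <= exponential_pdf e x by apply: exponential_pdf_ge0; exact: ltW.
have pdfE x : 0 <= x -> exponential_pdf e x = e * expR (- (e * x)).
  by move=> x0; rewrite exponential_pdfE// mulNr.
rewrite -ler_pdivrMl ?invr_gt0// invrK.
have [w0|w0] := leP 0 w.
  by rewrite pdfE// ger0_norm// lerDl.
by rewrite (pdfE (- w)); [rewrite ltr0_norm// lerDr|rewrite oppr_ge0 ltW].
Qed.

Lemma Rint_damped_cos (e th : R) : 0 < e -> 0 < th ->
  \int[mu]_w (expR (- (e * `|w|)) * cos (th * w)) = 2 * e / (e ^+ 2 + th ^+ 2).
Proof.
move=> e0 th0.
have me : measurable_fun setT (fun w : R => cos (th * w)).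
  apply: measurableT_comp; last exact: mulrl_measurable.
  apply: continuous_measurable_fun; exact: continuous_cos.
have i1 : integ mu (fun w => expR (- (e * `|w|)) * cos (th * w)).
  apply: integ_dom (integ_expN e0) _.
    by apply: measurable_funM => //; exact: integ_meas (integ_expN e0).
  by move=> w; rewrite normrM (ger0_norm (expR_ge0 _)) ler_piMr ?expR_ge0// cos_max.
rewrite Rint_even//; last by move=> x; rewrite normrN mulrN cosN.
rewrite -[RHS]mulrA; congr (2 * _).
rewrite Rintegral_mkcond.
set f := _ \_ _.
have mf : measurable_fun setT f.
  apply: (measurable_restrictT _ _).1 => //; apply: measurable_funTS; exact: integ_meas i1.
pose f_ n (w : R) := \1_(`[0, n.+1%:R]%classic : set R) w * f w.
have fE w : 0 <= w -> f w = damped_cos e th w.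
  move=> w0; rewrite /f patchE mem_set/= ?in_itv/= ?w0// ger0_norm//.
have cv : \int[mu]_w f_ n w @[n --> \oo] --> \int[mu]_w f w.
  have [] := @dominated_cvgR _ _ _ mu f_ f (fun w => expR (- (e * `|w|))) _ mf _ (integ_expN e0) _ => //.
  - by move=> n; apply: measurable_funM.
  - apply/aeW => w; apply: cvg_near_cst.
    have [w0|w0] := leP 0 w; last first.
      apply: nearW => n; rewrite /f_ /f patchE memNset ?mulr0//=.
      by rewrite in_itv/= andbT; apply/negP; rewrite -ltNge.
    exists (Num.truncn w) => // n /= hn; rewrite /f_ indicE mem_set ?mul1r//=.
    rewrite in_itv/= w0/= ltW// (lt_le_trans (Num.Theory.truncnS_gt _))// ler_nat ltnS; exact: hn.
  - move=> n; apply/aeW => w; rewrite /f_ indicE normrM.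
    have h : `|f w| <= expR (- (e * `|w|)).
      rewrite /f patchE; case: ifPn => _; last by rewrite normr0 expR_ge0.
      by rewrite normrM (ger0_norm (expR_ge0 _)) ler_piMr ?expR_ge0// cos_max.
    by case: (_ \in _); rewrite ?normr1 ?mul1r// normr0 mul0r expR_ge0.
have f_E n : \int[mu]_w f_ n w = damped_cos1 e th n.+1%:R - damped_cos1 e th 0.
  have [_ <-] := Rint_FTC (ltr0Sn R n) (fun w _ => is_derive_damped_cos1 e0 th0 w)
    (fun w _ => @continuous_damped_cos _ e th w).
  rewrite [RHS]Rintegral_mkcond; apply: eq_Rintegral => w _.
  rewrite /f_ indicE patchE; case: ifPn => h; last by rewrite mul0r.
  by rewrite mul1r fE//; move/set_mem: h => /=; rewrite in_itv/= => /andP[].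
have D0 : 0 < e ^+ 2 + th ^+ 2 by rewrite addr_gt0// exprn_gt0.
have lim : damped_cos1 e th n.+1%:R - damped_cos1 e th 0 @[n --> \oo] --> 0 - damped_cos1 e th 0.
  apply: cvgB; last exact: cvg_cst.
  apply/cvgr0Pnorm_le => d d0.
  pose C := (th + e) / (e ^+ 2 + th ^+ 2).
  have C0 : 0 < C by rewrite divr_gt0// addr_gt0.
  have : C * expR (- e) ^+ n @[n --> \oo] --> C * 0.
    apply: cvgMl_tmp; apply: cvg_expr; rewrite ger0_norm ?expR_ge0// -expR0 ltr_expR; lra.
  rewrite mulr0 => /cvgr0Pnorm_le /(_ d d0); apply: filterS => n.
  apply: le_trans; rewrite /damped_cos1 /C.
  rewrite !normrM (ger0_norm (expR_ge0 _)) normrX (ger0_norm (expR_ge0 _)) normfV (gtr0_norm D0) (gtr0_norm (addr_gt0 th0 e0)).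
  rewrite [leRHS]mulrAC ler_wpM2r ?invr_ge0 ?(ltW D0)// mulrC ler_pM ?expR_ge0//.
    rewrite (le_trans (ler_normB _ _))// !normrM (gtr0_norm th0) (gtr0_norm e0).
    by apply: lerD; rewrite ler_piMr ?(ltW th0) ?(ltW e0)// ler_norml ?cos_geN1 ?cos_le1 ?sin_geN1 ?sin_le1.
  rewrite -expRM_natr ler_expR mulNr lerN2 ler_wpM2l ?(ltW e0)// ler_nat//.
rewrite (_ : (fun n => _) = (fun n => damped_cos1 e th n.+1%:R - damped_cos1 e th 0)) in cv; last exact/funext.
rewrite (cvg_unique _ cv lim) // /damped_cos1 !mulr0 oppr0 expR0 sin0 cos0 mulr0 mulr1 mul1r.
by rewrite !sub0r mulNr opprK.
Qed.

End even_integral.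

(** * The regularized kernel *)

Lemma measurable_cos (R : realType) : measurable_fun setT (@cos R).
Proof. by apply: continuous_measurable_fun; exact: continuous_cos. Qed.

Lemma measurable_sin (R : realType) : measurable_fun setT (@sin R).
Proof. by apply: continuous_measurable_fun; exact: continuous_sin. Qed.

Section kernel.
Variable R : realType.
Local Notation mu := (@lebesgue_measure R).
Variables (al a : R).
Hypotheses (al0 : 0 <= al) (al1 : al < 1) (a0 : 0 < a).
Let p := (1 - al) / 2.

(** The autocorrelation at lag [u] of the atoms of frequency [w] without their
modulation; see [Rint_envelope]. *)
Definition overlap (w u : R) : R := Num.max 0 (a - `|u| * (1 + `|w|) `^ al).
Definition smoothed_kernel (e u : R) : R :=
  \int[mu]_w (expR (- (e * `|w|)) * cos (2 * pi * w * u) * overlap w u).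
Definition poisson (e u : R) : R := 2 * e / (e ^+ 2 + (2 * pi * u) ^+ 2).

Lemma powR1D_ge1 (w : R) : 1 <= (1 + `|w|) `^ al.
Proof.
by rewrite -[leLHS](powRr0 (1 + `|w|)) ler_powR// lerDl.
Qed.

Lemma overlap_ge0 w u : 0 <= overlap w u.
Proof. by rewrite /overlap le_max lexx. Qed.

Lemma overlap_le w u : overlap w u <= a.
Proof. by rewrite /overlap ge_max (ltW a0)/= gerBl mulr_ge0// powR_ge0. Qed.

Lemma overlap_eq0 w u : a <= `|u| -> overlap w u = 0.
Proof.
move=> au; apply/max_idPl; rewrite subr_le0 (le_trans au)// ler_peMr//.
exact: powR1D_ge1.
Qed.

Lemma measurable_overlap : measurable_fun setT (fun z : R * R => overlap z.1 z.2).
Proof.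
apply: measurable_maxr => //; apply: measurable_funB => //; apply: measurable_funM.
  by apply: measurableT_comp => //; exact: measurable_snd.
apply: (measurableT_comp (measurable_powR _)).
apply: measurable_funD => //.
by apply: measurableT_comp => //; exact: measurable_fst.
Qed.

Lemma measurable_cos_wu : measurable_fun setT (fun z : R * R => cos (2 * pi * z.1 * z.2)).
Proof.
apply: measurableT_comp; first by apply: continuous_measurable_fun; exact: continuous_cos.
apply: measurable_funM; last exact: measurable_snd.
by apply: measurable_funM => //; exact: measurable_fst.
Qed.

Lemma measurable_expN (e : R) : measurable_fun setT (fun w : R => expR (- (e * `|w|))).
Proof.
apply: measurableT_comp => //; apply: measurable_funN.
by apply: measurable_funM => //; exact: measurableT_comp.
Qed.

Lemma measurable_smoothed_integrand e :
  measurable_fun setT (fun z : R * R => expR (- (e * `|z.1|)) * cos (2 * pi * z.1 * z.2) * overlap z.1 z.2).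
Proof.
apply: measurable_funM; last exact: measurable_overlap.
apply: measurable_funM; last exact: measurable_cos_wu.
apply: (measurableT_comp (measurable_expN e)); exact: measurable_fst.
Qed.

Lemma measurable_smoothed_kernel e : measurable_fun setT (smoothed_kernel e).
Proof. exact: (measurable_Rint_fst mu (measurable_smoothed_integrand e)). Qed.

Lemma integ_smoothed e u : 0 < e ->
  integ mu (fun w => expR (- (e * `|w|)) * cos (2 * pi * w * u) * overlap w u).
Proof.
move=> e0; apply: integ_dom (integZ a (integ_expN e0)) _.
  exact: (measurable_fun_pair1 u (measurable_smoothed_integrand e)).
move=> w; rewrite !normrM (ger0_norm (expR_ge0 _)) (ger0_norm (overlap_ge0 _ _)) mulrC.
apply: ler_pM; rewrite ?overlap_ge0 ?overlap_le ?mulr_ge0 ?expR_ge0//.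
by rewrite ler_piMr ?expR_ge0// cos_max.
Qed.

Lemma smoothed_kernelN e u : smoothed_kernel e (- u) = smoothed_kernel e u.
Proof. by apply: eq_Rintegral => w _; rewrite mulrN cosN /overlap normrN. Qed.

Lemma overlap0 u : overlap 0 u = Num.max 0 (a - `|u|).
Proof. by rewrite /overlap normr0 addr0 powR1 mulr1. Qed.

(** The factor 12 is twice the 6 of [damped_integral_bound], once for each sign
of the frequency. *)
Definition majorant (u : R) : R := 12 * `|u| `^ (p - 1) * \1_(`[- a, a]%classic : set R) u.

Let pi0 : 0 < (pi : R) := pi_gt0 R.

(** For [al > 0] the atoms become so short at high frequencies that the overlap
at a fixed lag vanishes beyond some [W]. *)
Lemma overlap_cutoff u : 0 < al -> 0 < u < a -> exists2 W, 0 < W &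
  u * (1 + W) `^ al = a /\
  (forall w, 0 <= w -> overlap w u = if w <= W then a - u * (1 + w) `^ al else 0).
Proof.
move=> al0' /andP[u0 ua].
pose W := (a / u) `^ al^-1 - 1.
have au : 1 < a / u by rewrite ltr_pdivlMr// mul1r.
have W0 : 0 < W.
  have : 1 `^ al^-1 < (a / u) `^ al^-1.
    by apply: gt0_ltr_powR; rewrite ?invr_gt0// nnegrE ?ler01// ltW// divr_gt0.
  by rewrite powR1 /W subr_gt0.
have W1 : u * (1 + W) `^ al = a.
  rewrite /W addrC subrK -powRrM mulVf ?gt_eqF// powRr1; last by rewrite divr_ge0 ?ltW.
  by field; rewrite gt_eqF.
exists W => //; split => // w w0; rewrite /overlap (gtr0_norm u0) (ger0_norm w0).
have mono x y : 0 <= x -> x <= y -> u * (1 + x) `^ al <= u * (1 + y) `^ al.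
  move=> x0 xy; rewrite ler_wpM2l ?(ltW u0)// ge0_ler_powR ?nnegrE//; move: al0 x0 xy; lra.
case: ifPn => [wW|]; first by apply/max_idPr; rewrite subr_ge0 -[leRHS]W1 mono.
by rewrite -ltNge => /ltW Ww; apply/max_idPl; rewrite subr_le0 -[leLHS]W1 mono// ltW.
Qed.

(** All atoms have the same length, so the overlap does not depend on [w]. *)
Lemma smoothed_kernel_al0 e u : al = 0 -> 0 < e -> u != 0 ->
  smoothed_kernel e u = poisson e u * overlap 0 u.
Proof.
move=> al00 e0; wlog u0 : u / 0 < u.
  move=> H un0; have [u0|u0|u0] := ltgtP 0 u; first exact: H.
    have := H (- u); rewrite oppr_gt0 oppr_eq0 smoothed_kernelN !overlap0 /poisson.
    by rewrite normrN mulrN sqrrN; apply.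
  by rewrite u0 eqxx in un0.
move=> _; pose th := 2 * pi * u; have th0 : 0 < th by rewrite /th !mulr_gt0.
have E w : expR (- (e * `|w|)) * cos (2 * pi * w * u) = expR (- (e * `|w|)) * cos (th * w).
  by rewrite /th mulrAC.
have ovE w : overlap w u = overlap 0 u by rewrite /overlap al00 !powRr0.
rewrite /smoothed_kernel; under eq_Rintegral do rewrite ovE E.
rewrite RintegralZr//; first by rewrite Rint_damped_cos.
apply: (integ_dom (m := mu) _ (integ_expN e0)).
  apply: measurable_funM; first exact: measurable_expN.
  apply: measurableT_comp; last exact: mulrl_measurable.
  by apply: continuous_measurable_fun; exact: continuous_cos.
move=> w; rewrite normrM (ger0_norm (expR_ge0 _)).
by rewrite ler_piMr ?expR_ge0// cos_max.
Qed.

(** Everything is even in [u] and in [w]; on the positive quarter the overlap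
is cut off at [W], and [damped_integral_bound] applies. *)
Lemma smoothed_kernel_bound e u : 0 < e -> u != 0 ->
  `|smoothed_kernel e u - poisson e u * overlap 0 u| <= majorant u.
Proof.
move=> e0.
wlog u0 : u / 0 < u.
  move=> H un0; have [u0|u0|u0] := ltgtP 0 u; first exact: H.
    have := H (- u); rewrite oppr_gt0 oppr_eq0 smoothed_kernelN !overlap0 /poisson /majorant.
    rewrite normrN mulrN sqrrN.
    have -> : \1_(`[- a, a]%classic : set R) (- u) = \1_(`[- a, a]%classic : set R) u :> R.
      by rewrite !indicE !mem_setE !in_itv/= lerN2 andbC lerNl.
    by apply.
  by rewrite u0 eqxx in un0.
move=> _; have m0 : 0 <= majorant u by rewrite /majorant !mulr_ge0// powR_ge0.
have [au|ua] := leP a u.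
  have au' : a <= `|u| by rewrite (le_trans au)// ler_norm.
  rewrite /smoothed_kernel; under eq_Rintegral do rewrite overlap_eq0// mulr0.
  by rewrite Rintegral_cst// mul0r overlap_eq0// mulr0 subr0 normr0.
have ov0 : overlap 0 u = a - u.
  by rewrite overlap0 (gtr0_norm u0); apply/max_idPr; rewrite subr_ge0 ltW.
pose th := 2 * pi * u; have th0 : 0 < th by rewrite /th !mulr_gt0.
have E w : expR (- (e * `|w|)) * cos (2 * pi * w * u) = expR (- (e * `|w|)) * cos (th * w).
  by rewrite /th mulrAC.
move: al0; rewrite le_eqVlt => /predU1P[al00|alp].
  by rewrite (smoothed_kernel_al0 (esym al00) e0 (lt0r_neq0 u0)) subrr normr0.
have [W W0 [W1 Wov]] := overlap_cutoff alp (introT andP (conj u0 ua)).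
have -> : smoothed_kernel e u = 2 * \int[mu]_(w in `[0, W]) (damped_cos e th w * (a - u * (1 + w) `^ al)).
  rewrite /smoothed_kernel Rint_even; [|exact: integ_smoothed|]; last first.
    by move=> w; rewrite normrN mulrN mulNr cosN /overlap normrN.
  congr (2 * _); rewrite [LHS]Rintegral_mkcond [RHS]Rintegral_mkcond.
  apply: eq_Rintegral => w _; rewrite !patchE !mem_setE !in_itv/= andbT.
  have [w0|//] := leP 0 w; rewrite /= Wov// E ger0_norm//.
  by case: ifP => // _; rewrite mulr0.
have := damped_integral_bound alp al1 u0 e0 W0; rewrite W1 -/th.
rewrite ov0 /poisson -/th => H.
have -> : majorant u = 2 * (6 * (u `^ p / u)).
  rewrite /majorant (gtr0_norm u0) indicE mem_setE in_itv/= (ltW ua) andbT.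
  have -> : - a <= u by lra.
  rewrite mulr1 powRB ?powRr1 ?(ltW u0)//; first by ring.
  by apply/implyP => _; rewrite gt_eqF.
rewrite -[2 * e]/(2 * e) -!mulrA -mulrBr normrM ger0_norm// ler_wpM2l//.
by rewrite mulrA.
Qed.

End kernel.

(** * The Poisson kernel as an approximate identity *)

Section poisson_kernel.
Variable R : realType.
Local Notation mu := (@lebesgue_measure R).
Let pi0 : 0 < (pi : R) := pi_gt0 R.
Local Notation P := (@poisson R 1).

Let PE v : P v = 2 / (1 + (2 * pi * v) ^+ 2).
Proof. by rewrite /poisson mulr1 expr1n. Qed.

Let den_gt0 v : 0 < 1 + (2 * pi * v) ^+ 2 :> R.
Proof. by rewrite ltr_pwDl// sqr_ge0. Qed.

Let P_ge0 v : 0 <= P v.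
Proof. by rewrite PE divr_ge0// ltW. Qed.

Let cont_P : continuous P.
Proof.
rewrite (_ : P = fun v => 2 * (1 + (2 * pi * v) ^+ 2)^-1); last exact/funext/PE.
move=> v; apply: cvgMl_tmp; apply: cvgV; first by rewrite gt_eqF.
apply: cvgD; first exact: cvg_cst.
by apply: cvgM; apply: cvgMl_tmp; exact: cvg_id.
Qed.

Let mP : measurable_fun setT P. Proof. exact: continuous_measurable_fun. Qed.

Let int_half : (\int[mu]_(v in `[0%R, +oo[) (P v)%:E = (2^-1)%:E)%E.
Proof.
have F (v : R) : is_derive v 1 (fun x : R => pi^-1 * atan (2 * pi * x)) (P v).
  have h1 : is_derive v 1 (fun x : R => 2 * pi * x) (2 * pi).
    by apply: is_derive_eq; rewrite /GRing.scale/= mulr1.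
  have h2 := @is_derive1_comp R atan (fun x : R => 2 * pi * x) v _ _ (is_derive1_atan _) h1.
  apply: is_derive_eq; rewrite PE /GRing.scale/=.
  have := den_gt0 v; have := pi0; move: (@pi R) => q q0 d0.
  by field; rewrite !gt_eqF.
rewrite (@ge0_continuous_FTC2y _ P (fun x => pi^-1 * atan (2 * pi * x)) 0 (pi^-1 * (pi / 2))).
- rewrite mulr0 atan0 mulr0 sube0; congr EFin; rewrite mulrA mulVf ?mul1r// gt_eqF//.
- by move=> x _.
- by apply: continuous_subspaceT.
- apply: cvgMl_tmp; apply: (@cvg_comp _ _ _ (fun x => 2 * pi * x) atan _ (pinfty_nbhs R)); last exact: cvgy_atan.
  by apply: gt0_cvgMry; [rewrite mulr_gt0|exact: cvg_id].
- by move=> x _; have [] := F x.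
- have cF : {for (0 : R), continuous (fun x : R => pi^-1 * atan (2 * pi * x))}.
    by apply: differentiable_continuous; apply/derivable1_diffP; have [] := F 0.
  exact: cvg_at_right_filter.
- by move=> x _; rewrite derive1E; apply: derive_val; exact: F.
Qed.

Lemma integ_poisson1 : integ mu P.
Proof.
pose h := P \_ `[0, +oo[.
have ih : integ mu h.
  have iset : mu.-integrable `[0, +oo[ (EFin \o P).
    apply/integrableP; split; first exact/measurable_EFinP/measurable_funTS.
    under eq_integral do rewrite /= ger0_norm//.
    by rewrite int_half ltry.
  have mD : measurable (`[0%R, +oo[%classic : set (measurableTypeR R)) by exact: measurable_itv.
  by have := (integrable_mkcond _ mD).1 iset; rewrite restrict_EFin.
have i2 : integ mu (fun x => h (0 - x)) by exact: (integ_refl 0 ih).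
apply: integ_dom (integD ih i2) _ => // v; rewrite ger0_norm// sub0r /h !patchE !mem_setE !in_itv/= !andbT.
have PN : P (- v) = P v by rewrite /poisson mulrN sqrrN.
by rewrite oppr_ge0; case: (leP 0 v) => v0; case: (leP v 0) => v0' /=; rewrite ?PN ?addr0 ?add0r ?lerDl//; lra.
Qed.

Lemma Rint_poisson1 : \int[mu]_v P v = 1.
Proof.
rewrite Rint_even//; first by rewrite /Rintegral int_half/= mulfV.
  exact: integ_poisson1.
by move=> v; rewrite /poisson mulrN sqrrN.
Qed.

Lemma measurable_poisson (e : R) : 0 < e -> measurable_fun setT (poisson e).
Proof.
move=> e0; apply: continuous_measurable_fun => u.
apply: cvgMl_tmp; apply: cvgV; first by rewrite gt_eqF// ltr_pwDl ?exprn_gt0 ?sqr_ge0.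
apply: cvgD; first exact: cvg_cst.
by apply: cvgM; apply: cvgMl_tmp; exact: cvg_id.
Qed.

(** The substitution [u = e v] turns the Poisson kernel of parameter [e] into
that of parameter 1, of integral 1; dominated convergence applies with [B] times the latter. *)
Lemma poisson_cvg (h : R -> R) (B : R) (e : nat -> R) : measurable_fun setT h ->
  (forall u, `|h u| <= B) -> (forall n, 0 < e n) ->
  (forall v : R, h (e n * v) @[n --> \oo] --> h 0) ->
  (forall n, integ mu (fun u => h u * poisson (e n) u)) /\
  \int[mu]_u (h u * poisson (e n) u) @[n --> \oo] --> h 0.
Proof.
move=> mh hB e0 cvh.
have mpo n : measurable_fun setT (poisson (e n)) := measurable_poisson (e0 n).
have mprod n : measurable_fun setT (fun u => h u * poisson (e n) u) by exact: measurable_funM.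
have sc n v : poisson (e n) (e n * v) = (e n)^-1 * P v.
  rewrite PE /poisson; have := den_gt0 v; have := e0 n; move: (e n) => x x0 d0.
  have d1 : x ^+ 2 + (2 * pi * (x * v)) ^+ 2 != 0.
    by rewrite gt_eqF// ltr_pwDl ?exprn_gt0 ?sqr_ge0.
  move: d1 d0; move: (@pi R) => q d1 d0.
  by field; rewrite d1 !gt_eqF.
have mhe n : measurable_fun setT (fun v => h (e n * v)).
  by apply: measurableT_comp => //; exact: mulrl_measurable.
have mhP n : measurable_fun setT (fun v => h (e n * v) * P v) by exact: measurable_funM.
have B0 : 0 <= B by exact: le_trans (hB 0).
have dom n v : `|h (e n * v) * P v| <= B * P v.
  by rewrite normrM (ger0_norm (P_ge0 _)) ler_wpM2r.
have iBP := integZ B integ_poisson1.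
have E n : \int[mu]_u (h u * poisson (e n) u) = \int[mu]_v (h (e n * v) * P v).
  have := Rint_scale (e0 n) (mprod n).
  under eq_Rintegral do rewrite sc mulrCA.
  rewrite RintegralZl//; last exact: (integ_dom (m := mu) (mhP n) iBP (dom n)).
  move/(congr1 (fun x => e n * x)); rewrite !mulrA mulfV ?gt_eqF// !mul1r.
  by move=> ->.
split.
  move=> n.
  have i1 : integ mu (fun v => h (e n * v) * P v) by exact: (integ_dom (m := mu) (mhP n) iBP (dom n)).
  have ei0 : 0 < (e n)^-1 by rewrite invr_gt0.
  have := integ_scale ei0 (integZ (e n)^-1 i1).
  rewrite (_ : (fun x => _) = (fun u => h u * poisson (e n) u))//.
  apply/funext => u; have eu : e n * ((e n)^-1 * u) = u by rewrite mulrA mulfV ?gt_eqF// mul1r.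
  by rewrite mulrCA -sc eu.
rewrite (_ : (fun n => _) = (fun n => \int[mu]_v (h (e n * v) * P v))); last exact/funext.
have -> : h 0 = \int[mu]_v (h 0 * P v).
  by rewrite RintegralZl ?Rint_poisson1 ?mulr1//; exact: integ_poisson1.
have [] := @dominated_cvgR _ _ _ mu (fun n v => h (e n * v) * P v) (fun v => h 0 * P v)
  (fun v => B * P v) mhP _ _ iBP _ => //.
- exact: measurable_funM.
- by apply/aeW => v; exact: cvgMr_tmp.
- by move=> n; apply/aeW => v; exact: dom.
Qed.

End poisson_kernel.

(** * The mass of the majorant *)

Section majorant.
Variable R : realType.
Local Notation mu := (@lebesgue_measure R).
Variables (al a : R).
Hypotheses (al0 : 0 <= al) (al1 : al < 1) (a0 : 0 < a).
Let p := (1 - al) / 2.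
Let p0 : 0 < p. Proof. by rewrite divr_gt0// subr_gt0. Qed.
Let p1 : p < 1. Proof. by rewrite ltr_pdivrMr//; move: al0; lra. Qed.

Let h (u : R) : R := \1_(`[0, a]%classic : set R) u * `|u| `^ (p - 1).

Let mabs : measurable_fun setT (fun u : R => `|u| `^ (p - 1)).
Proof. by apply: (measurableT_comp (measurable_powR _)); exact: normr_measurable. Qed.

Let mh : measurable_fun setT h.
Proof. by apply: measurable_funM => //; exact: mabs. Qed.

(** Monotone convergence along the intervals [[a / (n + 2), a]], away from the
singularity. *)
Let int_h : (\int[mu]_u (h u)%:E <= (a `^ p / p)%:E)%E.
Proof.
pose c n : R := a / n.+2%:R.
have c0 n : 0 < c n by rewrite divr_gt0.
have ca n : c n < a by rewrite ltr_pdivrMr// ltr_pMr// ltr1n.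
pose g n (u : R) : R := \1_(`[c n, a]%classic : set R) u * `|u| `^ (p - 1).
have mgr n : measurable_fun setT (g n).
  apply: measurable_funM; last exact: mabs.
  exact: measurable_indic.
have mg n : measurable_fun setT (fun u => (g n u)%:E) by exact/measurable_EFinP.
have g0 n u : 0 <= g n u by rewrite mulr_ge0// powR_ge0.
have ghn u : (g n u)%:E @[n --> \oo] --> (h u)%:E.
  apply: cvg_near_cst; have [u0|u0] := ltP 0 u.
    exists (Num.truncn (a / u)) => // n /= hn; congr (_%:E); rewrite /g /h; congr (_ * _).
    have cu : c n <= u.
      rewrite /c ler_pdivrMr// mulrC -ler_pdivrMr// ltW//.
      by rewrite (lt_le_trans (Num.Theory.truncnS_gt _))// ler_nat ltnS (leq_trans hn).
    by rewrite !indicE !mem_setE !in_itv/= cu (ltW u0).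
  apply: nearW => n; congr (_%:E); rewrite /g /h.
  move: u0; rewrite le_eqVlt => /predU1P[->|u0].
    by rewrite normr0 powR0 ?mulr0// subr_eq0 lt_eqF.
  rewrite !indicE !mem_setE !in_itv/= !leNgt u0/= !mul0r.
  by rewrite (lt_trans u0)// mul0r.
have gE n : integ mu (g n) /\ \int[mu]_u g n u = (a `^ p - c n `^ p) / p.
  have dF (w : R) : c n <= w -> is_derive w 1 (fun x : R => x `^ p / p) (w `^ (p - 1)).
    move=> cw; have w0 : 0 < w by rewrite (lt_le_trans (c0 n)).
    have w1 : w \in `]0, +oo[ by rewrite in_itv/= andbT.
    have h1 : is_derive w 1 (@powR R ^~ p) (p * w `^ (p - 1)).
      apply: DeriveDef; first exact: derivable_powR.
      by rewrite -derive1E powR_derive1.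
    by apply: is_derive_eq; rewrite /GRing.scale/= mulr0 add0r mulrA mulVf ?gt_eqF// mul1r.
  have cF (w : R) : c n <= w -> {for w, continuous (fun x : R => x `^ (p - 1))}.
    move=> cw; have w0 : 0 < w by rewrite (lt_le_trans (c0 n)).
    apply: differentiable_continuous; apply/derivable1_diffP; apply: derivable_powR.
    by rewrite in_itv/= andbT.
  have gpatch : g n = (fun x : R => x `^ (p - 1)) \_ `[c n, a].
    apply/funext => u; rewrite /g indicE patchE; case: ifPn => hu; last by rewrite mul0r.
    rewrite mul1r ger0_norm//; move/set_mem: hu => /=; rewrite in_itv/= => /andP[cu _].
    by rewrite (le_trans _ cu)// ltW.
  have [i1 i2] := Rint_FTC (ca n) dF cF; rewrite mulrBl -i2 gpatch; split.
    have mD : measurable (`[c n, a]%classic : set (measurableTypeR R)) by exact: measurable_itv.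
    by have := (integrable_mkcond _ mD).1 i1; rewrite restrict_EFin.
  by rewrite [RHS]Rintegral_mkcond.
have -> : (\int[mu]_u (h u)%:E = \int[mu]_u limn (fun n => (g n u)%:E))%E.
  by apply: eq_integral => u _; apply/esym/cvg_lim => //; exact: ghn.
have nd u i j : (i <= j)%N -> ((g i u)%:E <= (g j u)%:E)%E.
  move=> ij; rewrite lee_fin /g ler_wpM2r ?powR_ge0// !indicE.
  case: (boolP (u \in `[c i, a]%classic)) => // hu.
  rewrite mem_set//; move/set_mem: hu => /=; rewrite !in_itv/= => /andP[h1 ->]; rewrite andbT.
  by rewrite (le_trans _ h1)// ler_pM2l// lef_pV2 ?posrE// ler_nat !ltnS.
rewrite monotone_convergence//; last 2 first.
- by move=> n u _; rewrite lee_fin.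
- by move=> u _ i j ij; exact: nd.
apply: lime_le.
  apply: ereal_nondecreasing_is_cvgn => i j ij; apply: ge0_le_integral => //.
  - by move=> u _; rewrite lee_fin.
  - exact: mg.
  - exact: mg.
  - by move=> u _; exact: nd.
apply: nearW => n.
have [ig gn] := gE n.
rewrite -EFin_Rintegral// gn lee_fin ler_pdivrMr// divfK ?gt_eqF//.
by rewrite gerBl powR_ge0.
Qed.

Lemma integ_majorant : integ mu (majorant al a) /\
  \int[mu]_u majorant al a u <= 24 * (a `^ p / p).
Proof.
have h0 u : 0 <= h u by rewrite mulr_ge0// powR_ge0.
have ih : integ mu h.
  apply/integP => //; under eq_integral do rewrite ger0_norm//.
  by rewrite (le_lt_trans int_h)// ltry.
have int_h' : \int[mu]_u h u <= a `^ p / p by rewrite -lee_fin EFin_Rintegral.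
have ihr : integ mu (fun u => h (- u)).
  have := integ_refl 0 ih; by under eq_fun do rewrite sub0r.
have mm : measurable_fun setT (majorant al a).
  apply: measurable_funM; last exact: measurable_indic.
  by apply: measurable_funM => //; exact: mabs.
have m0 u : 0 <= majorant al a u by rewrite !mulr_ge0// powR_ge0.
have le u : majorant al a u <= 12 * (h u + h (- u)).
  rewrite /majorant /h normrN !indicE !mem_setE !in_itv/= -mulrA ler_wpM2l// mulrC -mulrDl.
  rewrite -/p ler_wpM2r ?powR_ge0//.
  have [u0|u0] := leP 0 u.
    have -> : - a <= u by rewrite (le_trans _ u0)// oppr_le0 ltW.
    by rewrite lerDl.
  have -> : (0 <= - u) by rewrite oppr_ge0 ltW.
  rewrite -lerNl /= add0r; case: (- u <= a) => //=.
  by rewrite ler_nat leq_b1.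
have i12 : integ mu (fun u => 12 * (h u + h (- u))) by apply: integZ; exact: integD.
have im : integ mu (majorant al a).
  by apply: (integ_dom (m := mu) mm i12) => u; rewrite ger0_norm.
split => //; rewrite (le_trans (le_Rint im i12 le))//.
rewrite RintegralZl//; last exact: integD.
rewrite RintegralD// Rint_opp//; have -> : 24 = 12 * 2 :> R by rewrite -natrM.
by rewrite -mulrA ler_wpM2l// mulr_natl mulr2n lerD.
Qed.

End majorant.

(** * Removal of the regularization *)

Section limit_kernel.
Variable R : realType.
Local Notation mu := (@lebesgue_measure R).
Variables (al a : R).
Hypotheses (al0 : 0 <= al) (al1 : al < 1) (a0 : 0 < a).

Definition eps (n : nat) : R := n.+1%:R^-1.

Lemma eps_gt0 n : 0 < eps n. Proof. by rewrite invr_gt0. Qed.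

Lemma eps_cvg0 : eps n @[n --> \oo] --> 0.
Proof. exact: cvg_harmonic. Qed.

Lemma integ_overlap (u : R) : 0 < al -> u != 0 -> integ mu (fun w => overlap al a w u).
Proof.
move=> alp u0.
have mo : measurable_fun setT (fun w => overlap al a w u).
  exact: (measurable_fun_pair1 u (measurable_overlap al a)).
have [au|ua] := leP a `|u|.
  rewrite (_ : (fun w => _) = fun=> 0); first exact: integrable0.
  by apply/funext => w; exact: overlap_eq0.
have [|W W0 [_ HW]] := @overlap_cutoff _ al a al0 a0 `|u| alp.
  by rewrite normr_gt0 u0.
have ii : integ mu (fun w => a * \1_(`[- W, W]%classic : set R) w).
  by apply: integZ; exact: integrable_indic_itv.
apply: (integ_dom (m := mu) mo ii) => w.
rewrite ger0_norm ?overlap_ge0//.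
have -> : overlap al a w u = overlap al a `|w| `|u| by rewrite /overlap !normr_id.
rewrite HW//; case: ifPn => wW; last by rewrite mulr_ge0// ltW.
rewrite indicE mem_set/= ?mulr1; last by rewrite in_itv/= -ler_norml.
by rewrite gerBl mulr_ge0// powR_ge0.
Qed.

(** For [al > 0] the overlap is integrable in [w] off [u = 0], so the limit is
its cosine transform; for [al = 0] the difference vanishes identically. *)
Lemma limit_kernel : exists k : R -> R, [/\ measurable_fun setT k,
  forall u, `|k u| <= majorant al a u &
  forall u, u != 0 -> (smoothed_kernel al a (eps n) u - poisson (eps n) u * overlap al a 0 u)
      @[n --> \oo] --> k u].
Proof.
suff [k [mk hk]] : exists k : R -> R, measurable_fun setT k /\
  forall u, u != 0 -> (smoothed_kernel al a (eps n) u - poisson (eps n) u * overlap al a 0 u)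
      @[n --> \oo] --> k u.
  (* At u = 0 the majorant takes the value 0, as 0 to a nonzero power is 0, so
     the kernel has to be set to 0 there. *)
  exists (fun u => \1_(~` [set (0 : R)]) u * k u); split.
  - apply: measurable_funM => //; apply: measurable_indic; exact: measurableC.
  - move=> u; rewrite indicE; have [->|u0] := eqVneq u 0.
      rewrite memNset/=; last by apply; exact: erefl.
      by rewrite mul0r normr0 /majorant !mulr_ge0// powR_ge0.
    rewrite mem_set/= ?mul1r; last exact/eqP.
    apply: (@cvgr_to_le _ _ _ _ _ _ _ (cvg_norm (hk u u0))).
    by apply: nearW => n; exact: smoothed_kernel_bound (eps_gt0 n) u0.
  - by move=> u u0; rewrite indicE mem_set/= ?mul1r; [exact: hk|exact/eqP].
move: al0; rewrite le_eqVlt => /predU1P[al00|alp].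
  exists (fun=> 0); split => // u u0; apply: cvg_near_cst; apply: nearW => n.
  by rewrite (smoothed_kernel_al0 _ (esym al00) (eps_gt0 n) u0) subrr.
have mz : measurable_fun setT (fun z : R * R => cos (2 * pi * z.1 * z.2) * overlap al a z.1 z.2).
  by apply: measurable_funM; [exact: measurable_cos_wu|exact: measurable_overlap].
exists (fun u => \int[mu]_w (cos (2 * pi * w * u) * overlap al a w u)); split.
  exact: (measurable_Rint_fst mu mz).
move=> u u0.
set I := Rintegral _ _ _; rewrite -[X in _ --> X]subr0.
apply: cvgB; last first.
  suff hp : poisson (eps n) u @[n --> \oo] --> 0.
    rewrite [X in _ --> X](_ : 0 = 0 * overlap al a 0 u); last by rewrite mul0r.
    exact: cvgMr_tmp.
  have h1 : 2 * eps n / (0 + (2 * pi * u) ^+ 2) @[n --> \oo] --> 2 * 0 / (0 + (2 * pi * u) ^+ 2).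
    by apply: cvgMr_tmp; apply: cvgMl_tmp; exact: eps_cvg0.
  rewrite mulr0 mul0r in h1.
  have th0 : 0 < (2 * pi * u) ^+ 2.
    by rewrite lt_neqAle sqr_ge0 eq_sym expf_neq0// !mulf_neq0// gt_eqF// pi_gt0.
  apply: (squeeze_cvgr _ (cvg_cst 0) h1); apply: nearW => n.
  have e0 := eps_gt0 n; apply/andP; split.
    by apply: divr_ge0; [rewrite mulr_ge0// ltW|rewrite addr_ge0// sqr_ge0].
  rewrite /poisson ler_wpM2l ?mulr_ge0 ?(ltW e0)// add0r lef_pV2 ?posrE//.
    by rewrite lerDr sqr_ge0.
  by rewrite ltr_wpDl// sqr_ge0.
have mc : measurable_fun setT (fun w => cos (2 * pi * w * u) * overlap al a w u).
  exact: (measurable_fun_pair1 u mz).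
have [] := @dominated_cvgR _ _ _ mu
  (fun n w => expR (- (eps n * `|w|)) * cos (2 * pi * w * u) * overlap al a w u)
  (fun w => cos (2 * pi * w * u) * overlap al a w u) (fun w => overlap al a w u)
  (fun n => integ_meas (integ_smoothed al a0 u (eps_gt0 n))) mc
  _ (integ_overlap alp u0) _.
- apply/aeW => w; apply: cvgMr_tmp; rewrite -[X in _ --> X]mul1r; apply: cvgMr_tmp.
  have h : expR (- (eps n * `|w|)) @[n --> \oo] --> expR (- (0 * `|w|)).
    apply: (@continuous_cvg _ _ _ _ _ _ (@expR R)); first exact: continuous_expR.
    by apply: cvgN; apply: cvgMr_tmp; exact: eps_cvg0.
  by rewrite mul0r oppr0 expR0 in h.
- move=> n; apply/aeW => w; rewrite !normrM (ger0_norm (expR_ge0 _)) (ger0_norm (overlap_ge0 _ _ _ _)).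
  rewrite ler_piMl ?overlap_ge0// mulr_ile1 ?expR_ge0//.
    by rewrite -expR0 ler_expR oppr_le0 mulr_ge0// ltW// eps_gt0.
  by rewrite cos_max.
by move=> _; exact.
Qed.

Lemma integ_tensor (k w : R -> R) : integ mu k -> integ mu w ->
  integ (mu \x mu)%E (fun p : R * R => k p.1 * w p.2).
Proof.
move=> ik iw; have mk := integ_meas ik; have mw := integ_meas iw.
have mm : measurable_fun setT (fun p : R * R => k p.1 * w p.2).
  apply: measurable_funM.
    by apply: measurableT_comp => //; exact: measurable_fst.
  by apply: measurableT_comp => //; exact: measurable_snd.
have iw' := (integP mu mw).1 iw; have ik' := (integP mu mk).1 ik.
apply/(integrable12ltyP mu mu); first exact/measurable_EFinP.
under eq_integral => s _.
  under eq_integral do rewrite /= normrM EFinM.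
  rewrite ge0_integralZl//; last by apply/measurable_EFinP; exact: measurableT_comp.
  rewrite muleC.
over.
rewrite /= ge0_integralZl//.
- rewrite lte_mul_pinfty//; first exact: integral_ge0.
  by rewrite ge0_fin_numE//; exact: integral_ge0.
- by apply/measurable_EFinP; exact: measurableT_comp.
- exact: integral_ge0.
Qed.

Lemma Rint_corr_kernel (k f g : R -> R) : integ mu k -> sqint mu f -> sqint mu g ->
  \int[mu]_u (corr f g u * k u) = \int[mu]_t (conv k f t * g t).
Proof.
move=> ik hf hg; have [[mf if2] [mg ig2]] := (hf, hg).
have mk : measurable_fun setT k := integ_meas ik.
pose F (p : R * R) := f (p.1 - p.2) * k p.2 * g p.1.
have iF : integ (mu \x mu)%E F.
  have i1 := integ_conv_kernel if2 (integ_norm ik).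
  have i2 := integ_tensor ig2 (integ_norm ik).
  apply: (integ_dom (m := (mu \x mu)%E) _ (integD i1 i2)).
    apply: measurable_funM; first exact: measurable_conv_kernel.
    by apply: measurableT_comp => //; exact: measurable_fst.
  move=> [t u]; rewrite /F/= -mulrDl mulrAC normrM ler_wpM2r//.
  have h1 := sqr_ge0 (f (t - u) - g t); have h2 := sqr_ge0 (f (t - u) + g t).
  by rewrite ler_norml; move: (f (t - u)) (g t) h1 h2 => x y; nra.
have := RFubini iF; rewrite /F/= => E.
transitivity (\int[mu]_u \int[mu]_t (f (t - u) * k u * g t)).
  apply: eq_Rintegral => u _; rewrite /corr.
  have ic : integ mu (fun s => f s * g (s + u)) by exact: integ_corr.
  rewrite -RintegralZr// -(Rint_shift (- u)); last first.
    by apply: measurable_funM => //; exact: integ_meas ic.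
  by apply: eq_Rintegral => t _; rewrite subrK mulrAC.
rewrite -E; apply: ae_eq_Rint.
- exact: (measurable_Rint_snd mu (integ_meas iF)).
- by apply: measurable_funM => //; exact: measurable_conv.
have := ae_integ_conv_sqint ik hf; apply: lae_imp => t ht.
rewrite convC// /conv -RintegralZr//.
have := integ_refl t ht; congr (is_true (integrable.body _ _ _)); apply/funext => u /=.
by rewrite opprB addrC subrK mulrC.
Qed.

(** The Poisson part concentrates at [u = 0], where [corr f g] is continuous with
value the integral of [f g] and the overlap is [a]; the rest converges under
the majorant. *)
Lemma corr_smoothed_cvg (k f g : R -> R) : measurable_fun setT k ->
  (forall u, `|k u| <= majorant al a u) ->
  (forall u, u != 0 -> (smoothed_kernel al a (eps n) u - poisson (eps n) u * overlap al a 0 u)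
      @[n --> \oo] --> k u) ->
  sqint mu f -> sqint mu g ->
  \int[mu]_u (corr f g u * smoothed_kernel al a (eps n) u) @[n --> \oo] -->
    a * \int[mu]_t (f t * g t) + \int[mu]_t (conv k f t * g t).
Proof.
move=> mk kb kcv hf hg; have [[mf if2] [mg ig2]] := (hf, hg).
have [im _] := integ_majorant al0 al1 a0.
have ik : integ mu k := integ_dom (m := mu) mk im kb.
have mc : measurable_fun setT (corr f g) by exact: measurable_corr.
have mov : measurable_fun setT (fun u => overlap al a 0 u).
  exact: (measurable_fun_pair2 (0 : R) (measurable_overlap al a)).
have cov : {for 0, continuous (overlap al a 0)}.
  rewrite (_ : overlap al a 0 = fun u => Num.max 0 (a - `|u|)); last exact/funext/overlap0.
  apply: (@continuous_max _ _ (fun=> 0) (fun u : R => a - `|u|)); first exact: cvg_cst.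
  by apply: cvgB; [exact: cvg_cst|exact: norm_continuous].
have ov0 : overlap al a 0 0 = a by rewrite overlap0 normr0 subr0; apply/max_idPr; exact: ltW.
have [] := @poisson_cvg _ (fun u => corr f g u * overlap al a 0 u) (corr_bound f g * a) eps.
- exact: measurable_funM.
- move=> u; rewrite normrM ler_pM ?corr_le// ger0_norm ?overlap_ge0//; exact: overlap_le.
- exact: eps_gt0.
- move=> v; have ev : eps n * v @[n --> \oo] --> 0.
    by rewrite -(mul0r v); apply: cvgMr_tmp; exact: eps_cvg0.
  apply: cvgM.
    have -> : corr f g 0 = \int[mu]_s (f s * g s) by apply: eq_Rintegral => s _; rewrite addr0.
    exact: corr_cvg.
  exact: (cvg_comp _ _ ev cov).
move=> ipo cpo.
pose d n u := smoothed_kernel al a (eps n) u - poisson (eps n) u * overlap al a 0 u.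
have md n : measurable_fun setT (d n).
  apply: measurable_funB; first exact: measurable_smoothed_kernel.
  by apply: measurable_funM => //; exact: measurable_poisson (eps_gt0 n).
have neq0 := lae_neq (0 : R).
have dle n : {ae mu, forall u, `|corr f g u * d n u| <= corr_bound f g * majorant al a u}.
  move: neq0; apply: lae_imp => u /eqP u0; rewrite normrM ler_pM ?corr_le//.
  exact: smoothed_kernel_bound (eps_gt0 n) u0.
have icd n : integ mu (fun u => corr f g u * d n u).
  have [] := @dominated_cvgR _ _ _ mu (fun _ u => corr f g u * d n u) (fun u => corr f g u * d n u)
    (fun u => corr_bound f g * majorant al a u) (fun _ => measurable_funM mc (md n)) (measurable_funM mc (md n))
    (aeW _ (fun u => cvg_cst _)) (integZ _ im) (fun _ => dle n).
  by [].
have aecv : {ae mu, forall u, corr f g u * d n u @[n --> \oo] --> corr f g u * k u}.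
  by move: neq0; apply: lae_imp => u /eqP u0; apply: cvgMl_tmp; exact: kcv.
have [ick cd] := @dominated_cvgR _ _ _ mu (fun n u => corr f g u * d n u) (fun u => corr f g u * k u)
   (fun u => corr_bound f g * majorant al a u) (fun n => measurable_funM mc (md n)) (measurable_funM mc mk) aecv
   (integZ _ im) dle.
rewrite -(Rint_corr_kernel ik hf hg).
have -> : a * \int[mu]_t (f t * g t) = corr f g 0 * overlap al a 0 0.
  by rewrite ov0 mulrC; congr (_ * _); apply: eq_Rintegral => s _; rewrite addr0.
rewrite (_ : (fun n => _) = (fun n => \int[mu]_u (corr f g u * overlap al a 0 u * poisson (eps n) u) + \int[mu]_u (corr f g u * d n u))).
  exact: cvgD cpo cd.
apply/funext => n; rewrite -RintegralD//.
by apply: eq_Rintegral => u _; rewrite /d mulrBr -mulrA (mulrC (overlap _ _ _ _)) addrC subrK.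
Qed.

End limit_kernel.

(** * The plane and the envelopes of the atoms *)

Section integ_prod.
Context d1 d2 (T1 : measurableType d1) (T2 : measurableType d2) (R : realType).
Context (m1 : {sigma_finite_measure set T1 -> \bar R}).
Context (m2 : {sigma_finite_measure set T2 -> \bar R}).

Lemma integ_prod2 (F : T1 * T2 -> R) : measurable_fun setT F ->
  (forall y, integ m1 (fun x => F (x, y))) ->
  integ m2 (fun y => \int[m1]_x `|F (x, y)|) -> integ (m1 \x m2)%E F.
Proof.
move=> mF i1 i2; apply/(integrable21ltyP m1 m2); first exact/measurable_EFinP.
have [_] := integrableP _ _ _ i2; congr (_ < _)%E; apply: eq_integral => y _ /=.
rewrite ger0_norm; last exact: Rintegral_ge0.
by rewrite EFin_Rintegral//; exact: integ_norm (i1 y).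
Qed.

End integ_prod.

Section plane.
Variable R : realType.
Local Notation mu := (@lebesgue_measure R).

(** A copy of the product measure with its own sigma-finiteness, so that
Fubini's theorem applies to the product of two planes. *)
Definition plane (A : set (measurableTypeR R * measurableTypeR R)) : \bar R := (mu \x mu)%E A.

Let plane0 : plane set0 = 0%E. Proof. exact: measure0. Qed.
Let plane_ge0 A : (0 <= plane A)%E. Proof. exact: measure_ge0. Qed.
Let plane_sigma_additive : semi_sigma_additive plane.
Proof. exact: measure_semi_sigma_additive. Qed.

HB.instance Definition _ := isMeasure.Build _ _ _ plane
  plane0 plane_ge0 plane_sigma_additive.

Let plane_sigma_finite : sigma_finite setT plane.
Proof.
have /sigma_finiteP[F [TF ndF Foo]] := sigma_finiteT mu.
exists (fun n => F n `*` F n).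
  rewrite -setXTT TF predeqE => -[x y]; split; last by move=> [n _ []/= ? ?]; split; exists n.
  move=> [/= [n _ Fnx] [k _ Fky]]; exists (maxn n k) => //; split.
  - by move: x Fnx; exact/subsetPset/ndF/leq_maxl.
  - by move: y Fky; exact/subsetPset/ndF/leq_maxr.
move=> k; have [mF Fk] := Foo k; split; first exact: measurableX.
by rewrite /plane product_measure1E// lte_mul_pinfty// ge0_fin_numE.
Qed.

HB.instance Definition _ := Measure_isSigmaFinite.Build _ _ _ plane plane_sigma_finite.

End plane.
Arguments plane : clear implicits.

Section coefficients.
Variable R : realType.
Local Notation mu := (@lebesgue_measure R).
Variables (al a : R).
Hypotheses (al0 : 0 <= al) (al1 : al < 1) (a0 : 0 < a).

Let box (v : R) : R := \1_(`[0, a]%classic : set R) v.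

(** The modulus of the atom of frequency [w] with translation parameter 0. *)
Definition envelope (w y : R) : R := (Num.sqrt (beta al w))^-1 * box (y / beta al w).

Lemma beta_gt0 w : 0 < beta al w.
Proof. by rewrite /beta powR_gt0// ltr_pwDl. Qed.

Lemma betaN w : beta al (- w) = beta al w.
Proof. by rewrite /beta normrN. Qed.

Let betaV w : (beta al w)^-1 = (1 + `|w|) `^ al.
Proof. by rewrite /beta powRN invrK. Qed.

Let mbetaV : measurable_fun setT (fun w => (beta al w)^-1).
Proof.
under eq_fun do rewrite betaV.
by apply: (measurableT_comp (measurable_powR _)); apply: measurable_funD.
Qed.

Let mbox : measurable_fun setT box.
Proof. exact: measurable_indic. Qed.

Lemma measurable_envelope : measurable_fun setT (fun z : R * R => envelope z.1 z.2).
Proof.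
have mb : measurable_fun setT (fun z : R * R => (beta al z.1)^-1).
  by apply: (measurableT_comp mbetaV); exact: measurable_fst.
apply: measurable_funM.
  under eq_fun do rewrite -sqrtrV ?(ltW (beta_gt0 _))//.
  apply: (measurableT_comp _ mb).
  apply: continuous_measurable_fun; exact: sqrt_continuous.
apply: (measurableT_comp mbox); apply: measurable_funM => //; exact: measurable_snd.
Qed.

Lemma envelope_ge0 w y : 0 <= envelope w y.
Proof. by rewrite mulr_ge0// invr_ge0 sqrtr_ge0. Qed.

Lemma sqint_envelope w : sqint mu (envelope w).
Proof.
split; first exact: (measurable_fun_pair2 w measurable_envelope).
have bi : 0 < (beta al w)^-1 by rewrite invr_gt0 beta_gt0.
have ib : integ mu box by exact: integrable_indic_itv.
have := integZ ((Num.sqrt (beta al w))^-1 ^+ 2) (integ_scale bi ib).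
rewrite (_ : (fun x => _ * _) = (fun y => envelope w y ^+ 2))//.
apply/funext => y; rewrite /envelope exprMn; congr (_ * _).
by rewrite mulrC /box indicE; case: (_ \in _); rewrite ?expr0n ?expr1n.
Qed.

Let Rint_box c : \int[mu]_v (box v * box (v + c)) = Num.max 0 (a - `|c|).
Proof.
pose J : interval R := `[Num.max 0 (- c), Num.min a (a - c)].
have E v : box v * box (v + c) = \1_([set` J] : set R) v.
  rewrite /box !indicE !mem_setE !in_itv/= ge_max le_min -natrM mulnb; congr (_%:R).
  have -> : (0 <= v + c) = (- c <= v) by rewrite -lerBlDr sub0r.
  by rewrite -lerBrDr andbACA.
under eq_Rintegral do rewrite E.
rewrite /Rintegral integral_indic// setIT.
have EJ : (mu [set` J] = (Num.max 0 (a - `|c|))%:E)%E.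
  rewrite lebesgue_measure_itv/= lte_fin -EFinB.
  have [m1 m2] : Num.min a (a - c) - Num.max 0 (- c) = a - `|c| /\
      (Num.max 0 (- c) < Num.min a (a - c)) = (0 < a - `|c|).
    have [c0|c0] := leP 0 c.
      have -> : Num.max 0 (- c) = 0 by apply/max_idPl; rewrite oppr_le0.
      have -> : Num.min a (a - c) = a - c by apply/min_idPr; rewrite gerBl.
      by rewrite ger0_norm// subr0.
    have -> : Num.max 0 (- c) = - c by apply/max_idPr; rewrite oppr_ge0 ltW.
    have -> : Num.min a (a - c) = a by apply/min_idPl; rewrite lerDl oppr_ge0 ltW.
    by rewrite ltr0_norm// subr_gt0.
  by rewrite m1 m2; case: ltP.
exact: (congr1 fine EJ).
Qed.

Lemma Rint_envelope w u : \int[mu]_y (envelope w y * envelope w (y + u)) = overlap al a w u.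
Proof.
have b0 := beta_gt0 w.
have mw : measurable_fun setT (envelope w) := (sqint_envelope w).1.
have mm : measurable_fun setT (fun y => envelope w y * envelope w (y + u)).
  by apply: measurable_funM => //; exact: measurable_shift.
have := Rint_scale b0 mm; move/(congr1 (fun x => beta al w * x)).
rewrite mulrA mulfV ?gt_eqF// mul1r => <-.
have sb : Num.sqrt (beta al w) != 0 by rewrite gt_eqF// sqrtr_gt0.
have E v : envelope w (beta al w * v) * envelope w (beta al w * v + u) =
    (beta al w)^-1 * (box v * box (v + u / beta al w)).
  have e1 : beta al w * v / beta al w = v by rewrite mulrAC mulfV ?gt_eqF// mul1r.
  rewrite /envelope mulrDl !e1.
  have -> : (beta al w)^-1 = (Num.sqrt (beta al w))^-1 * (Num.sqrt (beta al w))^-1.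
    by rewrite -invfM -expr2 sqr_sqrtr// ltW.
  ring.
under eq_Rintegral do rewrite E.
rewrite RintegralZl//; last first.
  have ib : sqint mu box.
    split => //; rewrite (_ : (fun x => _) = box); first exact: integrable_indic_itv.
    by apply/funext => v; rewrite /box indicE; case: (_ \in _); rewrite ?expr0n ?expr1n.
  by apply: sqint_mul => //; exact: sqint_shift.
rewrite mulrA mulfV ?gt_eqF// mul1r Rint_box /overlap; congr (Num.max _ (_ - _)).
by rewrite normrM normfV (gtr0_norm b0) /beta powRN invrK.
Qed.

End coefficients.

(** * The sesquilinear form of the frame in real coordinates *)

Section frame_form.
Variable R : realType.
Local Notation mu := (@lebesgue_measure R).
Variables (al a : R).
Hypotheses (al0 : 0 <= al) (al1 : al < 1) (a0 : 0 < a).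
Local Notation env := (envelope al a).
Local Notation mu2 := (mu \x mu)%E.

(** For [phi = cos] and [phi = sin]: the integral of [f] against the real and the
imaginary part of the atom at [(x, w) = p]. *)
Definition coef (phi f : R -> R) (p : R * R) : R :=
  \int[mu]_t (f t * (env p.2 (t - p.1) * phi (2 * pi * p.2 * (t - p.1)))).

Lemma measurable_envelope_comp d (T : measurableType d) (w y : T -> R) :
  measurable_fun setT w -> measurable_fun setT y ->
  measurable_fun setT (fun z => env (w z) (y z)).
Proof.
move=> mw my; apply: (measurableT_comp (measurable_envelope al a)
  (measurable_fun_pair mw my)).
Qed.

Lemma measurable_coef phi f : measurable_fun setT phi -> measurable_fun setT f ->
  measurable_fun setT (coef phi f).
Proof.
move=> mphi mf.
have mx : measurable_fun setT (fun z : (R * R) * R => z.1.1).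
  by apply: (measurableT_comp measurable_fst); exact: measurable_fst.
have mw : measurable_fun setT (fun z : (R * R) * R => z.1.2).
  by apply: (measurableT_comp measurable_snd); exact: measurable_fst.
have mt : measurable_fun setT (fun z : (R * R) * R => z.2) by exact: measurable_snd.
have mtx : measurable_fun setT (fun z : (R * R) * R => z.2 - z.1.1) by exact: measurable_funB.
apply: (measurable_Rint_snd mu (F := fun z : (R * R) * R =>
  f z.2 * (env z.1.2 (z.2 - z.1.1) * phi (2 * pi * z.1.2 * (z.2 - z.1.1))))).
apply: measurable_funM; first exact: (measurableT_comp mf).
apply: measurable_funM; first exact: measurable_envelope_comp.
by apply: (measurableT_comp mphi); do 2 apply: measurable_funM => //.
Qed.

Lemma sqint_env_shift w x : sqint mu (fun t => env w (t - x)).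
Proof. exact: (sqint_shift (- x) (sqint_envelope al a w)). Qed.

Lemma integ_coef (phi f : R -> R) (p : R * R) : measurable_fun setT phi -> (forall x, `|phi x| <= 1) -> sqint mu f ->
  integ mu (fun t => f t * (env p.2 (t - p.1) * phi (2 * pi * p.2 * (t - p.1)))).
Proof.
move=> mphi phi1 hf; apply: sqint_mul => //.
have hE := sqint_env_shift p.2 p.1.
apply: (sqint_dom (m := mu) _ hE).
  apply: measurable_funM; first exact: hE.1.
  apply: (measurableT_comp mphi); apply: measurable_funM => //; exact: measurable_funB.
by move=> t; rewrite normrM ler_piMr.
Qed.

(** For real [f] and [g], [form_re] and [form_im] are the real and imaginary
parts of the product of the coefficient of [f] and the conjugate coefficient
of [g]. *)
Definition form_re (f g : R -> R) (p : R * R) : R :=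
  coef cos f p * coef cos g p + coef sin f p * coef sin g p.
Definition form_im (f g : R -> R) (p : R * R) : R :=
  coef cos f p * coef sin g p - coef sin f p * coef cos g p.

(** The addition theorem for the cosine; [u] is the difference of the two
integration variables. *)
Lemma form_re_iterated (f g : R -> R) (p : R * R) : sqint mu f -> sqint mu g ->
  form_re f g p = \int[mu]_s \int[mu]_u
    (f s * g (s + u) * (env p.2 (s - p.1) * env p.2 (s + u - p.1)) * cos (2 * pi * p.2 * u)).
Proof.
move=> hf hg; have [[mf _] [mg _]] := (hf, hg).
have icf := integ_coef p (@measurable_cos R) (@cos_max R) hf; have isf := integ_coef p (@measurable_sin R) (@sin_max R) hf.
have icg := integ_coef p (@measurable_cos R) (@cos_max R) hg; have isg := integ_coef p (@measurable_sin R) (@sin_max R) hg.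
rewrite /form_re {1 3}/coef -RintegralZr// -RintegralZr// -RintegralD//; [|exact: integZr..].
apply: eq_Rintegral => s _.
set c := cos (2 * pi * p.2 * (s - p.1)); set d := sin (2 * pi * p.2 * (s - p.1)).
set e := env p.2 (s - p.1).
transitivity (\int[mu]_t (f s * e * (c * (g t * (env p.2 (t - p.1) * cos (2 * pi * p.2 * (t - p.1)))) +
    d * (g t * (env p.2 (t - p.1) * sin (2 * pi * p.2 * (t - p.1))))))).
  rewrite RintegralZl//; last by apply: integD; exact: integZ.
  rewrite RintegralD//; try exact: integZ.
  rewrite RintegralZl// RintegralZl//; rewrite -/(coef cos g p) -/(coef sin g p); ring.
rewrite -(Rint_shift s); last first.
  apply: (integ_meas (m := mu)); apply: integZ; apply: integD; exact: integZ.
apply: eq_Rintegral => u _; rewrite (addrC u s).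
have -> : 2 * pi * p.2 * u = 2 * pi * p.2 * (s + u - p.1) - 2 * pi * p.2 * (s - p.1) by ring.
rewrite cosB -/c -/d; ring.
Qed.

End frame_form.

(** * The regularized form as a convolution form *)

Section weighted_form.
Variable R : realType.
Local Notation mu := (@lebesgue_measure R).
Variables (al a : R).
Hypotheses (al0 : 0 <= al) (al1 : al < 1) (a0 : 0 < a).
Local Notation env := (envelope al a).
Local Notation mu2 := (mu \x mu)%E.
Local Notation pl := (plane R).

Let Rint_pl (F : R * R -> R) : \int[pl]_p F p = \int[mu2]_p F p.
Proof. by []. Qed.

Let integ_mu2 (F : R * R -> R) : integ pl F -> integ mu2 F.
Proof. by []. Qed.

Let env2 (s u : R) (p : R * R) := env p.2 (s - p.1) * env p.2 (s + u - p.1).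

Let menv2 s u : measurable_fun setT (env2 s u).
Proof.
have m1 := @measurable_fst _ _ (measurableTypeR R) (measurableTypeR R).
have m2 := @measurable_snd _ _ (measurableTypeR R) (measurableTypeR R).
by apply: measurable_funM; apply: measurable_envelope_comp => //; exact: measurable_funB.
Qed.

Let env2_ge0 s u p : 0 <= env2 s u p.
Proof. by rewrite mulr_ge0// envelope_ge0. Qed.

Let env2_slice s u w : integ mu (fun x => env2 s u (x, w)) /\
  \int[mu]_x env2 s u (x, w) = overlap al a w u.
Proof.
have hE := sqint_envelope al a w.
have i1 : integ mu (fun y => env w y * env w (y + u)).
  by apply: sqint_mul => //; exact: sqint_shift.
have E : (fun x => env2 s u (x, w)) = (fun x => (fun y => env w y * env w (y + u)) (s - x)).
  by apply/funext => x; rewrite /env2/= addrAC.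
rewrite E; split; first exact: (integ_refl s i1).
rewrite (Rint_refl s (f := fun y => env w y * env w (y + u))); last exact: integ_meas i1.
exact: Rint_envelope.
Qed.

Let weighted_env (rho : R -> R) (s u : R) : measurable_fun setT rho ->
  integ mu (fun w => rho w * overlap al a w u) ->
  integ mu2 (fun p => rho p.2 * env2 s u p) /\
  \int[mu2]_p (rho p.2 * env2 s u p) = \int[mu]_w (rho w * overlap al a w u).
Proof.
move=> mrho irho.
have mm : measurable_fun setT (fun p : R * R => rho p.2 * env2 s u p).
  apply: measurable_funM => //; apply: (measurableT_comp mrho); exact: measurable_snd.
have ii : integ mu2 (fun p => rho p.2 * env2 s u p).
  apply: integ_prod2 => // [w|].
    exact: (integZ (rho w) (env2_slice s u w).1).
  rewrite (_ : (fun y => _) = (fun w => `|rho w * overlap al a w u|)); first exact: integ_norm.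
  apply/funext => w; rewrite normrM (ger0_norm (overlap_ge0 _ _ _ _)) -(env2_slice s u w).2.
  have i2 := (env2_slice s u w).1.
  rewrite -RintegralZl//.
  by apply: eq_Rintegral => x _; rewrite normrM /= (ger0_norm (env2_ge0 _ _ _)).
split => //; rewrite -(RFubini2 ii).2; apply: eq_Rintegral => w _ /=.
by rewrite RintegralZl ?(env2_slice s u w).2//; exact: (env2_slice s u w).1.
Qed.

Let integ_shear (k w : R -> R) : integ mu k -> integ mu w ->
  integ mu2 (fun p : R * R => k (p.1 + p.2) * w p.2).
Proof.
move=> ik iw; have mk : measurable_fun setT k := integ_meas ik.
have mw : measurable_fun setT w := integ_meas iw.
have m1 := @measurable_fst _ _ (measurableTypeR R) (measurableTypeR R).
have m2 := @measurable_snd _ _ (measurableTypeR R) (measurableTypeR R).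
apply: integ_prod2 => [|u|].
- apply: measurable_funM; last exact: (measurableT_comp mw).
  by apply: (measurableT_comp mk); exact: measurable_funD.
- exact: (integZr (w u) (integ_shift u ik)).
- rewrite (_ : (fun y => _) = (fun u => (\int[mu]_x `|k x|) * `|w u|)).
    by apply: integZ; exact: integ_norm.
  apply/funext => u /=; rewrite -(Rint_shift u (f := fun x => `|k x|)); last exact: measurableT_comp.
  rewrite -RintegralZr//; last exact: (integ_norm (integ_shift u ik)).
  by apply: eq_Rintegral => x _; rewrite normrM.
Qed.

Let scale_out (c : R) (G K : R * R -> R) : 0 < c -> (forall q, K q = c * G q) ->
  integ pl K -> integ mu2 G /\ \int[pl]_q K q = c * \int[mu2]_q G q.
Proof.
move=> c0 KG iK.
have EG : G = (fun q => c^-1 * K q) by apply/funext => q; rewrite KG mulrA mulVf ?mul1r// gt_eqF.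
have iG : integ pl G by rewrite EG; exact: integZ.
split; first exact: integ_mu2.
rewrite -Rint_pl -RintegralZl//; apply: eq_Rintegral => q _; exact: KG.
Qed.

Section fixed.
Variables (f g : R -> R) (e : R).
Hypotheses (hf : sqint mu f) (hg : sqint mu g) (e0 : 0 < e).

Let rho (u w : R) : R := expR (- (e * `|w|)) * cos (2 * pi * w * u).
Let H (z : (R * R) * (R * R)) : R :=
  f z.2.1 * g (z.2.1 + z.2.2) * (rho z.2.2 z.1.2 * env2 z.2.1 z.2.2 z.1).

Let mrho u : measurable_fun setT (rho u).
Proof.
have mc : measurable_fun setT (fun w => cos (2 * pi * w * u)).
  by have := measurable_fun_pair1 u (@measurable_cos_wu R); exact.
exact: (measurable_funM (measurable_expN e) mc).
Qed.

Let irho u : integ mu (fun w => rho u w * overlap al a w u).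
Proof. exact: integ_smoothed. Qed.

Let rho_le u w : `|rho u w| <= expR (- (e * `|w|)).
Proof.
by rewrite normrM (ger0_norm (expR_ge0 _)) ler_piMr ?expR_ge0// cos_max.
Qed.

Let slice (q : R * R) : integ mu2 (fun p => H (p, q)) /\
  \int[mu2]_p H (p, q) = f q.1 * g (q.1 + q.2) * smoothed_kernel al a e q.2.
Proof.
have [i1 i2] := weighted_env q.1 (mrho q.2) (irho q.2).
have E : (fun p => H (p, q)) =
  (fun p => f q.1 * g (q.1 + q.2) * (rho q.2 p.2 * env2 q.1 q.2 p)) by [].
by rewrite E; split; [exact: integZ|rewrite RintegralZl// i2].
Qed.

Let mH : measurable_fun setT H.
Proof.
have [[mf _] [mg _]] := (hf, hg).
have m1 := @measurable_fst _ _ (measurableTypeR R * measurableTypeR R)%type (measurableTypeR R * measurableTypeR R)%type.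
have m2 := @measurable_snd _ _ (measurableTypeR R * measurableTypeR R)%type (measurableTypeR R * measurableTypeR R)%type.
have m11 := measurableT_comp (@measurable_fst _ _ (measurableTypeR R) (measurableTypeR R)) m1.
have m12 := measurableT_comp (@measurable_snd _ _ (measurableTypeR R) (measurableTypeR R)) m1.
have m21 := measurableT_comp (@measurable_fst _ _ (measurableTypeR R) (measurableTypeR R)) m2.
have m22 := measurableT_comp (@measurable_snd _ _ (measurableTypeR R) (measurableTypeR R)) m2.
have mD : measurable_fun setT (fun z : (R * R) * (R * R) => z.2.1 + z.2.2) by exact: measurable_funD.
apply: measurable_funM.
  by apply: measurable_funM; [exact: (measurableT_comp mf)|exact: (measurableT_comp mg)].
apply: measurable_funM.
  apply: measurable_funM; first exact: (measurableT_comp (measurable_expN e)).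
  by have := measurableT_comp (@measurable_cos_wu R) (measurable_fun_pair m12 m22); exact.
by apply: measurable_funM; apply: measurable_envelope_comp => //; exact: measurable_funB.
Qed.

Let iH : integ (pl \x pl)%E H.
Proof.
have [[mf if2] [mg ig2]] := (hf, hg).
apply: integ_prod2 => // [q|]; first exact: (slice q).1.
(* The overlap vanishes for u beyond a, so that the absolute integral over p
   is bounded by f s ^ 2 + g (s + u) ^ 2 times a box in u. *)
pose C := a * \int[mu]_w expR (- (e * `|w|)).
pose box (u : R) : R := C * \1_(`[- a, a]%classic : set R) u.
have ibox : integ mu box by apply: integZ; exact: integrable_indic_itv.
have i1 := integ_tensor if2 ibox; have i2 := integ_shear ig2 ibox.
apply: (integ_dom (m := mu2) _ (integD i1 i2)).
  apply: (measurable_Rint_fst pl (F := fun z => `|H z|)); exact: measurableT_comp.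
move=> [s u]; rewrite ger0_norm/=; last exact: Rintegral_ge0.
have C0 : 0 <= C by rewrite mulr_ge0 ?(ltW a0)// Rintegral_ge0// => w _; exact: expR_ge0.
have box0 : 0 <= box u by rewrite mulr_ge0.
pose rhoa w := `|rho u w|.
have mrhoa : measurable_fun setT rhoa by exact: measurableT_comp.
have irhoa : integ mu (fun w => rhoa w * overlap al a w u).
  have := integ_norm (irho u); congr (is_true (integrable.body _ _ _)).
  by apply/funext => w /=; rewrite normrM (ger0_norm (overlap_ge0 _ _ _ _)).
have [i3 i4] := weighted_env s mrhoa irhoa.
have -> : \int[pl]_p `|H (p, (s, u))| = `|f s * g (s + u)| * \int[mu]_w (rhoa w * overlap al a w u).
  rewrite -i4 -RintegralZl//; apply: (@eq_Rintegral _ _ _ mu2) => p _.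
  by rewrite /H/= normrM; congr (_ * _); rewrite normrM (ger0_norm (env2_ge0 _ _ _)).
have le1 : \int[mu]_w (rhoa w * overlap al a w u) <= box u.
  rewrite /box indicE mem_setE in_itv/= -ler_norml.
  have [ua|ua] := leP `|u| a; last first.
    rewrite mulr0; under eq_Rintegral do rewrite overlap_eq0 ?mulr0 ?(ltW ua)//.
    by rewrite Rintegral_cst// mul0r.
  rewrite mulr1 /C -RintegralZl//; last exact: integ_expN.
  apply: le_Rint => //; first by apply: integZ; exact: integ_expN.
  move=> w; rewrite mulrC; by apply: ler_pM; [exact: overlap_ge0|exact: normr_ge0|exact: overlap_le|exact: rho_le].
apply: (@le_trans _ _ (`|f s * g (s + u)| * box u)); first by rewrite ler_wpM2l.
rewrite -mulrDl ler_wpM2r//.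
have h1 := sqr_ge0 (f s - g (s + u)); have h2 := sqr_ge0 (f s + g (s + u)).
by rewrite ler_norml; move: (f s) (g (s + u)) h1 h2 => x y; nra.
Qed.

(** Fubini on the product of two planes, with [p = (x, w)] and [q = (s, u)]: in
the order [q] then [p] the integral of [H] is that of the weighted form, in
the order [p] then [q] the integration over [x] yields the overlap and the
one over [w] the regularized kernel. *)
Lemma weighted_form :
  integ mu2 (fun p => expR (- (e * `|p.2|)) * form_re al a f g p) /\
  \int[mu2]_p (expR (- (e * `|p.2|)) * form_re al a f g p) =
  \int[mu]_u (corr f g u * smoothed_kernel al a e u).
Proof.
have [[mf if2] [mg ig2]] := (hf, hg).
have msmooth := measurable_smoothed_kernel al a e.
have mform : measurable_fun setT (fun p : R * R => expR (- (e * `|p.2|)) * form_re al a f g p).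
  have mc := measurable_coef al a mf; have mc' := measurable_coef al a mg.
  apply: measurable_funM.
    by apply: (measurableT_comp (measurable_expN e)); exact: measurable_snd.
  by apply: measurable_funD; apply: measurable_funM; apply: measurable_coef => //;
    by [exact: measurable_cos|exact: measurable_sin].
have LR := RFubini iH.
have mL : measurable_fun setT (fun p => \int[pl]_q H (p, q)) by exact: (measurable_Rint_snd pl mH).
have ae : {ae pl, forall p, expR (- (e * `|p.2|)) * form_re al a f g p = \int[pl]_q H (p, q)}.
  have := ae_integrable1 iH; apply: filterS => p hp.
  pose G (q : R * R) := f q.1 * g (q.1 + q.2) *
    (env p.2 (q.1 - p.1) * env p.2 (q.1 + q.2 - p.1)) * cos (2 * pi * p.2 * q.2).
  have HG q : H (p, q) = expR (- (e * `|p.2|)) * G q by rewrite /H /G /rho /env2/=; ring.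
  have [iG ->] := scale_out (expR_gt0 _) HG hp.
  by rewrite -(RFubini1 iG).2 form_re_iterated.
split.
  apply: integ_mu2; apply: (ae_eq_integ (m := pl) mform _ (RFubini1 iH).1).
  apply: (@filterS _ _ (ae_filter_ringOfSetsType pl)) ae => p ->; reflexivity.
rewrite -Rint_pl.
have X := @ae_eq_Rint _ _ _ pl _ _ mform mL ae.
rewrite X LR.
have E q : \int[pl]_p H (p, q) = f q.1 * g (q.1 + q.2) * smoothed_kernel al a e q.2.
  by rewrite Rint_pl (slice q).2.
have iK := integ_mu2 (RFubini2 iH).1.
rewrite Rint_pl -(RFubini2 iK).2; apply: eq_Rintegral => u _.
transitivity (\int[mu]_x (f x * g (x + u) * smoothed_kernel al a e u)).
  by apply: eq_Rintegral => x _; exact: (E (x, u)).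
have ic := integ_corr u hf hg.
have Y := RintegralZr (smoothed_kernel al a e u) measurableT ic.
exact: Y.
Qed.

End fixed.
End weighted_form.

(** * The frame form as a convolution form *)

Section weighted_limit.
Context d (T : measurableType d) (R : realType) (m : {measure set T -> \bar R}).

(** Fatou's lemma. *)
Lemma integ_weighted_limit (w : nat -> T -> R) (F : T -> R) (L : R) :
  measurable_fun setT F -> (forall x, 0 <= F x) -> (forall n x, 0 <= w n x) ->
  (forall x, w n x @[n --> \oo] --> (1 : R)) ->
  (forall n, integ m (fun x => w n x * F x)) ->
  \int[m]_x (w n x * F x) @[n --> \oo] --> L -> integ m F.
Proof.
move=> mF F0 w0 wcv iw hL; apply/(integP m mF).
have mw n : measurable_fun setT (fun x => (w n x * F x)%:E) := measurable_int m (iw n).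
have := @fatou _ _ _ m _ measurableT (fun n x => (w n x * F x)%:E) mw
  (fun n x _ => mulr_ge0 (w0 n x) (F0 x)).
have -> : (\int[m]_x limn_einf (fun n => (w n x * F x)%:E) = \int[m]_x (`|F x|)%:E)%E.
  apply: eq_integral => x _; rewrite ger0_norm//; apply: (cvg_limn_einf_sup _).1.
  apply: cvg_EFin; first exact: nearW.
  by rewrite -[X in _ --> X]mul1r; apply: cvgMr_tmp; exact: wcv.
have -> : (fun n => \int[m]_x (w n x * F x)%:E)%E = (fun n => (\int[m]_x (w n x * F x))%:E).
  by apply/funext => n; rewrite EFin_Rintegral.
have hE : (\int[m]_x (w n x * F x))%:E @[n --> \oo] --> L%:E.
  by apply: cvg_EFin => //; exact: nearW.
by rewrite (cvg_limn_einf_sup hE).1 => h; exact: (le_lt_trans h (ltry L)).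
Qed.

Lemma Rint_weighted_limit (w : nat -> T -> R) (F : T -> R) :
  (forall n, measurable_fun setT (w n)) -> (forall n x, 0 <= w n x <= 1) ->
  (forall x, w n x @[n --> \oo] --> (1 : R)) -> integ m F ->
  \int[m]_x (w n x * F x) @[n --> \oo] --> \int[m]_x F x.
Proof.
move=> mw w01 wcv iF; have mF := integ_meas iF.
have [] // := @dominated_cvgR _ _ _ m (fun n x => w n x * F x) F (fun x => `|F x|)
  (fun n => measurable_funM (mw n) mF) mF _ (integ_norm iF) _.
- apply: aeW => x; rewrite -[X in _ --> X]mul1r; apply: cvgMr_tmp; exact: wcv.
- move=> n; apply: aeW => x; have /andP[h0 h1] := w01 n x.
  by rewrite normrM (ger0_norm h0) ler_piMl.
Qed.

End weighted_limit.

Section frame_identity.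
Variable R : realType.
Local Notation mu := (@lebesgue_measure R).
Local Notation mu2 := (mu \x mu)%E.
Variables (al a : R).
Hypotheses (al0 : 0 <= al) (al1 : al < 1) (a0 : 0 < a).

Let wgt (n : nat) (p : R * R) : R := expR (- (eps R n * `|p.2|)).

Let mwgt n : measurable_fun setT (wgt n).
Proof. by apply: (measurableT_comp (measurable_expN _)); exact: measurable_snd. Qed.

Let wgt01 n p : 0 <= wgt n p <= 1.
Proof.
by rewrite expR_ge0/= -expR0 ler_expR oppr_le0 mulr_ge0// (ltW (eps_gt0 R n)).
Qed.

Let wgt_cvg p : wgt n p @[n --> \oo] --> (1 : R).
Proof.
have h : expR (- (eps R n * `|p.2|)) @[n --> \oo] --> expR (- (0 * `|p.2|)).
  apply: (@continuous_cvg _ _ _ _ _ _ (@expR R)); first exact: continuous_expR.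
  by apply: cvgN; apply: cvgMr_tmp; exact: eps_cvg0.
by rewrite mul0r oppr0 expR0 in h.
Qed.

Let weighted_cvg : exists k : R -> R, [/\ integ mu k,
  \int[mu]_u `|k u| <= \int[mu]_u majorant al a u &
  forall f g, sqint mu f -> sqint mu g ->
  \int[mu2]_p (wgt n p * form_re al a f g p) @[n --> \oo] -->
    a * \int[mu]_t (f t * g t) + \int[mu]_t (conv k f t * g t)].
Proof.
have [k [mk kb kcv]] := limit_kernel al0 al1 a0.
have [im _] := integ_majorant al0 al1 a0.
have ik : integ mu k := integ_dom (m := mu) mk im kb.
exists k; split => //; first by apply: le_Rint => //; exact: integ_norm.
move=> f g hf hg; have := corr_smoothed_cvg al0 al1 a0 mk kb kcv hf hg.
rewrite (_ : (fun n => \int[mu2]_p _) =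
  (fun n => \int[mu]_u (corr f g u * smoothed_kernel al a (eps R n) u)))//.
by apply/funext => n; exact: (weighted_form al0 a0 hf hg (eps_gt0 R n)).2.
Qed.

(** The diagonal form is the sum of the squares of the two coefficients, and its
weighted integrals converge; Fatou's lemma bounds its integral. *)
Lemma sqint_coef f : sqint mu f ->
  sqint mu2 (coef al a (@cos R) f) /\ sqint mu2 (coef al a (@sin R) f).
Proof.
move=> hf; have [mf _] := hf.
have mC : measurable_fun setT (coef al a (@cos R) f).
  by apply: measurable_coef mf; exact: measurable_cos.
have mS : measurable_fun setT (coef al a (@sin R) f).
  by apply: measurable_coef mf; exact: measurable_sin.
have [k [_ _ /(_ f f hf hf) hk]] := weighted_cvg.
have iF : integ mu2 (form_re al a f f).
  apply: (@integ_weighted_limit _ _ _ mu2 wgt (form_re al a f f) _ _ _ _ wgt_cvg _ hk).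
  - by apply: measurable_funD; exact: measurable_funM.
  - by move=> p; rewrite /form_re addr_ge0// -expr2 sqr_ge0.
  - by move=> n p; have /andP[] := wgt01 n p.
  - by move=> n; exact: (weighted_form al0 a0 hf hf (eps_gt0 R n)).1.
split; split => //; apply: (integ_dom (m := mu2) _ iF) => //.
- exact: measurable_funX.
- by move=> p; rewrite ger0_norm ?sqr_ge0// /form_re -!expr2 lerDl sqr_ge0.
- exact: measurable_funX.
- by move=> p; rewrite ger0_norm ?sqr_ge0// /form_re -!expr2 lerDr sqr_ge0.
Qed.

Lemma integ_form f g : sqint mu f -> sqint mu g ->
  integ mu2 (form_re al a f g) /\ integ mu2 (form_im al a f g).
Proof.
move=> /sqint_coef[cf sf] /sqint_coef[cg sg]; split.
  by apply: integD; exact: sqint_mul.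
by apply: integB; exact: sqint_mul.
Qed.

Lemma frame_kernel : exists k : R -> R, [/\ integ mu k,
  \int[mu]_u `|k u| <= \int[mu]_u majorant al a u &
  forall f g, sqint mu f -> sqint mu g ->
  \int[mu2]_p form_re al a f g p =
    a * \int[mu]_t (f t * g t) + \int[mu]_t (conv k f t * g t)].
Proof.
have [k [ik kb hk]] := weighted_cvg; exists k; split => // f g hf hg.
have hl := @Rint_weighted_limit _ _ _ mu2 wgt (form_re al a f g) mwgt wgt01 wgt_cvg (integ_form hf hg).1.
exact: (cvg_unique (@Rhausdorff R) hl (hk f g hf hg)).
Qed.

Let coefN (phi : R -> R) s f x w : (forall y, phi (- y) = s * phi y) ->
  integ mu (fun t => f t * (envelope al a w (t - x) * phi (2 * pi * w * (t - x)))) ->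
  coef al a phi f (x, - w) = s * coef al a phi f (x, w).
Proof.
move=> hphi ii; rewrite /coef/= -RintegralZl//; apply: eq_Rintegral => t _.
by rewrite /envelope betaN mulrN mulNr hphi; ring.
Qed.

(** The cosine coefficients are even and the sine coefficients odd in [w]. *)
Lemma Rint_form_im f g : sqint mu f -> sqint mu g ->
  \int[mu2]_p form_im al a f g p = 0.
Proof.
move=> hf hg; have [_ ii] := integ_form hf hg.
have cosE (y : R) : cos (- y) = 1 * cos y by rewrite cosN mul1r.
have sinE (y : R) : sin (- y) = - 1 * sin y by rewrite sinN mulN1r.
rewrite -(RFubini1 ii).2.
rewrite (@ae_eq_Rint _ _ _ mu _ (fun=> 0)); first by rewrite Rintegral_cst// mul0r.
- exact: (measurable_Rint_snd mu (integ_meas ii)).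
- exact: measurable_cst.
have := ae_integrable1 ii; apply: lae_imp => x ix.
have odd w : form_im al a f g (x, - w) = - form_im al a f g (x, w).
  have icf := integ_coef al a (x, w) (@measurable_cos R) (@cos_max R) hf.
  have isf := integ_coef al a (x, w) (@measurable_sin R) (@sin_max R) hf.
  have icg := integ_coef al a (x, w) (@measurable_cos R) (@cos_max R) hg.
  have isg := integ_coef al a (x, w) (@measurable_sin R) (@sin_max R) hg.
  rewrite /form_im (coefN cosE icf) (coefN cosE icg) (coefN sinE isf) (coefN sinE isg).
  ring.
have mform : measurable_fun setT (fun w => form_im al a f g (x, w)) := integ_meas ix.
have := Rint_opp mform; under eq_Rintegral do rewrite odd -mulN1r.
by rewrite RintegralZl// mulN1r => h; lra.
Qed.

End frame_identity.

(** * Operators of the form c f + k * f *)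

Section real_operators.
Variable R : realType.
Local Notation mu := (@lebesgue_measure R).

Definition affine_conv (c : R) (k h : R -> R) (t : R) : R := c * h t + conv k h t.

Lemma sqint_affine_conv c k h : integ mu k -> sqint mu h ->
  sqint mu (affine_conv c k h) /\
  \int[mu]_t affine_conv c k h t ^+ 2 <=
    (2 * c ^+ 2 + 2 * (\int[mu]_u `|k u|) ^+ 2) * \int[mu]_t h t ^+ 2.
Proof.
move=> ik hh; have [sk bk] := sqint_conv ik hh.
have sA : sqint mu (affine_conv c k h) by apply: sqintD => //; exact: sqintZ.
split => //; have [mh ih] := hh.
have i1 : integ mu (fun t => 2 * c ^+ 2 * h t ^+ 2 + 2 * conv k h t ^+ 2).
  by apply: integD; apply: integZ => //; exact: sk.2.
apply: (@le_trans _ _ (\int[mu]_t (2 * c ^+ 2 * h t ^+ 2 + 2 * conv k h t ^+ 2))).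
  apply: le_Rint => //; first exact: sA.2.
  move=> t; have := sqr_ge0 (c * h t - conv k h t); rewrite /affine_conv.
  by move: (h t) (conv k h t) => x y; nra.
rewrite RintegralD//; [|exact: integZ|by apply: integZ; exact: sk.2].
rewrite !RintegralZl//; last exact: sk.2.
set I := \int[mu]_t h t ^+ 2 in bk *; set Q := (\int[mu]_u `|k u|) ^+ 2 in bk *.
have -> : (2 * c ^+ 2 + 2 * Q) * I = 2 * c ^+ 2 * I + 2 * (Q * I) by ring.
by rewrite lerD2l ler_pM2l.
Qed.

Lemma Rint_affine_conv c k f g : integ mu k -> sqint mu f -> sqint mu g ->
  \int[mu]_t (affine_conv c k f t * g t) =
    c * \int[mu]_t (f t * g t) + \int[mu]_t (conv k f t * g t).
Proof.
move=> ik hf hg; have [sk _] := sqint_conv ik hf.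
have i1 := sqint_mul hf hg; have i2 := sqint_mul sk hg.
rewrite -RintegralZl// -RintegralD//; last exact: integZ.
by apply: eq_Rintegral => t _; rewrite mulrDl mulrA.
Qed.

Lemma ae_affine_convD c k x y f g : integ mu k -> sqint mu f -> sqint mu g ->
  {ae mu, forall t, affine_conv c k (fun s => x * f s + y * g s) t =
    x * affine_conv c k f t + y * affine_conv c k g t}.
Proof.
move=> ik hf hg; have := ae_convD ik (sqintZ x hf) (sqintZ y hg).
have := ae_convZ x ik hf; have := ae_convZ y ik hg.
move=> h1 h2; move: (lae_imp2 (fun t p q => conj p q) h1 h2).
by apply: lae_imp2 => t [e1 e2] e3; rewrite /affine_conv e3 e1 e2; ring.
Qed.

(** Composition of two such operators has the kernel [c l + d k + k * l]. *)
Lemma affine_conv_inverse c d k l h : integ mu k -> integ mu l -> sqint mu h ->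
  c * d = 1 -> {ae mu, forall t, c * l t + d * k t + conv k l t = 0} ->
  {ae mu, forall t, affine_conv c k (affine_conv d l h) t = h t}.
Proof.
move=> ik il hh cd klz.
have mk : measurable_fun setT k := integ_meas ik.
have ml : measurable_fun setT l := integ_meas il.
have [mh _] := hh; have [slh _] := sqint_conv il hh.
have ikl := integ_conv ik il.
have mkl : measurable_fun setT (conv k l) := integ_meas ikl.
have e0 := ae_convD ik (sqintZ d hh) slh.
have e1 := ae_convZ d ik hh.
have e2 := ae_convA ik il hh.
have e3 := ae_integ_conv_sqint il hh.
have e4 := ae_integ_conv_sqint ik hh.
have icl := integZ c il; have idk := integZ d ik.
have e5 := ae_convDl (integD icl idk) ikl hh.
have e6 := ae_convDl icl idk hh.
move: (lae_imp2 (fun t p q => conj p q) e0 e1) => e01.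
move: (lae_imp2 (fun t p q => conj p q) e01 e2) => e012.
move: (lae_imp2 (fun t p q => conj p q) e3 e4) => e34.
move: (lae_imp2 (fun t p q => conj p q) e5 e6) => e56.
move: (lae_imp2 (fun t p q => conj p q) e34 e56) => e36.
move: e012 e36; apply: lae_imp2 => t [[h0 h1] h2] [[h3 h4] [h5 h6]].
have cz : conv (fun s => c * l s + d * k s + conv k l s) h t = 0.
  rewrite (@eq_conv _ _ (fun=> 0) h h)//.
  - by rewrite /conv; under eq_Rintegral do rewrite mul0r; rewrite Rintegral_cst// mul0r.
  - by apply: measurable_funD => //; apply: measurable_funD; exact: measurable_funM.
  - exact: aeW.
rewrite /affine_conv h0 h1 h2 mulrDr mulrA cd mul1r.
have : c * conv l h t + d * conv k h t + conv (conv k l) h t = 0.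
  by rewrite -cz h5 h6 (convZl c h3) (convZl d h4).
by move: (h t) (conv l h t) (conv k h t) (conv (conv k l) h t) => v w y z; lra.
Qed.

(** The inverse has the kernel of the Neumann series of [k / a], divided by [a]. *)
Lemma affine_conv_invertible (a : R) (k : R -> R) : 0 < a -> integ mu k -> \int[mu]_u `|k u| < a ->
  exists2 l, integ mu l & forall h, sqint mu h ->
    {ae mu, forall t, affine_conv a k (affine_conv a^-1 l h) t = h t} /\
    {ae mu, forall t, affine_conv a^-1 l (affine_conv a k h) t = h t}.
Proof.
move=> a0 ik ka; have an0 : a != 0 by rewrite gt_eqF.
have mk : measurable_fun setT k := integ_meas ik.
have [||r ir hr] := @neumann_kernel _ (fun t => a^-1 * k t); first exact: integZ.
  under eq_Rintegral do rewrite normrM (gtr0_norm (_ : 0 < a^-1)) ?invr_gt0//.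
  by rewrite RintegralZl ?integ_norm// mulrC ltr_pdivrMr// mul1r.
have mr : measurable_fun setT r := integ_meas ir.
have il := integZ a^-1 ir; exists (fun t => a^-1 * r t) => // h hh.
have ml : measurable_fun setT (fun t => a^-1 * r t) by exact: measurable_funM.
have E t : conv k (fun s => a^-1 * r s) t = conv (fun s => a^-1 * k s) r t.
  by apply: eq_Rintegral => s _; ring.
split; apply: affine_conv_inverse => //; rewrite ?mulfV ?mulVf//.
  move: hr; apply: lae_imp => t <-; rewrite mulrA mulfV// mul1r; congr (_ + _); exact: E.
move: hr; apply: lae_imp => t <-; rewrite mulrA mulfV// mul1r (addrC (a^-1 * _)); congr (_ + _).
by rewrite convC//; exact: E.
Qed.

End real_operators.

Section complex_square_integrable.
Variable R : realType.
Local Notation mu := (@lebesgue_measure R).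
Local Notation re f := (fun t => complex.Re (f t)).
Local Notation im f := (fun t => complex.Im (f t)).

Let energy (f : R -> R[i]) (t : R) : R := complex.Re (f t) ^+ 2 + complex.Im (f t) ^+ 2.

Let energy_ge0 f t : 0 <= energy f t.
Proof. by rewrite addr_ge0// sqr_ge0. Qed.

Let L2normE f : (L2norm f = (\int[mu]_t (energy f t)%:E) `^ 2^-1)%E.
Proof.
rewrite /L2norm unlock/=; congr (_ `^ _)%E; apply: eq_integral => t _ /=.
have -> : Normc.normc (f t) = Num.sqrt (energy f t) by rewrite /energy; case: (f t).
by rewrite ger0_norm ?sqrtr_ge0// powR_mulrn ?sqrtr_ge0// sqr_sqrtr// energy_ge0.
Qed.

Lemma L2P (f : R -> R[i]) : L2 f <-> sqint mu (re f) /\ sqint mu (im f).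
Proof.
have key : measurable_fun setT (re f) -> measurable_fun setT (im f) ->
    (L2norm f < +oo)%E <-> integ mu (energy f).
  move=> m1 m2; have me : measurable_fun setT (energy f).
    by apply: measurable_funD; exact: measurable_funX.
  have -> : integ mu (energy f) <-> (\int[mu]_t (energy f t)%:E < +oo)%E.
    rewrite (integP mu me).
    by under eq_integral do rewrite ger0_norm ?energy_ge0//.
  rewrite L2normE; split; last by move=> h; exact: poweR_lty.
  by apply: lty_poweRy; rewrite invr_eq0.
split.
  move=> [[m1 m2] /(key m1 m2) ie]; split; split => //; apply: (integ_dom (m := mu) _ ie).
  - exact: measurable_funX.
  - by move=> t; rewrite ger0_norm ?sqr_ge0// lerDl sqr_ge0.
  - exact: measurable_funX.
  - by move=> t; rewrite ger0_norm ?sqr_ge0// lerDr sqr_ge0.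
move=> [[m1 i1] [m2 i2]]; split => //; apply/(key m1 m2); exact: integD.
Qed.

Lemma L2norm_sqrt f : L2 f ->
  (L2norm f = (Num.sqrt (\int[mu]_t re f t ^+ 2 + \int[mu]_t im f t ^+ 2))%:E)%E.
Proof.
move=> /L2P[[m1 i1] [m2 i2]]; rewrite L2normE -EFin_Rintegral; last exact: integD.
rewrite RintegralD// poweR_EFin powR12_sqrt// addr_ge0//; exact: sq_Rint_ge0.
Qed.

Definition conv_op (c : R) (k : R -> R) (f : R -> R[i]) : R -> R[i] :=
  fun t => (affine_conv c k (re f) t +i* affine_conv c k (im f) t)%C.

Lemma L2_conv_op c k f : integ mu k -> L2 f -> L2 (conv_op c k f).
Proof.
move=> ik /L2P[h1 h2]; apply/L2P; split; first exact: (sqint_affine_conv c ik h1).1.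
exact: (sqint_affine_conv c ik h2).1.
Qed.

Lemma bounded_conv_op c k : integ mu k -> bounded_op (conv_op c k).
Proof.
move=> ik; split; first by move=> f; exact: L2_conv_op.
  move=> z f g /L2P[f1 f2] /L2P[g1 g2]; case: z => z1 z2.
  have e1 := ae_affine_convD c 1 1 ik (sqintD (sqintZ z1 f1) (sqintZ (- z2) f2)) g1.
  have e2 := ae_affine_convD c 1 1 ik (sqintD (sqintZ z1 f2) (sqintZ z2 f1)) g2.
  have e3 := ae_affine_convD c z1 (- z2) ik f1 f2.
  have e4 := ae_affine_convD c z1 z2 ik f2 f1.
  move: (lae_imp2 (fun t p q => conj p q) e1 e3) => e13.
  move: (lae_imp2 (fun t p q => conj p q) e2 e4) => e24.
  move: e13 e24; apply: lae_imp2 => t [h1 h3] [h2 h4].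
  apply/eqP; rewrite eq_complex /conv_op/=; apply/andP; split; apply/eqP.
    rewrite !mul1r in h1; rewrite h3 in h1; rewrite -mulNr -h1; congr affine_conv.
    by apply/funext => s; case: (f s) => x y; case: (g s) => x' y' /=; ring.
  rewrite !mul1r in h2; rewrite h4 in h2; rewrite -h2; congr affine_conv.
  by apply/funext => s; case: (f s) => x y; case: (g s) => x' y' /=; ring.
pose q := 2 * c ^+ 2 + 2 * (\int[mu]_u `|k u|) ^+ 2.
have q0 : 0 <= q by rewrite addr_ge0// mulr_ge0// sqr_ge0.
exists (Num.sqrt q) => f hf; rewrite !L2norm_sqrt//; last exact: L2_conv_op.
rewrite -EFinM lee_fin -sqrtrM// ler_wsqrtr//.
have [h1 h2] := (L2P f).1 hf.
by rewrite mulrDr; apply: lerD; [exact: (sqint_affine_conv c ik h1).2|exact: (sqint_affine_conv c ik h2).2].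
Qed.

Lemma invertible_conv_op a k : 0 < a -> integ mu k -> \int[mu]_u `|k u| < a ->
  boundedly_invertible (conv_op a k).
Proof.
move=> a0 ik ka; have [l il hl] := affine_conv_invertible a0 ik ka.
exists (conv_op a^-1 l); split; first exact: bounded_conv_op.
  move=> f /L2P[h1 h2]; move: (hl _ h1).2 (hl _ h2).2; apply: lae_imp2 => t e1 e2.
  by rewrite /conv_op/= e1 e2; case: (f t).
move=> f /L2P[h1 h2]; move: (hl _ h1).1 (hl _ h2).1; apply: lae_imp2 => t e1 e2.
by rewrite /conv_op/= e1 e2; case: (f t).
Qed.

End complex_square_integrable.

(** * The frame operator of an indicator window *)

Section frame_operator.
Variable R : realType.
Local Notation mu := (@lebesgue_measure R).
Local Notation mu2 := (mu \x mu)%E.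
Local Notation re f := (fun t => complex.Re (f t)).
Local Notation im f := (fun t => complex.Im (f t)).
Variables (al a : R).
Hypotheses (al0 : 0 <= al) (al1 : al < 1) (a0 : 0 < a).

Definition window (t : R) : R[i] := ((\1_(`[0, a]%classic : set R) t)%:C)%C.

Local Notation C f := (coef al a (@cos R) f).
Local Notation S f := (coef al a (@sin R) f).

Let atomE p t : atom al window p.1 p.2 t =
  ((envelope al a p.2 (t - p.1) * cos (2 * pi * p.2 * (t - p.1))) +i*
   (envelope al a p.2 (t - p.1) * sin (2 * pi * p.2 * (t - p.1))))%C.
Proof.
rewrite /atom /translation /modulation /dilation /cis /window /envelope.
by apply/eqP; rewrite eq_complex/=; apply/andP; split; apply/eqP; ring.
Qed.

Let inner_atom f p : L2 f -> inner f (atom al window p.1 p.2) =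
  ((C (re f) p + S (im f) p) +i* (C (im f) p - S (re f) p))%C.
Proof.
move=> /L2P[h1 h2].
have c1 := integ_coef al a p (@measurable_cos R) (@cos_max R) h1; have s1 := integ_coef al a p (@measurable_sin R) (@sin_max R) h1.
have c2 := integ_coef al a p (@measurable_cos R) (@cos_max R) h2; have s2 := integ_coef al a p (@measurable_sin R) (@sin_max R) h2.
apply/eqP; rewrite eq_complex /inner /cintegral; apply/andP; split; apply/eqP.
  rewrite [RHS]/= /coef -RintegralD//; apply: eq_Rintegral => t _; rewrite atomE.
  by case: (f t) => x y /=; ring.
rewrite [RHS]/= /coef -RintegralB//; apply: eq_Rintegral => t _; rewrite atomE.
by case: (f t) => x y /=; ring.
Qed.

Let atom_inner f p : L2 f -> inner (atom al window p.1 p.2) f =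
  ((C (re f) p + S (im f) p) +i* (S (re f) p - C (im f) p))%C.
Proof.
move=> /L2P[h1 h2].
have c1 := integ_coef al a p (@measurable_cos R) (@cos_max R) h1; have s1 := integ_coef al a p (@measurable_sin R) (@sin_max R) h1.
have c2 := integ_coef al a p (@measurable_cos R) (@cos_max R) h2; have s2 := integ_coef al a p (@measurable_sin R) (@sin_max R) h2.
apply/eqP; rewrite eq_complex /inner /cintegral; apply/andP; split; apply/eqP.
  rewrite [RHS]/= /coef -RintegralD//; apply: eq_Rintegral => t _; rewrite atomE.
  by case: (f t) => x y /=; ring.
rewrite [RHS]/= /coef -RintegralB//; apply: eq_Rintegral => t _; rewrite atomE.
by case: (f t) => x y /=; ring.
Qed.

Let inner_conv_op k f g : integ mu k -> L2 f -> L2 g -> inner (conv_op a k f) g =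
  ((\int[mu]_t (affine_conv a k (re f) t * re g t) + \int[mu]_t (affine_conv a k (im f) t * im g t)) +i*
   (\int[mu]_t (affine_conv a k (im f) t * re g t) - \int[mu]_t (affine_conv a k (re f) t * im g t)))%C.
Proof.
move=> ik /L2P[f1 f2] /L2P[g1 g2].
have [h1 _] := sqint_affine_conv a ik f1; have [h2 _] := sqint_affine_conv a ik f2.
apply/eqP; rewrite eq_complex /inner /cintegral; apply/andP; split; apply/eqP.
  rewrite [RHS]/= -RintegralD//; [|exact: sqint_mul..]; apply: eq_Rintegral => t _.
  by rewrite /conv_op; case: (g t) => x y /=; ring.
rewrite [RHS]/= -RintegralB//; [|exact: sqint_mul..]; apply: eq_Rintegral => t _.
by rewrite /conv_op; case: (g t) => x y /=; ring.
Qed.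

(** Both sides are expanded into the real and imaginary parts of [f] and [g]; the
real forms give the convolution forms, the imaginary ones integrate to 0. *)
Lemma frame_operator_conv_op k : integ mu k ->
  (forall f g, sqint mu f -> sqint mu g -> \int[mu2]_p form_re al a f g p =
    a * \int[mu]_t (f t * g t) + \int[mu]_t (conv k f t * g t)) ->
  represents_frame_operator al window (conv_op a k).
Proof.
move=> ik hk f g hf hg F.
have [[f1 f2] [g1 g2]] := ((L2P f).1 hf, (L2P g).1 hg).
have [r11 i11] := integ_form al0 al1 a0 f1 g1; have [r12 i12] := integ_form al0 al1 a0 f1 g2.
have [r21 i21] := integ_form al0 al1 a0 f2 g1; have [r22 i22] := integ_form al0 al1 a0 f2 g2.
have E1 : (fun p => complex.Re (F p)) = (fun p =>
    (form_re al a (re f) (re g) p + form_re al a (im f) (im g) p) +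
    (form_im al a (re f) (im g) p - form_im al a (im f) (re g) p)).
  apply/funext => p; rewrite /F inner_atom// atom_inner// /form_re /form_im /=; ring.
have E2 : (fun p => complex.Im (F p)) = (fun p =>
    (form_re al a (im f) (re g) p - form_re al a (re f) (im g) p) +
    (form_im al a (re f) (re g) p + form_im al a (im f) (im g) p)).
  apply/funext => p; rewrite /F inner_atom// atom_inner// /form_re /form_im /=; ring.
have R1 := integD r11 r22; have I1 := integB i12 i21.
have R2 := integB r21 r12; have I2 := integD i11 i22.
split.
  split.
    have := integD R1 I1; rewrite -E1; exact.
  have := integD R2 I2; rewrite -E2; exact.
rewrite inner_conv_op// /cintegral E1 E2.
rewrite !Rint_affine_conv// -!hk//.
rewrite (RintegralD _ R1 I1)// (RintegralD _ r11 r22)// (RintegralB _ i12 i21)//.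
rewrite (RintegralD _ R2 I2)// (RintegralB _ r21 r12)// (RintegralD _ i11 i22)//.
have z11 := Rint_form_im al0 al1 a0 f1 g1; have z12 := Rint_form_im al0 al1 a0 f1 g2.
have z21 := Rint_form_im al0 al1 a0 f2 g1; have z22 := Rint_form_im al0 al1 a0 f2 g2.
rewrite z11 z12 z21 z22.
by rewrite subr0 !addr0.
Qed.

Lemma L2_window : L2 window.
Proof.
have ib : integ mu (fun t => \1_(`[0, a]%classic : set R) t) by exact: integrable_indic_itv.
apply/L2P; split; split => //=.
- by exact: measurable_indic.
- rewrite (_ : (fun t => _) = (fun t => \1_(`[0, a]%classic : set R) t))//.
  by apply/funext => t; rewrite indicE; case: (_ \in _); rewrite ?expr0n ?expr1n.
- rewrite (_ : (fun t => _) = (fun=> 0)); first exact: integrable0.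
  by apply/funext => t; rewrite expr0n.
Qed.

Lemma window_neq0 : ~ {ae mu, forall t, window t = 0}.
Proof.
move=> [N [mN N0 hN]].
pose J : set R := `[0, a]%classic; have : (mu J <= mu N)%E.
  apply: le_measure; rewrite ?inE//.
    exact: measurable_itv.
  apply: (subset_trans _ hN) => t ta /= /eqP.
  by rewrite /window indicE mem_set// eq_complex/= oner_eq0.
by rewrite N0 /J lebesgue_measure_itv/= lte_fin a0 sube0 lee_fin leNgt a0.
Qed.

Lemma compactly_supported_window : compactly_supported window.
Proof.
pose J : set R := `[0, a]%classic.
have cJ : closed J by exact: itv_closed.
have EJ : closure J = J by apply/esym/closure_id.
apply: (@subclosed_compact _ _ J); [exact: closed_closure|exact: segment_compact|].
rewrite -EJ; apply: closure_subset => t /=; apply: contraPP => ta.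
by rewrite /window indicE memNset//= => /negP; apply; apply/eqP.
Qed.

End frame_operator.

Theorem mainTheorem2 (R : realType) (alpha : R) (h0 : 0 <= alpha)
    (h1 : alpha < 1) :
  exists psi : R -> R[i],
    [/\ L2 psi,
        ~ {ae @lebesgue_measure R, forall t, psi t = 0},
        compactly_supported psi
      & admissible alpha psi].
Proof.
pose p : R := (1 - alpha) / 2.
have p0 : 0 < p by rewrite divr_gt0// subr_gt0.
have p12 : p <= 2^-1 by rewrite ler_pdivrMr// mulVf// gerBl.
(* As p <= 1/2 and a >= 1, a^p is at most sqrt a = 48 / p, and the norm bound
   24 a^p / p is at most 24 * 48 / p^2 = a / 2. *)
pose a : R := (48 / p) ^+ 2.
have s0 : 0 < 48 / p by rewrite divr_gt0.
have a0 : 0 < a by rewrite exprn_gt0.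
have a1 : 1 <= a.
  rewrite exprn_ege1// ler_pdivlMr// mul1r (le_trans p12)//; lra.
have small : 24 * (a `^ p / p) < a.
  have : a `^ p <= 48 / p.
    by rewrite (le_trans (ler_powR a1 p12))// powR12_sqrt ?(ltW a0)// /a sqrtr_sqr (gtr0_norm s0).
  move=> h; apply: (@le_lt_trans _ _ (2^-1 * a)); last by rewrite gtr_pMl//; lra.
  have : a `^ p / p <= 48 / p / p by rewrite ler_pM2r// invr_gt0.
  rewrite /a; have -> : 2^-1 * (48 / p) ^+ 2 = 24 * (48 / p / p) by field; rewrite gt_eqF.
  by rewrite ler_pM2l.
have [k [ik kb hk]] := frame_kernel h0 h1 a0.
have ka := le_lt_trans kb (le_lt_trans (integ_majorant h0 h1 a0).2 small).
exists (window a); split.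
- exact: L2_window.
- exact: window_neq0.
- exact: compactly_supported_window.
exists (conv_op a k); split.
- exact: frame_operator_conv_op.
- exact: bounded_conv_op.
- exact: invertible_conv_op.
Qed.
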